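(* Let $x\in(0,1)$ be fixed and let $A_\varepsilon$, $\varepsilon^{-1}\in\mathbb N$, be the convolved medium described in the context, with $g$, $Z_\varepsilon$, $\mathbf H(s)$ as defined there. Define, for $\lambda\in\mathbb R^4$, $$\Lambda(\lambda):=\int_0^1\Lambda_{\beta(\xi)}\left(\|h\|_1\,\lambda\cdot\mathbf H(s)\right)ds .$$ Then $\Lambda\in C^\infty(\mathbb R^4)$ is a convex function such that $$\lim_{\varepsilon\to0}\varepsilon\log\mathbb E_\xi e^{\varepsilon^{-1}\lambda\cdot Z_\varepsilon}=\Lambda(\lambda).$$ If in addition $\Lambda$ is steep, then for fixed $\xi$, $Z_\varepsilon$ satisfies a large deviation principle with good convex rate function $$\Lambda^\ast(\ell):=\sup_{\lambda\in\mathbb R^4}\left[\lambda\cdot\ell-\Lambda(\lambda)\right],$$ and $u_\varepsilon=u_\varepsilon(x)$ satisfies a large deviation principle with good rate function $$I_{u_\varepsilon}(\ell):=\inf_{z\in g^{-1}\{\ell\}}\Lambda^\ast(z).$$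
   Context: $\xi$ is a random vector, $P_\xi=P[\,\cdot\mid\xi]$, $\mathbb E_\xi\{X\}=\mathbb E\{X\mid\xi\}$; all statements are for fixed $\xi$, under $P_\xi$. Only $\varepsilon$ with $\varepsilon^{-1}\in\mathbb N$ are considered. Medium: $A_\varepsilon(s)=A(s/\varepsilon)$ with $$\frac1{A(s)}:=\sum_{n=1}^\infty\mathbf 1_{[n-1,n)}(s)\,\gamma_n,\qquad\gamma_n:=\sum_{m=-\infty}^\infty h_{n-m}\beta_m,\qquad h_n\ge0,\quad\|h\|_1:=\sum_kh_k<\infty,$$ where $\{\beta_m\}_{m\in\mathbb Z}$ are non-negative i.i.d. random variables, each depending on the same random vector (parameter) $\xi$, with the law of a random variable $\beta=\beta(\xi)$. The $\gamma_n$ are assumed well defined, in the sense that $\phi_M(t):=\prod_{|k|<M}\mathbb E\{e^{ith_k\beta}\}$ has a continuous limit $\phi(t)$ as $M\to\infty$. The logarithmic moment generating function of $\beta$ is $\Lambda_{\beta}(t)=\Lambda_{\beta(\xi)}(t):=\log\mathbb E_\xi\{e^{t\beta}\}$. Equation: $f\in L^2([0,1])$ is deterministic, $F(s):=\int_0^sf(t)\,dt$, and $u_\varepsilon$ solves $-\frac{d}{dx}\left(A_\varepsilon\frac{d}{dx}u_\varepsilon\right)=f$ on $(0,1)$ with $u_\varepsilon(0)=u_\varepsilon(1)=0$ (it is assumed that $0<\nu_1(\omega,\varepsilon)\le A_\varepsilon\le\nu_2(\omega,\varepsilon)<\infty$). For the fixed $x\in(0,1)$, $$u_\varepsilon(x)=g(Z_\varepsilon),\quad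 g:\mathbb R^2\times(0,\infty)^2\to\mathbb R,\quad g(z_1,z_2,z_3,z_4)=-z_1+z_2\frac{z_3}{z_4},$$ where $Z_\varepsilon=(Z_{\varepsilon,1},\dots,Z_{\varepsilon,4})$, $Z_{\varepsilon,i}=\int_0^1\frac{H_i(s)}{A_\varepsilon(s)}\,ds$, and $$\mathbf H=(H_1,H_2,H_3,H_4)=(F\mathbf 1_{(0,x)},\,F,\,\mathbf 1_{(0,x)},\,1).$$ Steepness: for a convex $\Lambda:\mathbb R^n\to(-\infty,\infty]$ let $\mathcal D_\Lambda:=\{\lambda:\Lambda(\lambda)<\infty\}$, with interior $\mathcal D_\Lambda^\circ$. $\Lambda$ is steep if $\lim_{j\to\infty}|\nabla\Lambda(\lambda_j)|=\infty$ whenever $\{\lambda_j\}$ is a sequence in $\mathcal D_\Lambda^\circ$ converging to a boundary point of $\mathcal D_\Lambda^\circ$. Large deviations: a rate function is a lower semicontinuous $I:\mathbb R^n\to[0,\infty]$; it is good if all sublevel sets $\{y: I(y)\le\alpha\}$, $\alpha\in[0,\infty)$, are compact. A family of random vectors $Y_\varepsilon\in\mathbb R^n$ satisfies a large deviation principle with rate function $I$ (here with respect to $P_\xi$) if for all $\Gamma\subset\mathbb R^n$, with interior $\Gamma^\circ$ and closure $\bar\Gamma$, $$-\inf_{y\in\Gamma^\circ}I(y)\le\liminf_{\varepsilon\to0}\varepsilon\log P_\xi[Y_\varepsilon\in\Gamma]\le\limsup_{\varepsilon\to0}\varepsilon\log P_\xi[Y_\varepsilon\in\Gamma]\le-\i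nf_{y\in\bar\Gamma}I(y).$$
   Formalization: Λ may be +∞, so it is claimed C^∞ on the interior of its domain (on all of R^4 if Λ_β is finite); the LDPs assume 0 is interior to that domain; I_u as written is claimed if P_ξ(β=0)=0, and for general β with g extended by a/0=0. *)

(* Defs.v *)
From HB Require Import structures.
From mathcomp Require Import all_boot all_order all_algebra.
From mathcomp Require Import complex.
From mathcomp Require Import all_classical all_reals all_analysis.

Set Implicit Arguments.
Unset Strict Implicit.
Unset Printing Implicit Defensive.

Import Order.TTheory GRing.Theory Num.Theory.
Import numFieldNormedType.Exports.

Local Open Scope classical_set_scope.
Local Open Scope ring_scope.

(* The admissible scales: the inverses of the positive integers. *)
Definition scale {R : realType} (N : nat) : R := N.+1%:R^-1.

Section Functions.
Context {R : realType} {n : nat}.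
Implicit Types (L : 'rV[R]_n -> \bar R) (f : 'rV[R]_n -> R).

Definition dot (u v : 'rV[R]_n) : R := \sum_i u 0 i * v 0 i.

Definition effdom L : set 'rV[R]_n := [set l | (L l < +oo)%E].

(* At t = 0 and t = 1 the convention 0 * oo = 0 gives the intended value. *)
Definition econvex L : Prop := forall (t : R) (l m : 'rV[R]_n), 0 <= t <= 1 ->
  (L (t *: l + (1 - t) *: m)%R <= t%:E * L l + (1 - t)%:E * L m)%E.

Definition partial_deriv (i : 'I_n) f : 'rV[R]_n -> R :=
  fun l => 'D_(delta_mx 0 i) f l.

Definition iter_partial (s : seq 'I_n) f : 'rV[R]_n -> R :=
  foldr partial_deriv f s.

(* C^oo on the open set U: all partial derivatives of all orders exist and are
   continuous at the points of U. *)
Definition smooth_on (U : set 'rV[R]_n) f : Prop :=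
  forall (s : seq 'I_n) (l : 'rV[R]_n), U l ->
    {for l, continuous (iter_partial s f)} /\
    forall i : 'I_n, derivable (iter_partial s f) l (delta_mx 0 i).

Definition gradient f (l : 'rV[R]_n) : 'rV[R]_n := \row_i partial_deriv i f l.

(* The norm on row vectors is the max norm, which diverges exactly when the
   Euclidean norm does. *)
Definition steep L : Prop :=
  forall (l_ : nat -> 'rV[R]_n) (l : 'rV[R]_n),
    (forall j, interior (effdom L) (l_ j)) ->
    l_ @ \oo --> l ->
    closure (interior (effdom L)) l -> ~ interior (effdom L) l ->
    `|gradient (fine \o L) (l_ j)| @[j --> \oo] --> +oo.

Definition legendre L : 'rV[R]_n -> \bar R := fun y =>
  ereal_sup [set ((dot l y)%:E - L l)%E | l in [set: 'rV[R]_n]].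

End Functions.

Section LargeDeviations.
Context {R : realType} {E : topologicalType}.
Local Open Scope ereal_scope.

Definition rate_function (I : E -> \bar R) : Prop :=
  (forall y, 0 <= I y) /\ lower_semicontinuous I.

Definition good_rate_function (I : E -> \bar R) : Prop :=
  rate_function I /\
  forall a : R, (0 <= a)%R -> compact [set y | I y <= a%:E].

Definition borel_measurable d (T : measurableType d) (Y : T -> E) : Prop :=
  forall U : set E, open U -> measurable (Y @^-1` U).

(* G ranges over all subsets of E for which the probabilities P[Y_eps \in G]
   are defined; this includes all Borel subsets. *)
Definition ldp d (T : measurableType d) (P : probability T R)
    (Y : R -> T -> E) (I : E -> \bar R) : Prop :=
  (forall N, borel_measurable (Y (scale N))) /\
  forall G : set E, (forall N, measurable (Y (scale N) @^-1` G)) ->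
    let u N := (scale N)%:E * lne (P (Y (scale N) @^-1` G)) in
    [/\ - ereal_inf [set I y | y in interior G] <= limn_einf u,
        limn_einf u <= limn_esup u &
        limn_esup u <= - ereal_inf [set I y | y in closure G]].

End LargeDeviations.

Section Probability.
Context {R : realType} d {T : measurableType d}.
Variable P : probability T R.

Definition mutually_independent (X : int -> {RV P >-> R}) : Prop :=
  forall (s : seq int) (B : int -> set R), uniq s ->
    (forall m, measurable (B m)) ->
    P (\bigcap_(m in [set` s]) (X m @^-1` B m)) =
    (\prod_(m <- s) P (X m @^-1` B m))%E.

Definition log_mgf (X : {RV P >-> R}) (t : R) : \bar R := lne ('M_P X t).

(* E[exp (i t X)] *)
Definition charfun (X : {RV P >-> R}) (t : R) : R[i] :=
  Complex (fine ('E_P[fun w => cos (t * X w)])%E)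
          (fine ('E_P[fun w => sin (t * X w)])%E).

(* The product over the integers k with |k| < M, written as k = j - (M - 1)
   with 0 <= j < 2M - 1. *)
Definition phi_prod (h : int -> R) (X : {RV P >-> R}) (M : nat) (t : R) : R[i] :=
  \prod_(j < (M.*2).-1) charfun X (t * h (j%:Z - M.-1%:Z)).

Definition convolution_well_defined (h : int -> R) (X : {RV P >-> R}) : Prop :=
  exists2 phi : R -> R[i]^o, continuous phi &
    forall t : R, (phi_prod h X M t : R[i]^o) @[M --> \oo] --> phi t.

End Probability.

Section Medium.
Context {R : realType} d {T : measurableType d}.
Variables (h : int -> R) (beta_ : int -> T -> R).
Local Notation mu := (@lebesgue_measure R).

Definition l1norm : \bar R := \esum_(k in [set: int]) (h k)%:E.

Definition gamma (k : int) (w : T) : \bar R :=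
  \esum_(m in [set: int]) (h (k - m) * beta_ m w)%:E.

Definition inv_medium (w : T) (s : R) : \bar R :=
  (\sum_(1 <= k <oo) (\1_(`[k.-1%:R, k%:R[ : set R) s)%:E * gamma k%:Z w)%E.

(* If gamma is 0 or +oo on a cell then medium is 0 there, so that a positive
   lower bound on medium excludes both cases. *)
Definition medium (w : T) (s : R) : R := (fine (inv_medium w s))^-1.

Definition medium_eps (eps : R) (w : T) (s : R) : R := medium w (s / eps).

Definition antideriv (f : R -> R) (s : R) : R := \int[mu]_(t in `[0, s]) f t.

Definition H (f : R -> R) (x s : R) : 'rV[R]_4 :=
  \row_i [tuple antideriv f s * \1_(`]0, x[ : set R) s; antideriv f s;
                \1_(`]0, x[ : set R) s; 1]`_i.

Definition Z (f : R -> R) (x eps : R) (w : T) : 'rV[R]_4 :=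
  \row_i \int[mu]_(s in `[0, 1]) (H f x s 0 i / medium_eps eps w s).

(* g is given by its formula on all of R^4, with the convention a / 0 = 0;
   g_dom is its domain R^2 x (0, oo)^2. The vector Z lies in the closed cone
   |z_1| <= C z_3, |z_2| <= C z_4, 0 <= z_3 <= z_4, on which z_4 = 0 forces
   z = 0; there the convention gives the continuous extension g 0 = 0. *)
Definition g (z : 'rV[R]_4) : R :=
  - z 0 (inord 0) + z 0 (inord 1) * (z 0 (inord 2) / z 0 (inord 3)).

Definition g_dom : set 'rV[R]_4 :=
  [set z | 0 < z 0 (inord 2) /\ 0 < z 0 (inord 3)].

(* I_u(l) = inf { J z | z in D, g z = l } *)
Definition contracted_rate (D : set 'rV[R]_4) (J : 'rV[R]_4 -> \bar R)
    (l : R) : \bar R :=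
  ereal_inf [set J z | z in D `&` g @^-1` [set l]].

(* - (a u')' = f on (0, 1), u(0) = u(1) = 0, for f in L^2 and a bounded
   coefficient a: u is absolutely continuous with derivative v, and the flux
   a v agrees a.e. with an absolutely continuous q whose derivative is -f. *)
Definition solves_bvp (a f u : R -> R) : Prop :=
  exists v q : R -> R,
  [/\ mu.-integrable `[0, 1] (EFin \o v),
      forall y, 0 <= y <= 1 -> u y = u 0 + \int[mu]_(s in `[0, y]) v s,
      forall y, 0 <= y <= 1 -> q y = q 0 - \int[mu]_(s in `[0, y]) f s,
      {ae mu, forall s, 0 < s < 1 -> a s * v s = q s} &
      u 0 = 0 /\ u 1 = 0].

End Medium.

Definition Lambda {R : realType} d {T : measurableType d}
    (P : probability T R) (h : int -> R) (beta : {RV P >-> R})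
    (f : R -> R) (x : R) (l : 'rV[R]_4) : \bar R :=
  (\int[@lebesgue_measure R]_(s in `[0%R, 1%R])
     log_mgf beta (fine (l1norm h) * dot l (H f x s))%R)%E.

(* Main.v *)
Require Import Defs.
From HB Require Import structures.
From mathcomp Require Import all_boot all_order all_algebra.
From mathcomp Require Import finmap.
From mathcomp Require Import all_classical all_reals all_analysis.
From mathcomp Require Import measurable_realfun.
From mathcomp Require Import ring lra zify.

Set Implicit Arguments.
Unset Strict Implicit.
Unset Printing Implicit Defensive.

Import Order.TTheory GRing.Theory Num.Theory.
Import numFieldNormedType.Exports.

Local Open Scope classical_set_scope.
Local Open Scope ring_scope.

(** Put n = 1 / epsilon and phi = lambda . H. Then n lambda . Z_epsilon is the sum
    over m of t_m beta_m, where t_m is the sum over 1 <= k <= n of h_(k-m) y_k and y_k is the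
    mean of phi on the k-th cell. By Fatou and independence E exp(n lambda . Z) is
    at most the product of the E exp(t_m beta_m), and Jensen's inequality bounds
    this product by exp(n Lambda(lambda)) for every n. Conversely, the indices m
    outside 1..n cost only a factor exp(- o(n)), because the numbers
    - log E exp(- B h_j beta) are summable; and t_m tends to ||h|| phi(s) when m/n
    tends to s, for almost every s, so that Fatou's lemma and the lower
    semicontinuity of the log-moment generating function give the matching lower
    bound, including at the points where Lambda is infinite.

    The principle for Z follows from the Gartner-Ellis argument: steepness forces
    the minimizer of Lambda - lambda . y + c |lambda|^2 into the interior of the
    domain, where the gradient of Lambda is then close to y. Finally
    u_epsilon(x) = g(Z_epsilon) almost surely, and Z_epsilon stays in a closed cone
    on which g is continuous, so the contraction principle applies. *)

(** * Limits in the extended reals and exponential rates *)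

(** Two obstacles shape the proof. First, [Lambda] may be infinite and no positive exponential
    moment of beta is assumed, so the infinitely many indices outside 1..n cannot be treated as an
    error bounded above. Jensen avoids a remainder: index m gives the cell k the weight h_(k-m) /
    ||h||, and summing over all m gives each cell weight exactly 1. In the lower bound t_m is
    replaced outside 1..n by a nonpositive coefficient; as beta >= 0, the log-moment generating
    function is finite there. The summability needed comes from E exp(- B gamma_1) > 0, true because
    gamma_1 is almost surely finite. Second, to differentiate [Lambda] the arguments ||h|| lambda .
    H(s) must stay, uniformly in s, inside the domain of the log-moment generating function. As the
    last coordinate of H is 1, moving lambda along that axis raises all arguments equally, and
    finiteness of [Lambda] at the shifted point provides the margin. For the contraction, g is
    singular at z_4 = 0; on the cone |g z| <= 2 C z_3, which vanishes there. *)

Section ereal_reals.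
Context {R : realType}.
Local Open Scope ereal_scope.
Implicit Types (x y : \bar R) (u : (\bar R)^nat).

Lemma lte_real_between x y : x < y -> exists r : R, x < r%:E /\ r%:E < y.
Proof.
move: x y => [x| |] [y| |] //= xy.
- exists ((x + y) / 2)%R; rewrite !lte_fin; move: xy; rewrite lte_fin => xy.
  by split; lra.
- by exists (x + 1)%R; rewrite lte_fin ltrDl ltr01 ltry.
- by exists (y - 1)%R; rewrite lte_fin gtrBl ltr01 ltNyr.
- by exists 0%R; rewrite ltNyr ltry.
Qed.

Lemma lee_real_gt x y : (forall v : R, x < v%:E -> y <= v%:E) -> y <= x.
Proof.
move=> H; rewrite leNgt; apply/negP => /lte_real_between[r [xr ry]].
by have := H r xr; rewrite leNgt ry.
Qed.

Lemma lee_real_lt x y : (forall v : R, v%:E < x -> v%:E <= y) -> x <= y.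
Proof.
move=> H; rewrite leNgt; apply/negP => /lte_real_between[r [yr rx]].
by have := H r rx; rewrite leNgt yr.
Qed.

Lemma limn_esup_le_near u x :
  (forall v : R, x < v%:E -> \forall N \near \oo, u N <= v%:E) ->
  limn_esup u <= x.
Proof.
move=> H; apply: lee_real_gt => v /H Hv.
apply: ereal_inf_le; exists (ereal_sup (u @` [set N | u N <= v%:E])).
  by exists [set N | u N <= v%:E].
by apply: ge_ereal_sup => _ [N + <-].
Qed.

Lemma limn_einf_ge_near u x :
  (forall v : R, v%:E < x -> \forall N \near \oo, v%:E <= u N) ->
  x <= limn_einf u.
Proof.
move=> H; rewrite /limn_einf leeNr; apply: limn_esup_le_near => v.
rewrite lteNl => /(H (- v)%R)/=; apply: filterS => N.
by rewrite EFinN leeNl.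
Qed.

Lemma near_lt_limn_einf u (v : R) :
  v%:E < limn_einf u -> \forall N \near \oo, v%:E < u N.
Proof.
rewrite /limn_einf lteNr => /ereal_inf_lt[_ [V VF <-]] supV.
move: VF; apply: filterS => N VN; rewrite -lteN2.
by apply: le_lt_trans supV; apply: ereal_sup_ubound; exists N.
Qed.

(** Only real levels v are tested, so that infinite limits x need no case of their own; the limit is
    squeezed between running infima and suprema. *)
Lemma cvge_real_bounds u x :
  (forall v : R, x < v%:E -> \forall N \near \oo, u N <= v%:E) ->
  (forall v : R, v%:E < x -> \forall N \near \oo, v%:E <= u N) ->
  u @ \oo --> x.
Proof.
move=> H1 H2.
have e1 : limn_esup u = x.
  apply/eqP; rewrite eq_le limn_esup_le_near//=.
  by apply: le_trans (limn_einf_sup u); exact: limn_einf_ge_near.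
have e2 : limn_einf u = x.
  apply/eqP; rewrite eq_le limn_einf_ge_near// andbT.
  by apply: le_trans (limn_einf_sup u) _; exact: limn_esup_le_near.
apply: (@squeeze_cvge _ _ _ _ (einfs u) u (esups u)).
- by near=> N; rewrite ereal_inf_lbound ?ereal_sup_ubound//; exists N => /=.
- by rewrite -e2 limn_einf_lim; exact: is_cvg_einfs.
- by rewrite -e1 limn_esup_lim; exact: is_cvg_esups.
Unshelve. all: by end_near. Qed.

Lemma cvge_near_lt u x (v : R) :
  u @ \oo --> x -> x < v%:E -> \forall N \near \oo, u N < v%:E.
Proof.
move=> ux xv; apply: (ux [set y | y < v%:E]).
by apply: open_nbhs_nbhs; split => //; exact: open_ereal_lt_ereal.
Qed.

Lemma cvge_near_gt u x (v : R) :
  u @ \oo --> x -> v%:E < x -> \forall N \near \oo, v%:E < u N.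
Proof.
move=> ux xv; apply: (ux [set y | v%:E < y]).
by apply: open_nbhs_nbhs; split => //; exact: open_ereal_gt_ereal.
Qed.

End ereal_reals.

Section dot_product.
Context {R : realType} {n : nat}.
Implicit Types (l m z : 'rV[R]_n) (a s : R).

Lemma dotDl l m z : dot (l + m) z = dot l z + dot m z.
Proof.
by rewrite /dot -big_split; apply: eq_bigr => i _; rewrite mxE mulrDl.
Qed.

Lemma dotZl a l z : dot (a *: l) z = a * dot l z.
Proof.
by rewrite /dot big_distrr; apply: eq_bigr => i _; rewrite mxE -mulrA.
Qed.

Lemma dotC l z : dot l z = dot z l.
Proof. by apply: eq_bigr => i _; rewrite mulrC. Qed.

Lemma dot0l z : dot 0 z = 0.
Proof. by rewrite -(scale0r (0 : 'rV[R]_n)) dotZl mul0r. Qed.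

Lemma dotNl l z : dot (- l) z = - dot l z.
Proof. by rewrite -scaleN1r dotZl mulN1r. Qed.

Lemma dot_delta i z : dot (delta_mx 0 i) z = z 0 i.
Proof.
rewrite /dot (bigD1 i)//= big1 ?addr0 ?mxE ?eqxx ?mul1r// => j ji.
by rewrite mxE (negbTE ji) andbF mul0r.
Qed.

Lemma coord_le_norm z i : `|z 0 i| <= `|z|.
Proof.
rewrite [leRHS]/Num.norm/= mx_normrE.
by apply/bigmax_geP; right => /=; exists (ord0, i).
Qed.

Lemma norm_le_coord z a : 0 <= a -> (forall i, `|z 0 i| <= a) -> `|z| <= a.
Proof.
move=> a0 H; rewrite [leLHS]/Num.norm/= mx_normrE.
by apply/bigmax_leP; split => // -[i j] _ /=; rewrite ord1.
Qed.

Definition l1 l : R := \sum_i `|l 0 i|.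

Lemma l1_ge0 l : 0 <= l1 l. Proof. exact: sumr_ge0. Qed.

Lemma dot_le_coord l z a : (forall i, `|z 0 i| <= a) -> `|dot l z| <= l1 l * a.
Proof.
move=> H; apply: le_trans (ler_norm_sum _ _ _) _.
rewrite /l1 mulr_suml; apply: ler_sum => i _; rewrite normrM.
exact: ler_wpM2l.
Qed.

Lemma continuous_dot l : continuous (dot l).
Proof.
move=> z; apply: (@cvg_big _ _ +%R 0 xpredT add_continuous _ (nbhs z)) => i _.
by apply: cvgM; [exact: cvg_cst|exact: coord_continuous].
Qed.

Lemma open_halfspace l a : open [set z | a < dot l z].
Proof.
apply: (@open_comp _ _ (dot l) [set x | a < x]); last exact: open_gt.
by move=> z _; exact: continuous_dot.
Qed.

Lemma compact_box a : compact [set z : 'rV[R]_n | forall i, `|z 0 i| <= a].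
Proof.
have := @rV_compact R n (fun=> `[- a, a]%classic) (fun=> @segment_compact R _ _).
congr compact; apply/seteqP; split => z /= H i; have := H i;
  by rewrite in_itv/= ler_norml.
Qed.

Lemma closed_box a : closed [set z : 'rV[R]_n | forall i, `|z 0 i| <= a].
Proof. by apply: compact_closed; [exact: norm_hausdorff|exact: compact_box]. Qed.

End dot_product.

Lemma borel_measurable_closed {E : topologicalType} d (T : measurableType d)
    (Y : T -> E) (F : set E) :
  borel_measurable Y -> closed F -> measurable (Y @^-1` F).
Proof.
move=> mY cF; rewrite -(setCK F) -preimage_setC.
by apply: measurableC; apply: mY; rewrite openC.
Qed.

Section exponential_rates.
Context {R : realType}.
Local Open Scope ereal_scope.

Lemma scale_gt0 N : (0 < scale N :> R)%R.
Proof. by rewrite invr_gt0. Qed.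

(** Passage between the logarithmic and the exponential scale; it includes a = 0 and a = +oo, where
    [lne] is infinite. *)
Lemma rate_le N (a : \bar R) (v : R) : 0 <= a ->
  ((scale N)%:E * lne a <= v%:E) = (a <= (expR (N.+1%:R * v))%:E).
Proof.
move=> a0; rewrite lee_pdivrMl// -EFinM -[LHS]lee_expeR lneK//.
by rewrite in_itv/= a0 leey.
Qed.

Lemma rate_lt N (a : \bar R) (v : R) : 0 <= a ->
  ((scale N)%:E * lne a < v%:E) = (a < (expR (N.+1%:R * v))%:E).
Proof.
move=> a0; rewrite lte_pdivrMl// -EFinM -[LHS]lte_expeR lneK//.
by rewrite in_itv/= a0 leey.
Qed.

Lemma rate_ge N (a : \bar R) (v : R) : 0 <= a ->
  (v%:E <= (scale N)%:E * lne a) = ((expR (N.+1%:R * v))%:E <= a).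
Proof. by move=> a0; rewrite leNgt rate_lt// -leNgt. Qed.

(** Any gap between rates absorbs a constant factor: exp y >= 1 + y exceeds k as soon as y = (N + 1)
    (b - a) does. *)
Lemma near_expR_le (k : nat) (a b : R) : (a < b)%R ->
  \forall N \near \oo, (k%:R * expR (N.+1%:R * a) <= expR (N.+1%:R * b))%R.
Proof.
move=> ab; have ba : (0 < b - a)%R by rewrite subr_gt0.
near=> N; have -> : (N.+1%:R * b = N.+1%:R * (b - a) + N.+1%:R * a)%R by ring.
rewrite expRD ler_wpM2r ?expR_ge0//.
apply: le_trans (expR_ge1Dx _).
have kN : (k%:R / (b - a) <= N%:R)%R by near: N; exact: nbhs_infty_ger.
have : (k%:R <= N%:R * (b - a))%R by rewrite -ler_pdivrMr.
have -> : (N.+1%:R = N%:R + 1 :> R)%R by rewrite natr1.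
move=> h; apply: le_trans h _; nra.
Unshelve. all: by end_near. Qed.

End exponential_rates.

Section exponential_chebyshev.
Context {R : realType} {d} {T : measurableType d} (P : probability T R).
Local Open Scope ereal_scope.

Lemma exp_markov_set (X : T -> R) (A : set T) (a : R) :
  measurable_fun setT X -> measurable A -> (forall w, A w -> (a <= X w)%R) ->
  P A * (expR a)%:E <= \int[P]_(w in A) (expR (X w))%:E.
Proof.
move=> mX mA AX; rewrite muleC -integral_cst//.
apply: ge0_le_integral => //.
- by move=> w _; rewrite lee_fin expR_ge0.
- apply/measurable_EFinP; apply: measurableT_comp => //.
  exact: measurable_funTS.
- by move=> w Aw; rewrite lee_fin ler_expR AX.
Qed.

Lemma exp_markov (X : T -> R) (A : set T) (a : R) :
  measurable_fun setT X -> measurable A -> (forall w, A w -> (a <= X w)%R) ->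
  P A <= (expR (- a))%:E * 'E_P[fun w => expR (X w)].
Proof.
move=> mX mA AX.
have := exp_markov_set mX mA AX.
rewrite -lee_pdivlMr ?expR_gt0// -expRN muleC => /le_trans; apply.
apply: lee_wpmul2l; first by rewrite lee_fin expR_ge0.
rewrite unlock; apply: ge0_subset_integral => //.
by apply/measurable_EFinP; exact: measurableT_comp.
Qed.

End exponential_chebyshev.

(** * The Legendre transform and the Gartner-Ellis theorem *)

Section legendre_transform.
Context {R : realType} {n : nat}.
Variable L : 'rV[R]_n -> \bar R.
Local Open Scope ereal_scope.

Lemma legendre_ub l y : (dot l y)%:E - L l <= legendre L y.
Proof. by apply: ereal_sup_ubound; exists l. Qed.

Lemma legendre_gt_ex x y : x < legendre L y ->
  exists l, x < (dot l y)%:E - L l.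
Proof. by move=> /ereal_sup_gt[_ [l _ <-]]; exists l. Qed.

Hypothesis L0 : L 0%R = 0.
Hypothesis L_gtNy : forall l, -oo < L l.

Lemma legendre_ge0 y : 0 <= legendre L y.
Proof. by have := legendre_ub 0 y; rewrite dot0l L0 sube0. Qed.

(** Together with [halfspace_legendre_gt] this writes each superlevel set as a union of open
    half-spaces: that makes the transform lower semicontinuous, and half-spaces are the sets that
    Chebyshev's inequality controls. *)
Lemma legendre_gt_halfspace (a : R) y : a%:E < legendre L y ->
  exists l (b : R), [/\ L l < b%:E & (a + b < dot l y)%R].
Proof.
move=> /legendre_gt_ex[l]; have := L_gtNy l; case E : (L l) => [r| |]//= _.
rewrite -EFinB lte_fin => h.
exists l, ((r + (dot l y - a)) / 2)%R; rewrite E lte_fin; split; lra.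
Qed.

Lemma halfspace_legendre_gt (a b : R) l y : L l < b%:E ->
  (a + b < dot l y)%R -> a%:E < legendre L y.
Proof.
move=> Lb ab; apply: lt_le_trans (legendre_ub l y).
have := L_gtNy l; case E : (L l) => [r| |]//= _; last by rewrite E in Lb.
by move: Lb; rewrite E -EFinB !lte_fin => rb; lra.
Qed.

Lemma legendre_lsc : lower_semicontinuous (legendre L).
Proof.
move=> y a /legendre_gt_halfspace[l [b [Lb ab]]].
exists [set z | a + b < dot l z]%R; last by move=> z; exact: halfspace_legendre_gt.
by apply: open_nbhs_nbhs; split => //; exact: open_halfspace.
Qed.

Lemma econvex_legendre : econvex (legendre L).
Proof.
move=> t y z /andP[t0 t1].
have [->|tn0] := eqVneq t 0%R.
  by rewrite scale0r add0r subr0 scale1r mul0e add0e mul1e.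
have [->|tn1] := eqVneq t 1%R.
  by rewrite subrr scale0r addr0 scale1r mul0e adde0 mul1e.
have {tn0}t0 : (0 < t)%R by rewrite lt_neqAle eq_sym tn0.
have {tn1}t1 : (0 < 1 - t)%R by rewrite subr_gt0 lt_neqAle tn1.
apply: ge_ereal_sup => _ [l _ <-].
apply: (@le_trans _ _
    (t%:E * ((dot l y)%:E - L l) + (1 - t)%:E * ((dot l z)%:E - L l))).
  have := L_gtNy l; case E : (L l) => [r| |]//= _.
    rewrite -!EFinB -!EFinM -EFinD lee_fin.
    rewrite (dotC l (_ + _)%R) dotDl !dotZl !(dotC _ l); lra.
  by rewrite addeNy leNye.
by apply: leeD; (apply: lee_wpmul2l; [rewrite lee_fin ltW|exact: legendre_ub]).
Qed.

Hypothesis int0 : interior (effdom L) 0%R.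

(** A common bound at the 2n points on the axes; tightness, compact sublevel sets and the gradient
    bound below use the interior hypothesis in this form. *)
Lemma effdom_axes : exists2 s : R, (0 < s)%R &
  exists b : R, forall i, L (s *: delta_mx 0 i)%R < b%:E /\
    L (- (s *: delta_mx 0 i))%R < b%:E.
Proof.
have /nbhs_ballP[e /= e0 eD] := int0.
have norm_se (s : R) i : (`|s| = e / 2)%R -> effdom L (s *: delta_mx 0 i)%R.
  move=> se; apply: eD; rewrite -ball_normE/= sub0r normrN normrZ se.
  apply: (@le_lt_trans _ _ (e / 2 * 1)%R); last by rewrite mulr1 gtr_pMr// invf_lt1 ?ltr1n.
  apply: ler_wpM2l; first by rewrite divr_ge0// ltW.
  by apply: norm_le_coord => // j; rewrite mxE; case: (_ && _); rewrite ?normr1 ?normr0.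
have e2 : (0 < e / 2)%R by rewrite divr_gt0.
exists (e / 2)%R => //.
pose F (i : 'I_n) := maxe (L (e / 2 *: delta_mx 0 i)%R) (L (- (e / 2 *: delta_mx 0 i))%R).
have Ffin i : F i < +oo.
  rewrite /F gt_max; apply/andP; split; first by apply: norm_se; rewrite gtr0_norm.
  by rewrite -scaleNr; apply: norm_se; rewrite normrN gtr0_norm.
have Fr i : exists r : R, F i < r%:E.
  by have [r [Fr _]] := lte_real_between (Ffin i); exists r.
have [r Hr] := choice Fr.
exists (\big[Num.max/0%R]_i r i) => i.
have : F i < (\big[Num.max/0%R]_i r i)%:E.
  by apply: lt_le_trans (Hr i) _; rewrite lee_fin; exact: le_bigmax.
by rewrite gt_max => /andP.
Qed.

Lemma legendre_good : good_rate_function (legendre L).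
Proof.
split; first by split; [exact: legendre_ge0|exact: legendre_lsc].
move=> a _; apply: bounded_closed_compact.
- have [s s0 [b Hb]] := effdom_axes.
  (* Testing the transform at the points +- s e_i gives s |y_i| <= a + b on the sublevel set. *)
  pose M := (`|a + b| / s + 1)%R.
  exists M; split; first exact: num_real.
  move=> x Mx y /= ya; apply: le_trans (ltW Mx); apply: norm_le_coord.
    by rewrite addr_ge0// divr_ge0// ltW.
  move=> i; rewrite leNgt; apply/negP => Myi.
  have sM : (a + b < s * `|y 0%R i|)%R.
    have := ler_norm (a + b)%R => h1.
    have : (s * M < s * `|y 0%R i|)%R by rewrite ltr_pM2l.
    apply: le_lt_trans; rewrite /M mulrDr mulr1 mulrCA divff ?gt_eqF// mulr1.
    by rewrite (le_trans h1)// lerDl ltW.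
  have [H1 H2] := Hb i.
  suff : a%:E < legendre L y by rewrite ltNge ya.
  have [y0|y0] := leP 0%R (y 0%R i).
    apply: (halfspace_legendre_gt H1).
    by rewrite dotZl dot_delta; rewrite ger0_norm in sM.
  apply: (halfspace_legendre_gt H2).
  by rewrite dotNl dotZl dot_delta -mulrN; rewrite ltr0_norm in sM.
- rewrite -openC; have -> : ~` [set y | legendre L y <= a%:E] =
    [set y | a%:E < legendre L y].
    by apply/seteqP; split => y /=; rewrite ltNge => /negP.
  by move/lower_semicontinuousP : legendre_lsc; exact.
Qed.

End legendre_transform.

(** * The large deviation upper bound *)

Section ldp_upper_bound.
Context {R : realType} {d} {T : measurableType d} (P : probability T R) {n : nat}.
Variables (Z : nat -> T -> 'rV[R]_n) (L : 'rV[R]_n -> \bar R).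
Hypothesis mZ : forall N, borel_measurable (Z N).
Local Open Scope ereal_scope.

Definition scaled_mgf N l : \bar R :=
  'E_P[fun w => expR ((scale N)^-1 * dot l (Z N w))].

Lemma scaled_mgfE N l :
  scaled_mgf N l = \int[P]_w (expR (N.+1%:R * dot l (Z N w)))%:E.
Proof. by rewrite /scaled_mgf unlock /scale invrK. Qed.

Lemma scaled_mgf_ge0 N l : 0 <= scaled_mgf N l.
Proof.
by rewrite scaled_mgfE; apply: integral_ge0 => w _; rewrite lee_fin expR_ge0.
Qed.

Lemma measurable_dot N l : measurable_fun setT (fun w => dot l (Z N w)).
Proof.
apply: (measurability _ (RGenOInfty.measurableE R)) => // _ [_ [a ->] <-].
rewrite setTI; have -> : (fun w => dot l (Z N w)) @^-1` `]a, +oo[ =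
    Z N @^-1` [set z | (a < dot l z)%R].
  by apply/seteqP; split => w /=; rewrite in_itv/= andbT.
exact/mZ/open_halfspace.
Qed.

Hypothesis L_lim : forall l,
  (scale N)%:E * lne (scaled_mgf N l) @[N --> \oo] --> L l.

Lemma near_mgf_le l (v : R) : L l < v%:E ->
  \forall N \near \oo, scaled_mgf N l <= (expR (N.+1%:R * v))%:E.
Proof.
move=> /(cvge_near_lt (@L_lim l)); apply: filterS => N /ltW.
by rewrite rate_le// scaled_mgf_ge0.
Qed.

Lemma near_mgf_ge l (v : R) : v%:E < L l ->
  \forall N \near \oo, (expR (N.+1%:R * v))%:E <= scaled_mgf N l.
Proof.
move=> /(cvge_near_gt (@L_lim l)); apply: filterS => N /ltW.
by rewrite rate_ge// scaled_mgf_ge0.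
Qed.

(** Chebyshev's inequality: a mean of at most exp(n b) is divided by the threshold exp(n (a +
    b)). *)
Lemma near_halfspace_le l (a b : R) : L l < b%:E ->
  \forall N \near \oo, P (Z N @^-1` [set z | (a + b < dot l z)%R]) <=
    (expR (N.+1%:R * - a))%:E.
Proof.
move=> /near_mgf_le; apply: filterS => N mN.
apply: le_trans (@exp_markov _ _ _ P (fun w => N.+1%:R * dot l (Z N w))%R _
  (N.+1%:R * (a + b))%R _ _ _) _.
- by apply: measurable_funM => //; exact: measurable_dot.
- exact/mZ/open_halfspace.
- by move=> w /= /ltW abl; rewrite ler_pM2l.
- move: mN; rewrite scaled_mgfE unlock => mN.
  apply: le_trans (lee_wpmul2l _ mN) _; first by rewrite lee_fin expR_ge0.
  by rewrite -EFinM -expRD lee_fin ler_expR; lra.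
Qed.

(* An open set of probability O(exp (- a N)); compactness turns a pointwise bound
   by half-spaces into thinness of a neighbourhood of the whole set. *)
Definition thin (a : R) (U : set 'rV[R]_n) : Prop :=
  open U /\ exists k : nat, \forall N \near \oo,
    P (Z N @^-1` U) <= (k%:R * expR (N.+1%:R * - a))%:E.

Lemma thin_set0 a : thin a set0.
Proof.
split; first exact: open0.
by exists 0%N; apply: nearW => N; rewrite preimage_set0 measure0 mul0r.
Qed.

Lemma thinU a U V : thin a U -> thin a V -> thin a (U `|` V).
Proof.
move=> [oU [k Uk]] [oV [m Vm]]; split; first exact: openU.
exists (k + m)%N; near=> N.
rewrite preimage_setU; apply: le_trans (measureU2 _ _ _) _; try exact: mZ.
by rewrite natrD mulrDl EFinD; apply: leeD; near: N.
Unshelve. all: by end_near. Qed.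

Lemma thin_bigcup a (I : choiceType) (s : seq I) (U : I -> set 'rV[R]_n) :
  (forall i, i \in s -> thin a (U i)) -> thin a (\bigcup_(i in [set` s]) U i).
Proof.
elim: s => [_|i s IH H].
  by rewrite bigcup_seq big_nil; exact: thin_set0.
rewrite bigcup_seq big_cons -bigcup_seq; apply: thinU; first exact/H/mem_head.
by apply: IH => j js; apply: H; rewrite in_cons js orbT.
Qed.

Lemma thin_halfspace l (a b : R) : L l < b%:E ->
  thin a [set z | a + b < dot l z]%R.
Proof.
move=> Lb; split; first exact: open_halfspace.
exists 1%N; have := near_halfspace_le a Lb.
by apply: filterS => N; rewrite mul1r.
Qed.

Hypothesis L0 : L 0%R = 0.
Hypothesis L_gtNy : forall l, -oo < L l.
Hypothesis int0 : interior (effdom L) 0%R.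

(** Exponential tightness: a vector with a large coordinate lies in one of the 2n half-spaces along
    the axes, all of them thin. *)
Lemma thin_unbounded (a : R) : exists2 M : R, (0 <= M)%R & exists2 U, thin a U &
  [set z : 'rV[R]_n | exists i, (M < `|z 0%R i|)%R] `<=` U.
Proof.
have [s s0 [b Hb]] := effdom_axes int0.
exists (`|a + b| / s)%R; first by rewrite divr_ge0// ltW.
pose U (i : 'I_n) := [set z | a + b < dot (s *: delta_mx 0 i) z]%R `|`
  [set z | a + b < dot (- (s *: delta_mx 0 i)) z]%R.
exists (\bigcup_(i in [set` enum 'I_n]) U i).
  apply: thin_bigcup => i _; have [H1 H2] := Hb i.
  by apply: thinU; exact: thin_halfspace.
move=> z /= [i iM]; exists i; rewrite /= ?mem_enum//.
have {}iM : (a + b < s * `|z 0%R i|)%R.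
  apply: le_lt_trans (ler_norm _) _.
  by move: iM; rewrite ltr_pdivrMr// mulrC.
rewrite /U/=; have [z0|z0] := leP 0%R (z 0%R i).
  by left; rewrite dotZl dot_delta; rewrite ger0_norm in iM.
by right; rewrite dotNl dotZl dot_delta -mulrN; rewrite ltr0_norm in iM.
Qed.

(** Each point of F lies in a thin half-space. The part of F in a large box is compact and needs
    finitely many of them; the rest is thin by tightness. *)
Lemma thin_closed (a : R) (F : set 'rV[R]_n) : closed F ->
  a%:E < ereal_inf [set legendre L y | y in F] ->
  exists2 U, thin a U & F `<=` U.
Proof.
move=> cF aF.
have Fy y : F y -> exists lb : 'rV[R]_n * R,
    L lb.1 < lb.2%:E /\ (a + lb.2 < dot lb.1 y)%R.
  move=> Fy; have : a%:E < legendre L y.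
    by apply: lt_le_trans aF _; apply: ereal_inf_lbound; exists y.
  by case/(legendre_gt_halfspace L_gtNy) => l [b [? ?]]; exists (l, b).
(* Made total, with a dummy value off F, so that [choice] applies. *)
have Fy' y : exists lb : 'rV[R]_n * R,
    F y -> L lb.1 < lb.2%:E /\ (a + lb.2 < dot lb.1 y)%R.
  have [/Fy[lb H]|nF] := pselect (F y); first by exists lb.
  by exists (0%R, 0%R).
have [lb Hlb] := choice Fy'.
have [M M0 [U tU MU]] := thin_unbounded a.
pose K := [set z : 'rV[R]_n | forall i, (`|z 0%R i| <= M)%R] `&` F.
have cK : compact K.
  apply: (subclosed_compact _ (@compact_box R n M)); last exact: subIsetl.
  by apply: closedI => //; exact: closed_box.
move: cK; rewrite compact_cover.
move=> /(_ _ F (fun y => [set z | a + (lb y).2 < dot (lb y).1 z]%R)) [].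
- by move=> y _; exact: open_halfspace.
- by move=> z [_ Fz]; exists z => //=; have [] := Hlb z Fz.
move=> D DF KD.
exists (U `|` \bigcup_(y in [set` D]) [set z | a + (lb y).2 < dot (lb y).1 z]%R).
  apply: thinU => //; apply: (@thin_bigcup a _ (D : seq _)) => y yD.
  apply: thin_halfspace.
  by have [] := Hlb y (set_mem (DF _ yD)).
move=> z Fz; have [zM|] := pselect (exists i, M < `|z 0%R i|)%R.
  by left; exact: MU.
move=> /forallNP zM; right; apply: KD; split => // i.
by rewrite leNgt; apply/negP/zM.
Qed.

Lemma ldp_upper (F : set 'rV[R]_n) (v : R) : closed F ->
  - ereal_inf [set legendre L y | y in F] < v%:E ->
  \forall N \near \oo, P (Z N @^-1` F) <= (expR (N.+1%:R * v))%:E.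
Proof.
move=> cF; rewrite lteNl => /lte_real_between[a [va aF]].
have [U [oU [k Uk]] FU] := thin_closed cF aF.
(* This strict gap absorbs the factor k of the thin set. *)
have av : (- a < v)%R by move: va; rewrite lte_fin ltrNl.
near=> N; apply: (@le_trans _ _ (P (Z N @^-1` U))).
  apply: le_measure; rewrite ?inE; [|exact: mZ|by move=> w /FU].
  exact: borel_measurable_closed.
apply: (@le_trans _ _ (k%:R * expR (N.+1%:R * - a))%:E); first by near: N.
by rewrite lee_fin; near: N; exact: near_expR_le.
Unshelve. all: by end_near. Qed.

End ldp_upper_bound.

Section lower_semicontinuous_min.
Context {R : realType} {X : ptopologicalType}.
Local Open Scope ereal_scope.
Implicit Types (f : X -> \bar R) (K : set X).

(** Without a minimum, the open sets {a < f}, for levels a above some value of f on K, cover K. The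
    least level a of a finite subcover is still above some value f y, and y is then left
    uncovered. *)
Lemma lsc_compact_min f K : lower_semicontinuous f -> compact K -> K !=set0 ->
  exists2 x, K x & forall y, K y -> f x <= f y.
Proof.
move=> /lower_semicontinuousP lf + [x0 Kx0]; rewrite compact_cover => cK.
apply: contrapT => /forall2NP nmin.
have nm x : K x -> exists2 y, K y & f y < f x.
  move=> Kx; have [//|/existsNP[y /not_implyP[Ky /negP]]] := nmin x.
  by rewrite -ltNge; exists y.
have [] := cK R [set a | exists2 y, K y & f y < a%:E] (fun a => [set x | a%:E < f x]).
- by move=> a _; exact: lf.
- move=> x Kx; have [y Ky yx] := nm _ Kx.
  by have [a [ya ax]] := lte_real_between yx; exists a => //; exists y.
move=> D DP KD.
have [a0 a0D _] := KD _ Kx0.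
pose a := (\big[Num.min/a0]_(a <- D) a)%R.
have aD : a \in D.
  rewrite /a big_seq; elim/big_ind : _ => // u v uD vD.
  by rewrite /Num.min; case: ifP.
have [y Ky ya] := set_mem (DP _ aD).
have [b bD /= bf] := KD _ Ky; have := lt_trans bf ya.
by rewrite lte_fin ltNge; move/negP; apply; exact: bigmin_inf_seq bD _ (lexx _).
Qed.

Lemma lsc_addr f (q : X -> R) : lower_semicontinuous f -> continuous q ->
  lower_semicontinuous (fun x => f x + (q x)%:E).
Proof.
move=> lf cq x a.
rewrite -lteBlDr// -EFinB => /lte_real_between[b [ab bf]].
have [V xV Vb] := lf x b bf.
exists (V `&` [set y | a - b < q y]%R).
  apply: filterI => //; apply: (cq x [set r | a - b < r]%R); apply: open_nbhs_nbhs; split.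
    exact: open_gt.
  by move: ab; rewrite lte_fin /= => ab; lra.
move=> y [/Vb bfy /= aby]; rewrite -lteBlDr// -EFinB.
by apply: lt_trans bfy; rewrite lte_fin; lra.
Qed.

End lower_semicontinuous_min.

Section directional_derivative.
Context {R : realType} {V : normedModType R}.
Implicit Types (f : V -> R) (l v : V).

Lemma is_derive_lt_near f l v D c : is_derive l v f D -> D < c ->
  exists2 e : R, 0 < e & forall t, 0 < t < e -> f (l + t *: v) - f l < c * t.
Proof.
move=> [df <-] Dc.
have /cvgr_lt/(_ c Dc) := df.
move=> [e /= e0 He]; exists e => // t /andP[t0 te].
have := He t; rewrite /= sub0r normrN gtr0_norm// => /(_ te).
rewrite (addrC l) /GRing.scale/= => /(_ (lt0r_neq0 t0)).
by rewrite mulrC ltr_pdivrMr.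
Qed.

Lemma is_derive_gt_near f l v D c : is_derive l v f D -> c < D ->
  exists2 e : R, 0 < e & forall t, 0 < t < e -> c * t < f (l + t *: v) - f l.
Proof.
move=> df cD; have /is_derive_lt_near := is_deriveN df.
move=> /(_ (- c)); rewrite ltrN2 => /(_ cD)[e e0 He].
by exists e => // t /He; rewrite !fctE; lra.
Qed.

End directional_derivative.

Lemma exists_pos_lt3 {R : realType} (a b c : R) : 0 < a -> 0 < b -> 0 < c ->
  exists t, [/\ 0 < t, t < a, t < b & t < c].
Proof.
move=> a0 b0 c0; pose m := Num.min (Num.min a b) c.
have m0 : 0 < m by rewrite !lt_min a0 b0 c0.
have m2 : m / 2 < m by rewrite ltr_pdivrMr// ltr_pMr ?ltr1n.
by exists (m / 2); split; first exact: divr_gt0;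
  apply: (lt_le_trans m2); rewrite !ge_min lexx ?orbT.
Qed.

(** * Minimizers of the penalized function *)

Section tilted_minimizer.
Context {R : realType} {n : nat}.
Variable L : 'rV[R]_n -> \bar R.
Local Notation f := (fine \o L).
Hypothesis L0 : L 0 = 0%E.
Hypothesis L_gtNy : forall l, (-oo < L l)%E.
Hypothesis L_convex : econvex L.
Hypothesis L_lsc : lower_semicontinuous L.
Hypothesis int0 : interior (effdom L) 0.
Hypothesis L_derive : forall l v, interior (effdom L) l ->
  is_derive l v f (dot (gradient f l) v).
Hypothesis L_steep : steep L.

Lemma effdom_fin l : effdom L l -> L l = (f l)%:E.
Proof. by move=> Ll; rewrite fineK// fin_real// L_gtNy. Qed.

Lemma effdom_convex t l m : 0 <= t <= 1 -> effdom L l -> effdom L m ->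
  effdom L (t *: l + (1 - t) *: m).
Proof.
move=> t01 /effdom_fin Ll /effdom_fin Lm.
by rewrite /effdom/=; apply: le_lt_trans (L_convex l m t01) _; rewrite Ll Lm ltry.
Qed.

Lemma fine_convex t l m : 0 <= t <= 1 -> effdom L l -> effdom L m ->
  f (t *: l + (1 - t) *: m) <= t * f l + (1 - t) * f m.
Proof.
move=> t01 Dl Dm; have := L_convex l m t01.
by rewrite (effdom_fin (effdom_convex t01 Dl Dm)) (effdom_fin Dl) (effdom_fin Dm)
  -!EFinM -EFinD lee_fin.
Qed.

(** By convexity the difference quotients from l towards b are at most f b - f l, so the derivative
    in that direction cannot exceed it. *)
Lemma gradient_inequality l b : interior (effdom L) l -> effdom L b ->
  f l + dot (gradient f l) (b - l) <= f b.
Proof.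
move=> Il Db; have Dl := interior_subset Il.
rewrite leNgt; apply/negP => /= H.
have /(is_derive_gt_near (L_derive (b - l) Il)) [e e0 He] :
    f b - f l < dot (gradient f l) (b - l) by rewrite /=; lra.
pose t := Num.min (e / 2) 1.
have t0 : 0 < t by rewrite lt_min ltr01 divr_gt0.
have te : t < e by rewrite gt_min ltr_pdivrMr// ltr_pMr ?ltr1n.
have t1 : t <= 1 by rewrite ge_min lexx orbT.
have := He t; rewrite t0 te => /(_ isT).
have t01 : 0 <= t <= 1 by rewrite ltW.
have := fine_convex t01 Db Dl.
have -> : t *: b + (1 - t) *: l = l + t *: (b - l).
  by rewrite scalerBr scalerBl scale1r addrC -addrA (addrC (- _)).
by move=> /=; nra.
Qed.

(** The ball around 0 inside the domain, shrunk by t and moved to (1 - t) l, stays in the domain by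
    convexity. *)
Lemma segment_interior t l : effdom L l -> 0 < t <= 1 ->
  interior (effdom L) ((1 - t) *: l).
Proof.
move=> Dl /andP[t0 t1]; have /nbhs_ballP[e /= e0 eD] := int0.
apply/nbhs_ballP; exists (t * e) => /=; first exact: mulr_gt0.
move=> z; rewrite -ball_normE/= => zl.
have -> : z = t *: (t^-1 *: (z - (1 - t) *: l)) + (1 - t) *: l.
  by rewrite scalerA divff ?gt_eqF// scale1r subrK.
apply: effdom_convex => //; first by rewrite ltW.
apply: eD; rewrite -ball_normE/= sub0r normrN normrZ normfV gtr0_norm//.
by rewrite distrC mulrC ltr_pdivrMr// mulrC.
Qed.

Variables (y : 'rV[R]_n) (J : R).
Hypothesis yJ : (legendre L y <= J%:E)%E.

Lemma J_ge0 : 0 <= J.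
Proof. by rewrite -lee_fin; apply: le_trans yJ; exact: legendre_ge0. Qed.

Lemma fine_ge_legendre l : effdom L l -> dot l y - J <= f l.
Proof.
move=> Dl; have := le_trans (legendre_ub L l y) yJ.
by rewrite (effdom_fin Dl) -EFinB lee_fin; lra.
Qed.

Variables (c : R).
Hypothesis c0 : 0 < c.
Local Notation q := (fun l => c * dot l l - dot l y).

(* L - dot^~ y need not attain its minimum; the quadratic penalty makes its
   sublevel sets bounded, at a cost that vanishes with c. *)
Lemma penalized_min : exists2 e, effdom L e &
  forall l, effdom L l -> f e + q e <= f l + q l.
Proof.
pose psi l := (L l + (q l)%:E)%E.
have cdd : continuous (fun l : 'rV[R]_n => dot l l).
  move=> z; apply: (@cvg_big _ _ +%R 0 xpredT add_continuous _ (nbhs z)) => i _.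
  by apply: cvgM; exact: coord_continuous.
have lpsi : lower_semicontinuous psi.
  apply: lsc_addr => // z; apply: (@cvgB _ _ _ (nbhs z) _ (fun l => c * dot l l) (dot^~ y)).
    by apply: (@cvgM _ _ (nbhs z) _ (cst c) (fun l => dot l l)); [exact: cvg_cst|exact: cdd].
  have -> : dot^~ y = dot y by apply/funext => m; rewrite dotC.
  by rewrite (dotC z y); exact: continuous_dot.
(* Outside the box of radius M one has c |l|^2 >= J + 1, while L l - l . y >= - J; the penalized
   value is then positive, above its value 0 at the origin. *)
pose M := Num.sqrt ((J + 1) / c).
have M2 : c * M ^+ 2 = J + 1.
  rewrite sqr_sqrtr ?divr_ge0 ?(ltW c0) ?addr_ge0 ?J_ge0//.
  by rewrite mulrCA divff ?gt_eqF// mulr1.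
have M0 : 0 <= M by exact: sqrtr_ge0.
have [|e Ke He] := lsc_compact_min lpsi (@compact_box R n M).
  by exists 0 => i; rewrite mxE normr0.
have psi0 : psi 0 = 0%E by rewrite /psi L0 !dot0l mulr0 subr0 adde0.
have He0 : (psi e <= 0)%E by rewrite -psi0; apply: He => i; rewrite mxE normr0.
have De : effdom L e.
  by rewrite /effdom/= ltNge leye_eq; apply/negP => /eqP Le; move: He0; rewrite /psi Le.
exists e => // l Dl.
have psiE m : effdom L m -> psi m = (f m + q m)%:E.
  by move=> Dm; rewrite /psi (effdom_fin Dm) -EFinD.
rewrite -lee_fin -!psiE//.
have [lK|/existsNP[i /negP]] := pselect (forall i, `|l 0 i| <= M); first exact: He.
rewrite -ltNge => li; apply: le_trans He0 _; rewrite psiE// lee_fin.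
have := fine_ge_legendre Dl => h1.
have h2 : M ^+ 2 <= dot l l.
  rewrite /dot (bigD1 i)//= ler_wpDr//; first by apply: sumr_ge0 => j _; rewrite -expr2 sqr_ge0.
  rewrite -expr2 -(real_normK (num_real (l 0 i))).
  by rewrite ler_sqr ?nnegrE// ltW.
have : J + 1 <= c * dot l l by rewrite -M2 ler_pM2l.
by move: h1 => /=; lra.
Qed.

(* Otherwise the gradients of L along the segment from 0 to e would be unbounded
   by steepness, while the gradient inequality on a ball around 0 and the
   minimality of e bound them. *)
Lemma penalized_min_interior e : effdom L e ->
  (forall l, effdom L l -> f e + q e <= f l + q l) -> interior (effdom L) e.
Proof.
move=> De emin; apply: contrapT => nIe.
pose l_ (j : nat) : 'rV[R]_n := (1 - j.+1%:R^-1) *: e.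
have t01 (j : nat) : 0 < (j.+1%:R^-1 : R) <= 1.
  by rewrite invr_gt0 ltr0n/= invf_le1// ler1n.
have Il j : interior (effdom L) (l_ j) by exact: segment_interior.
have l_e : l_ @ \oo --> e.
  rewrite -[X in _ --> X]scale1r; apply: cvgZr_tmp; rewrite -[X in _ --> X]subr0.
  by apply: cvgB; [exact: cvg_cst|exact: cvg_harmonic].
have cle : closure (interior (effdom L)) e.
  move=> B /l_e [N _ NB]; exists (l_ N); split; first exact: Il.
  exact: (NB N (leqnn N)).
have := L_steep Il l_e cle nIe.
have [s s0 [K HK]] := effdom_axes int0.
pose b := dot e y.
(* Dominates the bound K + J + 2 |b| obtained below for G . w at w = +- s e_i, divided by s. *)
pose M := (`|K| + J + 3 * `|b|) / s.
move=> /cvgryPge/(_ (M + 1))[j _ /(_ j (leqnn j))] /=.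
rewrite leNgt => /negP; apply.
apply: (@le_lt_trans _ _ M); last by rewrite ltrDl ltr01.
set t : R := j.+1%:R^-1; have := t01 j; rewrite -/t => /andP[t0 t1].
set G := gradient f (l_ j); set l := l_ j.
have lE : l = (1 - t) *: e by [].
have Dl : effdom L l by exact: interior_subset (Il j).
(* The gradient inequality from l to e gives t G . e <= f e - f l, and minimality gives f e - f l <=
   t b - c t (2 - t) |e|^2; the quadratic term has the favourable sign. *)
have Ge : dot G e <= b.
  have := gradient_inequality (Il j) De; rewrite -/l -/G.
  have -> : e - l = t *: e by rewrite lE scalerBl scale1r opprB addrC subrK.
  have -> : dot G (t *: e) = t * dot G e by rewrite dotC dotZl dotC.
  have := emin _ Dl.
  have -> : dot l l = (1 - t) ^+ 2 * dot e e by rewrite lE dotZl dotC dotZl; ring.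
  have -> : dot l y = (1 - t) * b by rewrite lE dotZl.
  rewrite -/b /=.
  have : 0 <= dot e e by apply: sumr_ge0 => i _; rewrite -expr2 sqr_ge0.
  move: (dot e e) (dot G e) (fine (L e)) (fine (L l)) => a g fe fl a0 h1 h2.
  have h4 : 0 <= c * a * t * (2 - t).
    by rewrite !mulr_ge0 ?(ltW c0) ?(ltW t0)// subr_ge0 (le_trans t1)// ler1n.
  have h3 : t * g <= t * b by nra.
  by rewrite -(ler_pM2l t0).
have fl : - `|b| - J <= f l.
  apply: le_trans (fine_ge_legendre Dl).
  rewrite lerB// lE dotZl -/b.
  have : `|(1 - t) * b| <= `|b| by rewrite normrM ger0_norm ?subr_ge0// ler_piMl// gerBl ltW.
  by rewrite ler_norml => /andP[].
have ml : dot G l <= `|b|.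
  rewrite dotC lE dotZl dotC.
  apply: (@le_trans _ _ ((1 - t) * `|b|)).
    by rewrite ler_wpM2l ?subr_ge0// (le_trans Ge)// ler_norm.
  by rewrite ler_piMl// gerBl ltW.
(* The gradient inequality from l to w, with f l >= - |b| - J and G . l <= |b|. *)
have K1 w : (L w < K%:E)%E -> dot G w <= K + J + 2 * `|b|.
  move=> wK; have Dw : effdom L w by rewrite /effdom/=; exact: lt_trans wK (ltry _).
  have := gradient_inequality (Il j) Dw; rewrite -/l -/G.
  rewrite dotC dotDl dotNl !(dotC _ G).
  move: wK; rewrite (effdom_fin Dw) lte_fin /=; move: fl => /=; lra.
apply: norm_le_coord.
  by rewrite divr_ge0 ?(ltW s0)// !addr_ge0 ?J_ge0 ?mulr_ge0.
move=> i; have [H1 H2] := HK i; rewrite ler_pdivlMr//.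
have := K1 _ H1; have := K1 _ H2.
rewrite dotC dotNl dotZl dot_delta dotC dotZl dot_delta.
have := normr_ge0 b; have := ler_norm K => Kn b0 h1 h2.
rewrite -[X in _ * X <= _](gtr0_norm s0) -normrM ler_norml (mulrC (G 0 i)).
by apply/andP; split; lra.
Qed.

(** First-order condition. If the derivative of f along v were below (y - 2 c e) . v, a short step t
    v would lower f by more than the remaining quadratic cost c t^2 |v|^2; taking v = +- e_i gives
    equality. *)
Lemma penalized_min_gradient e : interior (effdom L) e ->
  (forall l, effdom L l -> f e + q e <= f l + q l) ->
  gradient f e = y - (2 * c) *: e.
Proof.
move=> Ie emin; set G := gradient f e.
have ineq v : dot (y - (2 * c) *: e) v <= dot G v.
  rewrite leNgt; apply/negP => H.
  pose k := (dot G v + dot (y - (2 * c) *: e) v) / 2.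
  have /(is_derive_lt_near (L_derive v Ie)) [r r0 Hr] : dot G v < k by rewrite /k; lra.
  have /nbhs_ballP[r' /= r'0 r'D] := Ie.
  pose V := 1 + `|v|.
  have V0 : 0 < V by rewrite ltr_pwDl.
  pose D := dot (y - (2 * c) *: e) v - k.
  have D0 : 0 < D by rewrite /D /k; lra.
  have v0 : 0 <= dot v v by apply: sumr_ge0 => i _; rewrite -expr2 sqr_ge0.
  have cv0 : 0 < 1 + c * dot v v by rewrite ltr_pwDl// mulr_ge0// ltW.
  have [t [t0 tr]] := exists_pos_lt3 r0 (divr_gt0 r'0 V0) (divr_gt0 D0 cv0).
  rewrite !ltr_pdivlMr// => tr' tD.
  have Dt : effdom L (e + t *: v).
    apply: r'D; rewrite -ball_normE/= opprD addrA subrr sub0r normrN normrZ gtr0_norm//.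
    by apply: le_lt_trans tr'; rewrite ler_pM2l// /V lerDr.
  have := Hr t; rewrite t0 tr => /(_ isT).
  have := emin _ Dt.
  rewrite !(dotDl, dotC _ (_ + _), dotZl, dotC _ (_ *: _)) (dotC v e) /=.
  move: tD; rewrite /D dotDl dotNl dotZl (dotC y v).
  nra.
apply/rowP => i; apply/eqP; rewrite eq_le.
have h1 := ineq (delta_mx 0 i); have h2 := ineq (- delta_mx 0 i).
move: h1 h2; rewrite !(dotC _ (- _)) !dotNl !(dotC _ (delta_mx _ _)) !dot_delta lerN2.
by move=> -> ->.
Qed.

End tilted_minimizer.

(** * The large deviation lower bound *)

Section ldp_lower_bound.
Context {R : realType} {d} {T : measurableType d} (P : probability T R) {n : nat}.
Variables (Z : nat -> T -> 'rV[R]_n) (L : 'rV[R]_n -> \bar R).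
Local Notation f := (fine \o L).
Hypothesis mZ : forall N, borel_measurable (Z N).
Hypothesis L_lim : forall l,
  ((scale N)%:E * lne (scaled_mgf P Z N l))%E @[N --> \oo] --> L l.
Hypothesis L0 : L 0 = 0%E.
Hypothesis L_gtNy : forall l, (-oo < L l)%E.
Hypothesis L_derive : forall l v, interior (effdom L) l ->
  is_derive l v f (dot (gradient f l) v).

Definition axis_dir (j : 'I_n * bool) : 'rV[R]_n :=
  if j.2 then - delta_mx 0 j.1 else delta_mx 0 j.1.

Definition open_box (y : 'rV[R]_n) (r : R) : set 'rV[R]_n :=
  [set z | forall i, `|z 0 i - y 0 i| < r].

Lemma not_open_box y r z : ~ open_box y r z ->
  exists j, r + dot (axis_dir j) y <= dot (axis_dir j) z.
Proof.
move=> /existsNP[i /negP]; rewrite -leNgt => ri.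
have [h|h] := leP 0 (z 0 i - y 0 i).
  exists (i, false); rewrite /axis_dir/= !dot_delta.
  by move: ri; rewrite ger0_norm//; lra.
exists (i, true); rewrite /axis_dir/= !dotNl !dot_delta.
by move: ri; rewrite ltr0_norm//; lra.
Qed.

Lemma dot_open_box e y r z : open_box y r z -> dot e z <= dot e y + l1 e * r.
Proof.
move=> B; have : `|dot e (z - y)| <= l1 e * r.
  by apply: dot_le_coord => i; rewrite !mxE ltW.
rewrite dotC dotDl dotNl !(dotC _ e) ler_norml => /andP[_]; lra.
Qed.

Lemma open_open_box y r : open (open_box y r).
Proof.
rewrite openE => z Hz.
apply: (@filter_forall _ _ (fun i => [set z | `|z 0 i - y 0 i| < r]) (nbhs z)) => i.
apply: open_nbhs_nbhs; split; last exact: Hz.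
apply: (@open_comp _ _ (fun z : 'rV[R]_n => `|z 0 i - y 0 i|) [set x | x < r]);
  last exact: open_lt.
move=> z' _.
apply: (@continuous_comp _ _ _ (fun z : 'rV[R]_n => z 0 i - y 0 i) Num.norm);
  last exact: norm_continuous.
apply: (@cvgB _ _ _ (nbhs z') _ (fun z : 'rV[R]_n => z 0 i) (cst (y 0 i))).
  exact: coord_continuous.
exact: cvg_cst.
Qed.

(** Stands in for a change of measure. In the box, exp(n e . Z) is at most its supremum there; off
    the box some signed coordinate of Z exceeds that of y by at least r, and an extra tilt s j in
    that direction is bounded below by exp(n s j (r + d_j . y)). *)
Lemma split_mgf N e y r (s : 'I_n * bool -> R) :
  (forall j, 0 < s j) ->
  (scaled_mgf P Z N e <=
   (expR (N.+1%:R * (dot e y + l1 e * r)))%:E * P (Z N @^-1` open_box y r) +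
   \sum_j (expR (- (N.+1%:R * (s j * (r + dot (axis_dir j) y)))))%:E *
     scaled_mgf P Z N (e + s j *: axis_dir j))%E.
Proof.
move=> s0; set A := dot e y + l1 e * r.
have mB : measurable (Z N @^-1` open_box y r) by exact/mZ/open_open_box.
have mexp l : measurable_fun setT
    (fun w => (expR (N.+1%:R * dot l (Z N w)))%:E).
  apply/measurable_EFinP; apply: measurableT_comp => //.
  by apply: measurable_funM => //; exact: measurable_dot.
have exp0 (x : R) : (0 <= (expR x)%:E)%E by rewrite lee_fin expR_ge0.
rewrite scaled_mgfE.
under eq_bigr do rewrite scaled_mgfE -ge0_integralZl_EFin ?expR_ge0//.
rewrite -ge0_integral_sum//; last first.
  by move=> j; apply: measurable_funeM; exact: mexp.
have -> : P (Z N @^-1` open_box y r) =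
    (\int[P]_w (\1_(Z N @^-1` open_box y r) w)%:E)%E.
  by rewrite integral_indic// setIT.
rewrite -ge0_integralZl_EFin ?expR_ge0//; last exact/measurable_EFinP.
pose g1 w := ((expR (N.+1%:R * A))%:E * (\1_(Z N @^-1` open_box y r) w)%:E)%E.
pose g2 w := (\sum_j (expR (- (N.+1%:R * (s j * (r + dot (axis_dir j) y)))))%:E *
    (expR (N.+1%:R * dot (e + s j *: axis_dir j) (Z N w)))%:E)%E.
have g10 w : (0 <= g1 w)%E by rewrite /g1 mule_ge0// lee_fin.
have g20 w : (0 <= g2 w)%E by apply: sume_ge0 => j _; rewrite mule_ge0.
have mg1 : measurable_fun setT g1.
  by apply: measurable_funeM; exact/measurable_EFinP.
have mg2 : measurable_fun setT g2.
  by apply: emeasurable_sum => j; apply: measurable_funeM; exact: mexp.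
rewrite -(@ge0_integralD _ _ _ P setT measurableT g1 g2)//.
apply: ge0_le_integral => //.
- exact: emeasurable_funD.
move=> w _; have sum0 := g20 w; rewrite /g1 /g2 in sum0 *.
have [wB|nB] := pselect (open_box y r (Z N w)).
  apply: (le_trans _ (leeDl _ sum0)); rewrite indicE mem_set// mule1 lee_fin ler_expR.
  by rewrite ler_pM2l//; exact: dot_open_box.
apply: (le_trans _ (leeDr _ (g10 w))).
have [j Hj] := not_open_box nB.
rewrite (bigD1 j)//=; apply: (le_trans _ (leeDl _ _)); last first.
  by apply: sume_ge0 => k _; rewrite mule_ge0.
rewrite -EFinM -expRD lee_fin ler_expR dotDl dotZl.
have : 0 <= N.+1%:R * (s j * (dot (axis_dir j) (Z N w) - (r + dot (axis_dir j) y))).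
  by rewrite !mulr_ge0// ?(ltW (s0 j))// subr_ge0.
lra.
Qed.

(** The tilt by e concentrates Z at the gradient y. For small steps s_j, L (e + s_j d_j) < f e + s_j
    (d_j . y + r / 2), so the terms off the box fall short of exp(n f e) by exp(- n s_j r / 2), and
    the box must carry the rest. *)
Lemma local_lower e r (v : R) : interior (effdom L) e -> 0 < r ->
  v < f e - dot e (gradient f e) - l1 e * r ->
  \forall N \near \oo,
    ((expR (N.+1%:R * v))%:E <= P (Z N @^-1` open_box (gradient f e) r))%E.
Proof.
move=> Ie r0; set y := gradient f e => vA.
have De : effdom L e by exact: interior_subset Ie.
have /nbhs_ballP[q /= q0 qD] := Ie.
have sex j : exists s, 0 < s /\
    (L (e + s *: axis_dir j) < (f e + s * (dot (axis_dir j) y + r / 2))%:E)%E.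
  have /(is_derive_lt_near (L_derive (axis_dir j) Ie)) [p p0 Hp] :
    dot (gradient f e) (axis_dir j) < dot (axis_dir j) y + r / 2.
    by rewrite dotC ltrDl divr_gt0.
  have nv0 : 0 < 1 + `|axis_dir j| by rewrite ltr_pwDl.
  have [t [t0 tp tq _]] := exists_pos_lt3 p0 (divr_gt0 q0 nv0) ltr01.
  exists t; split => //.
  rewrite (effdom_fin L_gtNy); last first.
    apply: qD; rewrite -ball_normE/= opprD addrA subrr sub0r normrN normrZ gtr0_norm//.
    move: tq; rewrite ltr_pdivlMr//; apply: le_lt_trans.
    by rewrite ler_pM2l// lerDr.
  by rewrite lte_fin; have := Hp t; rewrite t0 tp => /(_ isT)/=; lra.
have [s Hs] := choice sex.
have s0 j : 0 < s j by have [] := Hs j.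
pose m := \big[Num.min/1]_j s j.
have m0 : 0 < m by rewrite /m; elim/big_ind : _ => // a b a0 b0; rewrite lt_min a0.
have ms j : m <= s j by exact: bigmin_le.
(* The smallest loss s_j r / 2 over all directions; the error [ep] allowed on the rate of the total
   must stay below it. *)
pose c := m * (r / 2); have c0 : 0 < c by rewrite !mulr_gt0.
pose A := dot e y + l1 e * r.
have fA : 0 < f e - A - v by rewrite /A; lra.
have [ep [ep0 epc epf _]] := exists_pos_lt3 c0 fA ltr01.
pose K := #|{: 'I_n * bool}|.
near=> N.
have H1 : ((expR (N.+1%:R * (f e - ep)))%:E <= scaled_mgf P Z N e)%E.
  by near: N; apply: near_mgf_ge => //; rewrite (effdom_fin L_gtNy De) lte_fin /=; lra.
have H2 : forall j, (scaled_mgf P Z N (e + s j *: axis_dir j) <=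
    (expR (N.+1%:R * (f e + s j * (dot (axis_dir j) y + r / 2))))%:E)%E.
  near: N; apply: filter_forall => j; apply: near_mgf_le => //.
  by have [] := Hs j.
(* The K directions together take at most half of the total; by [H4] the other half is at least
   exp(n (v + A)). *)
have H3 : (2 * K)%:R * expR (N.+1%:R * (f e - c)) <= expR (N.+1%:R * (f e - ep)).
  by near: N; apply: near_expR_le; lra.
have H4 : 2%:R * expR (N.+1%:R * (v + A)) <= expR (N.+1%:R * (f e - ep)).
  by near: N; apply: near_expR_le; lra.
have := le_trans H1 (split_mgf N e y r s0); rewrite -/A.
have : (\sum_j (expR (- (N.+1%:R * (s j * (r + dot (axis_dir j) y)))))%:E *
     scaled_mgf P Z N (e + s j *: axis_dir j) <=
     (K%:R * expR (N.+1%:R * (f e - c)))%:E)%E.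
  apply: (@le_trans _ _ (\sum_(j : 'I_n * bool) (expR (N.+1%:R * (f e - c)))%:E)%E).
    apply: lee_sum => j _; apply: le_trans (lee_wpmul2l _ (H2 j)) _.
      by rewrite lee_fin expR_ge0.
    rewrite -EFinM -expRD lee_fin ler_expR -mulrN -mulrDr ler_pM2l//.
    have : m * (r / 2) <= s j * (r / 2) by rewrite ler_pM2r ?divr_gt0.
    by rewrite /c; lra.
  by rewrite sumEFin lee_fin sumr_const [leRHS]mulr_natl.
have -> : P (Z N @^-1` open_box y r) = (fine (P (Z N @^-1` open_box y r)))%:E.
  by rewrite fineK// fin_num_measure//; exact/mZ/open_open_box.
move: (fine _) => p hs /le_trans/(_ (leeD2l _ hs)).
rewrite -EFinM -EFinD !lee_fin => h.
rewrite -(ler_pM2l (expR_gt0 (N.+1%:R * A))) -expRD -mulrDr (addrC A).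
move: H3; rewrite natrM => H3; lra.
Unshelve. all: by end_near. Qed.

Hypothesis L_convex : econvex L.
Hypothesis L_lsc : lower_semicontinuous L.
Hypothesis int0 : interior (effdom L) 0.
Hypothesis L_steep : steep L.

(** As y need not be a gradient of L, the local bound is applied at the penalized minimizer e, whose
    gradient y - 2 c e is close to y for small c. *)
Lemma ldp_lower_at G y (v : R) : open G -> G y ->
  (v%:E < - legendre L y)%E -> \forall N \near \oo,
    forall U, measurable U -> Z N @^-1` G `<=` U ->
    ((expR (N.+1%:R * v))%:E <= P U)%E.
Proof.
move=> oG Gy vJ.
have Jfin : legendre L y \is a fin_num.
  rewrite fin_real//; apply/andP; split.
    by apply: lt_le_trans (legendre_ge0 L0 y); rewrite ltNy0.
  by move: vJ; case: (legendre L y) => [r| |]//=; rewrite ltry.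
pose J := fine (legendre L y).
have JE : legendre L y = J%:E by rewrite fineK.
have yJ : (legendre L y <= J%:E)%E by rewrite JE.
have J0 := J_ge0 L0 yJ.
have {}vJ : v < - J by move: vJ; rewrite JE -EFinN lte_fin.
have /nbhs_ballP[q /= q0 qG] : nbhs y G by exact: open_nbhs_nbhs.
pose rho := q / 2; have rho0 : 0 < rho by rewrite divr_gt0.
(* Comparing the minimum with the value 0 at the origin gives c |e|^2 <= J, hence (2 c e_i)^2 <= 4 c
   J < rho^2. *)
pose c := rho ^+ 2 / (8 * (J + 1)).
have J1 : 0 < J + 1 by rewrite ltr_wpDl.
have c0 : 0 < c by rewrite divr_gt0 ?exprn_gt0 ?mulr_gt0.
have [e De emin] := penalized_min L0 L_gtNy L_lsc yJ c0.
have Ie := penalized_min_interior L0 L_gtNy L_convex int0 L_derive L_steep yJ c0 De emin.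
have GE := penalized_min_gradient L_derive c0 Ie emin.
have ee0 : 0 <= dot e e by apply: sumr_ge0 => i _; rewrite -expr2 sqr_ge0.
have fe := fine_ge_legendre L_gtNy yJ De.
have fe0 : f e + (c * dot e e - dot e y) <= 0.
  have D0 : effdom L 0 by exact: interior_subset int0.
  by have := emin _ D0; rewrite /= L0 !dot0l mulr0 subr0 addr0.
have cee : c * dot e e <= J by move: fe fe0 => /=; lra.
have dist i : `|(gradient f e) 0 i - y 0 i| < rho.
  rewrite GE !mxE addrAC subrr sub0r normrN.
  rewrite -(@ltr_pXn2r _ 2) ?nnegrE ?(ltW rho0)// real_normK ?num_real//.
  have ei : e 0 i ^+ 2 <= dot e e.
    rewrite /dot (bigD1 i)//= -expr2 lerDl; apply: sumr_ge0 => j _.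
    by rewrite -expr2 sqr_ge0.
  have h1 : c * (8 * (J + 1)) = rho ^+ 2.
    by rewrite /c divfK// gt_eqF// mulr_gt0.
  have h2 : c * e 0 i ^+ 2 <= J by apply: le_trans cee; rewrite ler_pM2l.
  rewrite -h1 exprMn exprMn.
  have -> : 2 ^+ 2 * c ^+ 2 * e 0 i ^+ 2 = c * (4 * (c * e 0 i ^+ 2)) by ring.
  by rewrite ltr_pM2l//; lra.
(* Here f e - e . (y - 2 c e) >= - J + 2 c |e|^2 and v < - J, so the penalty only helps. *)
have vf : 0 < f e - dot e (gradient f e) - v.
  by rewrite GE (dotC e) dotDl dotNl dotZl (dotC y); move: fe => /=; nra.
have l10 : 0 < l1 e + 1 by rewrite ltr_wpDl// l1_ge0.
have [r [r0 rrho]] := exists_pos_lt3 rho0 (divr_gt0 vf l10) ltr01.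
rewrite ltr_pdivlMr// => rf _.
have boxG : open_box (gradient f e) r `<=` G.
  move=> z zB; apply: qG; rewrite -ball_normE/=.
  apply: (@le_lt_trans _ _ (rho + r)); last by rewrite /rho in rrho *; lra.
  apply: norm_le_coord; first by rewrite addr_ge0 ?ltW.
  move=> i; rewrite !mxE.
  rewrite (_ : y 0 i - z 0 i = - ((gradient f e) 0 i - y 0 i) + - (z 0 i - (gradient f e) 0 i)); last by ring.
  by apply: le_trans (ler_normD _ _) _; rewrite !normrN lerD// ltW.
have lr : l1 e * r < f e - dot e (gradient f e) - v.
  by apply: lt_trans rf; rewrite mulrDr mulr1 mulrC ltrDl.
have vr : v < f e - dot e (gradient f e) - l1 e * r by lra.
have := local_lower Ie r0 vr; apply: filterS => N HN U mU GU; apply: le_trans HN _.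
apply: le_measure; rewrite ?inE//; first exact/mZ/open_open_box.
by move=> w /= /boxG; exact: GU.
Qed.

End ldp_lower_bound.

Lemma gartner_ellis {R : realType} {d} {T : measurableType d}
    (P : probability T R) {n : nat} (Y : R -> T -> 'rV[R]_n)
    (L : 'rV[R]_n -> \bar R) :
  (forall N, borel_measurable (Y (scale N))) ->
  (forall l, ((scale N)%:E *
     lne ('E_P[fun w => expR ((scale N)^-1 * dot l (Y (scale N) w))]))%E
     @[N --> \oo] --> L l) ->
  L 0 = 0%E -> (forall l, (-oo < L l)%E) ->
  econvex L -> lower_semicontinuous L -> interior (effdom L) 0 ->
  (forall l v, interior (effdom L) l ->
     is_derive l v (fine \o L) (dot (gradient (fine \o L) l) v)) ->
  steep L -> ldp P Y (legendre L).
Proof.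
move=> mY L_lim L0 L_gtNy L_convex L_lsc int0 L_derive L_steep.
split => // G mG u; split; last 2 first.
- exact: limn_einf_sup.
- apply: limn_esup_le_near => v vF.
  have := ldp_upper mY L_lim L_gtNy int0 (@closed_closure _ G) vF.
  apply: filterS => N; rewrite /u rate_le//; apply: le_trans.
  apply: le_measure; rewrite ?inE//; last by move=> w; exact: subset_closure.
  exact: (borel_measurable_closed (mY N) (@closed_closure _ G)).
- apply: limn_einf_ge_near => v; rewrite lteNr => /ereal_inf_lt[_ [y Gy <-]].
  rewrite lteNr => vy.
  have := ldp_lower_at mY L_lim L0 L_gtNy L_derive L_convex L_lsc int0 L_steep
    (@open_interior _ G) Gy vy.
  apply: filterS => N HN; rewrite /u rate_ge//; apply: HN => // w.
  exact: interior_subset.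
Qed.

Lemma ae_eq_measure {R : realType} {d} {T : measurableType d}
    (P : {measure set T -> \bar R}) (A B : set T) :
  measurable A -> measurable B -> {ae P, forall w, A w <-> B w} -> P A = P B.
Proof.
have half A' B' : measurable A' -> measurable B' ->
    {ae P, forall w, A' w <-> B' w} -> (P A' <= P B')%E.
  move=> mA mB [N [mN N0 AB]].
  rewrite -(measureU0 mB mN N0); apply: le_measure; rewrite ?inE//.
    exact: measurableU.
  move=> w Aw; have [?|nB] := pselect (B' w); first by left.
  by right; apply: AB => /= -[/(_ Aw)].
move=> mA mB AB; apply/eqP; rewrite eq_le half//= half//.
by apply: filterS AB => w [].
Qed.

(** * Contraction along g *)

Section contraction_principle.
Context {R : realType} {d} {T : measurableType d} (P : probability T R).
Variables (Z : R -> T -> 'rV[R]_4) (J : 'rV[R]_4 -> \bar R).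
Variables (K : set 'rV[R]_4) (U : R -> T -> R).
Hypothesis J_good : good_rate_function J.
Hypothesis Z_ldp : ldp P Z J.
Hypothesis K_closed : closed K.
Hypothesis g_cont : {within K, continuous (g : 'rV[R]_4 -> R)}.
Hypothesis ZK : forall N, {ae P, forall w, K (Z (scale N) w)}.
Hypothesis mU : forall N, borel_measurable (U (scale N)).
Hypothesis UZ : forall N, {ae P, forall w, U (scale N) w = g (Z (scale N) w)}.
Local Open Scope ereal_scope.
Local Notation J' := (contracted_rate setT J).

Lemma closed_contraction_preimage F : closed F -> closed (K `&` g @^-1` F).
Proof.
move=> cF; have /continuous_closedP/(_ F cF)/closed_subspaceP[V cV VK] := g_cont.
rewrite setIC in VK; rewrite -[_ `&` _]setIC -VK.
exact: closedI.
Qed.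

(** The open complement of K has probability 0 at every scale, so the lower bound of the principle
    forces an infinite rate on it. *)
Lemma rate_pinfty_out z : ~ K z -> J z = +oo.
Proof.
move=> nKz; have oK : open (~` K) by rewrite openC.
have P0 N : P (Z (scale N) @^-1` (~` K)) = 0.
  rewrite (@ae_eq_measure _ _ _ _ _ set0) ?measure0//; first exact/Z_ldp.1.
  by apply: filterS (ZK N) => w Kw; split.
have [+ _ _] := Z_ldp.2 (~` K) (fun N => Z_ldp.1 N _ oK).
have -> : (fun N => (scale N)%:E * lne (P (Z (scale N) @^-1` (~` K)))) =
    (fun=> -oo : \bar R).
  by apply/funext => N; rewrite P0 le0_lneNy// gt0_muleNy// lte_fin scale_gt0.
rewrite (cvgNy_limn_einf_sup (@cvg_cst _ _ _ _ _)).1 leeNy_eq => /eqP h.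
have : ereal_inf [set J y | y in interior (~` K)] <= J z.
  by apply: ereal_inf_lbound; exists z => //; rewrite (interior_id _).1.
by move: h => /(congr1 oppe); rewrite oppeK => -> /=; rewrite leye_eq => /eqP.
Qed.

Lemma contracted_rate_gt_ex l (v : R) : J' l < v%:E ->
  exists2 z, K z /\ g z = l & J z < v%:E.
Proof.
move=> /ereal_inf_lt[_ [z [_ /= gz] <-] Jz]; exists z => //; split => //.
apply: contrapT => /rate_pinfty_out Jy.
by rewrite Jy in Jz.
Qed.

Lemma contracted_rate_le z : J' (g z) <= J z.
Proof. by apply: ereal_inf_lbound; exists z. Qed.

Lemma contracted_rate_ge0 l : 0 <= J' l.
Proof. by apply: le_ereal_inf_tmp => _ [z _ <-]; exact: J_good.1.1. Qed.

(** This form avoids showing that the infimum is attained: levels a + 1/(k+1) leave room for an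
    approximate minimizer, and each set intersected is the continuous image of a compact set. *)
Lemma contracted_sublevel (a : R) : [set l | J' l <= a%:E] =
  \bigcap_(k : nat) (g @` (K `&` [set z | J z <= (a + k.+1%:R^-1)%:E])).
Proof.
apply/seteqP; split => l /=.
  move=> la k _; have /contracted_rate_gt_ex[z [Kz gz] Jz] :
      J' l < (a + k.+1%:R^-1)%:E.
    by apply: le_lt_trans la _; rewrite lte_fin ltrDl.
  by exists z => //; split => //; exact: ltW.
move=> H; apply: lee_real_gt => v; rewrite lte_fin => av.
have [k kv] : exists k : nat, (k.+1%:R^-1 < v - a)%R.
  have va : (0 < v - a)%R by rewrite subr_gt0.
  have [k _ /(_ k (leqnn k)) /= Hk] := @near_infty_natSinv_lt R (PosNum va).
  by exists k.
have [z [_ /= zk] <-] := H k I.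
apply: le_trans (contracted_rate_le z) _; apply: le_trans zk _.
by rewrite lee_fin -lerBrDl ltW.
Qed.

Lemma compact_contracted_sublevel (a : R) : (0 <= a)%R ->
  compact [set l | J' l <= a%:E].
Proof.
move=> a0; have ck (k : nat) :
    compact (g @` (K `&` [set z | J z <= (a + k.+1%:R^-1)%:E])).
  apply: continuous_compact.
    by apply: continuous_subspaceW g_cont; exact: subIsetl.
  rewrite setIC; apply: compact_closedI => //.
  by apply: J_good.2; rewrite addr_ge0.
rewrite contracted_sublevel.
apply: (subclosed_compact _ (ck 0%N)); last by move=> l; exact.
apply: closed_bigI => k _; apply: compact_closed; last exact: ck.
exact: norm_hausdorff.
Qed.

Lemma contracted_good : good_rate_function J'.
Proof.
split; last exact: compact_contracted_sublevel.
split; first exact: contracted_rate_ge0.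
apply/lower_semicontinuousP => a.
have [a0|a0] := leP 0%R a; last first.
  have -> : [set x | a%:E < J' x] = setT.
    apply/seteqP; split => // l _ /=; apply: lt_le_trans (contracted_rate_ge0 l).
    by rewrite lte_fin.
  exact: openT.
have -> : [set x | a%:E < J' x] = ~` [set x | J' x <= a%:E].
  by apply/seteqP; split => x /=; rewrite ltNge => /negP.
rewrite openC; apply: compact_closed; last exact: compact_contracted_sublevel.
exact: norm_hausdorff.
Qed.

Lemma contraction_measure N G : measurable (U (scale N) @^-1` G) ->
  measurable (Z (scale N) @^-1` (K `&` g @^-1` G)) ->
  P (U (scale N) @^-1` G) = P (Z (scale N) @^-1` (K `&` g @^-1` G)).
Proof.
move=> m1 m2; apply: ae_eq_measure => //.
apply: filterS2 (ZK N) (UZ N) => w Kw Uw /=.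
by rewrite Uw; split => [|[]].
Qed.

Lemma contraction_ldp : ldp P U J'.
Proof.
split => // G mG u; split; last 2 first.
- exact: limn_einf_sup.
- set F := K `&` g @^-1` closure G.
  have cF : closed F by apply: closed_contraction_preimage; exact: closed_closure.
  have mF N : measurable (Z (scale N) @^-1` F).
    exact: borel_measurable_closed (Z_ldp.1 N) cF.
  have [_ _] := Z_ldp.2 F mF; rewrite -(closure_id F).1//.
  set u' := (fun N => (scale N)%:E * _) => h.
  have uu' N : u N <= u' N.
    rewrite /u /u' lee_wpmul2l// ?lee_fin ?(ltW (scale_gt0 N))//.
    rewrite lee_lne ?in_itv/= ?leey ?andbT//.
    rewrite -contraction_measure//.
      apply: le_measure; rewrite ?inE//; last by move=> w; exact: subset_closure.
      exact: borel_measurable_closed (mU N) (@closed_closure _ G).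
    exact: borel_measurable_closed (mU N) (@closed_closure _ G).
  have {uu'}uu' : limn_esup u <= limn_esup u'.
    rewrite !limn_esup_lim; apply: lee_lim; [exact: is_cvg_esups|exact: is_cvg_esups|].
    apply: nearW => N; apply: ge_ereal_sup => _ [k Nk <-].
    by apply: le_trans (uu' k) _; apply: ereal_sup_ubound; exists k.
  apply: le_trans uu' (le_trans h _); rewrite leeN2.
  apply: le_ereal_inf_tmp => _ [z [Kz Gz] <-].
  apply: le_trans (contracted_rate_le z).
  by apply: ereal_inf_lbound; exists (g z).
(* The preimage of an open set under g is open only relative to K; the complement of the closed set
   F is open in the whole space and agrees with it on K, where Z lives. *)
- set F := K `&` g @^-1` (~` interior G).
  have cF : closed F.
    apply: closed_contraction_preimage; rewrite closedC; exact: open_interior.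
  have oV : open (~` F) by rewrite openC.
  have mV N : measurable (Z (scale N) @^-1` (~` F)) by exact: Z_ldp.1.
  have [+ _ _] := Z_ldp.2 _ mV; rewrite (interior_id (~` F)).1//.
  set u' := (fun N => (scale N)%:E * _) => h.
  have uu' N : u' N <= u N.
    rewrite /u /u' lee_wpmul2l// ?lee_fin ?(ltW (scale_gt0 N))//.
    rewrite lee_lne ?in_itv/= ?leey ?andbT//.
    apply: (@le_trans _ _ (P (U (scale N) @^-1` interior G))).
      rewrite le_eqVlt; apply/orP; left; apply/eqP/ae_eq_measure => //.
        exact/mU/open_interior.
      apply: filterS2 (ZK N) (UZ N) => w Kw Uw; rewrite /F /= Uw; split.
        by move=> H; apply: contrapT => nG; exact: H.
      by move=> Gw [_].
    apply: le_measure; rewrite ?inE//; first exact/mU/open_interior.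
    by move=> w; exact: interior_subset.
  have {uu'}uu' : limn_einf u' <= limn_einf u.
    rewrite !limn_einf_lim; apply: lee_lim; [exact: is_cvg_einfs|exact: is_cvg_einfs|].
    apply: nearW => N; apply: le_ereal_inf_tmp => _ [k Nk <-].
    by apply: le_trans (uu' k); apply: ereal_inf_lbound; exists k.
  apply: le_trans (le_trans h uu'); rewrite leeN2.
  apply: le_ereal_inf_tmp => _ [l Gl <-]; apply: lee_real_gt => v.
  move=> /contracted_rate_gt_ex[z [Kz gz] Jz]; apply: le_trans (ltW Jz).
  by apply: ereal_inf_lbound; exists z => //; rewrite /F /= gz => -[_].
Qed.

End contraction_principle.

(** * The cone that carries Z, and continuity of g on it *)

Section limit_cone.
Context {R : realType}.
Implicit Types (z : 'rV[R]_4) (C : R).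

Definition limit_cone C : set 'rV[R]_4 :=
  [set z | [/\ `|z 0 (inord 0)| <= C * z 0 (inord 2),
    `|z 0 (inord 1)| <= C * z 0 (inord 3),
    0 <= z 0 (inord 2) & z 0 (inord 2) <= z 0 (inord 3)]].

Lemma closed_limit_cone C : closed (limit_cone C).
Proof.
have ci (i : 'I_4) : continuous (fun z : 'rV[R]_4 => z 0 i) by move=> z; exact: coord_continuous.
have cn (i : 'I_4) : continuous (fun z : 'rV[R]_4 => `|z 0 i|).
  move=> z; apply: (@continuous_comp _ _ _ (fun z : 'rV[R]_4 => z 0 i) Num.norm).
    exact: ci.
  exact: norm_continuous.
have cle (a b : 'rV[R]_4 -> R) : continuous a -> continuous b -> closed [set z | a z <= b z].
  move=> ca cb; have -> : [set z | a z <= b z] = (fun z => b z - a z) @^-1` [set x | 0 <= x].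
    by apply/seteqP; split => z /=; rewrite subr_ge0.
  apply: closed_comp; last exact: closed_ge.
  by move=> z _; apply: (@cvgB _ _ _ (nbhs z) _ b a); [exact: cb|exact: ca].
have cC i : continuous (fun z : 'rV[R]_4 => C * z 0 i).
  by move=> z; apply: (@cvgM _ _ (nbhs z) _ (cst C) (fun z : 'rV[R]_4 => z 0 i));
    [exact: cvg_cst|exact: ci].
have -> : limit_cone C = ([set z | `|z 0 (inord 0)| <= C * z 0 (inord 2)] `&`
    [set z | `|z 0 (inord 1)| <= C * z 0 (inord 3)]) `&`
    ([set z | 0 <= z 0 (inord 2)] `&` [set z | z 0 (inord 2) <= z 0 (inord 3)]).
  by apply/seteqP; split => z /= => [[? ? ? ?]|[[? ?] [? ?]]].
apply: closedI; apply: closedI.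
- by apply: cle; [exact: cn|exact: cC].
- by apply: cle; [exact: cn|exact: cC].
- by apply: (cle (cst 0)); [exact: cst_continuous|exact: ci].
- by apply: cle; exact: ci.
Qed.

Lemma limit_cone_g C z : limit_cone C z -> `|g z| <= 2 * (C * z 0 (inord 2)).
Proof.
move=> [h0 h1 h2 h3].
rewrite /g (le_trans (ler_normD _ _))// normrN mulr_natl mulr2n lerD//.
(* If the last coordinate vanishes, the cone forces z_3 = 0 and the quotient is 0 by convention. *)
have [z3|z3] := eqVneq (z 0 (inord 3)) 0.
  have z2 : z 0 (inord 2) = 0 by apply/eqP; rewrite eq_le h2 andbT -z3.
  by rewrite z2 mul0r mulr0 normr0 mulr0.
have z30 : 0 < z 0 (inord 3) by rewrite lt_neqAle eq_sym z3 (le_trans h2).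
rewrite normrM (ger0_norm (divr_ge0 _ _)) ?(ltW z30)// mulrA ler_pdivrMr//.
by rewrite (mulrAC C) ler_wpM2r.
Qed.

Lemma within_continuous_g C : {within limit_cone C, continuous (g : 'rV[R]_4 -> R)}.
Proof.
apply/subspace_continuousP => z Kz.
have [h0 h1 h2 h3] := Kz.
have [z3|z3] := eqVneq (z 0 (inord 3)) 0.
  have z2 : z 0 (inord 2) = 0 by apply/eqP; rewrite eq_le h2 andbT -z3.
  have gz : g z = 0.
    by apply/eqP; rewrite -normr_le0 (le_trans (limit_cone_g Kz))// z2 !mulr0.
  suff : (g : 'rV[R]_4 -> R) @ within (limit_cone C) (nbhs z) --> g z by [].
  rewrite gz; apply/cvgr0Pnorm_le => e e0.
  have : \forall z' \near nbhs z, (z' : 'rV[R]_4) 0 (inord 2) < e / (2 * `|C| + 1).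
    have : (fun z' : 'rV[R]_4 => z' 0 (inord 2)) @ nbhs z --> z 0 (inord 2) by exact: coord_continuous.
    move=> /cvgr_lt; apply; rewrite z2 divr_gt0// ltr_pwDr// mulr_ge0//.
  move=> H; apply: filterS H => z' + Kz'.
  rewrite ltr_pdivlMr ?ltr_pwDr ?mulr_ge0// => ze.
  apply: le_trans (limit_cone_g Kz') _; have [_ _ z'2 _] := Kz'.
  have : C * z' 0 (inord 2) <= `|C| * z' 0 (inord 2) by rewrite ler_wpM2r// ler_norm.
  by lra.
apply: cvg_within_filter.
have ci i : (fun z : 'rV[R]_4 => z 0 i) @ nbhs z --> z 0 i by exact: coord_continuous.
rewrite /g; apply: cvgD; first by apply: cvgN; exact: ci.
apply: cvgM; first exact: ci.
by apply: cvgM; [exact: ci|apply: cvgV => //; exact: ci].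
Qed.

End limit_cone.

Lemma contracted_rate_g_dom {R : realType} (J : 'rV[R]_4 -> \bar R) :
  (forall z, ~ g_dom z -> J z = +oo%E) ->
  contracted_rate g_dom J = contracted_rate setT J.
Proof.
move=> Jy; apply/funext => l; apply/eqP; rewrite eq_le; apply/andP; split.
  apply: le_ereal_inf_tmp => _ [z [_ gz] <-].
  have [Dz|/Jy ->] := pselect (g_dom z); last by rewrite leey.
  by apply: ereal_inf_lbound; exists z.
by apply: ereal_inf_le_tmp => _ [z [_ gz] <-]; exists z.
Qed.

(** * Log-moment generating functions *)

Lemma integral_expR_gt0 {R : realType} {d} {T : measurableType d}
    (P : probability T R) (Y : T -> R) : measurable_fun setT Y ->
  (0 < \int[P]_w (expR (Y w))%:E)%E.
Proof.
move=> mY; have mE : measurable_fun setT (fun w => (expR (Y w))%:E).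
  by apply/measurable_EFinP; exact: measurableT_comp.
have I0 : (0 <= \int[P]_w (expR (Y w))%:E)%E.
  by apply: integral_ge0 => w _; rewrite lee_fin expR_ge0.
rewrite lt_neqAle I0 andbT eq_sym; apply/negP => /eqP M0.
have : (\int[P]_w `|(expR (Y w))%:E| = 0)%E.
  rewrite -M0; apply: eq_integral => w _.
  by rewrite gee0_abs// lee_fin expR_ge0.
move/(ae_eq_integral_abs P measurableT mE) => [A [mA A0 HA]].
have := probability_setT P; rewrite (_ : setT = A).
  by move=> /eqP; rewrite A0 eq_sym onee_eq0.
apply/seteqP; split => // w _; apply: HA => /= /(_ I)/eqP.
by rewrite eqe gt_eqF// expR_gt0.
Qed.

Section log_moment_generating_function.
Context {R : realType} {d} {T : measurableType d} (P : probability T R).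
Variable X : {RV P >-> R}.
Local Open Scope ereal_scope.
Local Notation La := (log_mgf X).

Lemma mmt_genE t : 'M_P X t = \int[P]_w (expR (t * X w))%:E.
Proof.
rewrite /mmt_gen_fun unlock; apply: eq_integral => w _.
by rewrite /= mulrC.
Qed.

Lemma measurable_expRM t : measurable_fun setT (fun w => (expR (t * X w))%:E).
Proof.
apply/measurable_EFinP; apply: measurableT_comp => //.
by apply: measurable_funM => //; exact: measurable_funPT.
Qed.

Lemma mmt_gen_ge0 t : 0 <= 'M_P X t.
Proof.
by rewrite mmt_genE; apply: integral_ge0 => w _; rewrite lee_fin expR_ge0.
Qed.

Definition trunc_event (k : nat) : set T := [set w | (`|X w| <= k%:R)%R].

Lemma measurable_trunc_event k : measurable (trunc_event k).
Proof.
have -> : trunc_event k = (fun w => `|X w|)%R @^-1` `]-oo, k%:R].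
  by apply/seteqP; split => w /=; rewrite in_itv.
by rewrite -[X in measurable X]setTI; apply: measurableT_comp.
Qed.

Lemma trunc_mgf_cvg t :
  \int[P]_(w in trunc_event k) (expR (t * X w))%:E @[k --> \oo] --> 'M_P X t.
Proof.
rewrite mmt_genE.
under eq_fun do rewrite integral_mkcond.
have -> : \int[P]_w (expR (t * X w))%:E =
    \int[P]_w (limn (fun k => ((fun w => (expR (t * X w))%:E) \_ (trunc_event k)) w)).
  apply: eq_integral => w _; apply/esym/cvg_lim => //.
  apply: cvg_near_cst; near=> k.
  rewrite patchE mem_set//= /trunc_event/=.
  by near: k; exact: nbhs_infty_ger.
apply: cvg_monotone_convergence => //.
- move=> k; apply/(measurable_restrictT _ (measurable_trunc_event k)).
  by apply: measurable_funTS; exact: measurable_expRM.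
- by move=> k w _; rewrite patchE; case: ifP => // _; rewrite lee_fin expR_ge0.
- move=> w _ j k jk; rewrite !patchE.
  case: ifPn => [|_]; last by case: ifP => // _; rewrite lee_fin expR_ge0.
  rewrite inE /trunc_event/= => wj; rewrite mem_set//=.
  by apply: le_trans wj _; rewrite ler_nat.
Unshelve. all: by end_near. Qed.

Lemma trunc_bounded k (h : R -> R) : measurable_fun setT h ->
  (forall M : R, exists C : R, forall x, (`|x| <= M)%R -> (`|h x| <= C)%R) ->
  P.-integrable (trunc_event k) (EFin \o (h \o X)).
Proof.
move=> mh /(_ k%:R)[C hC]; apply: measurable_bounded_integrable.
- exact: measurable_trunc_event.
- by rewrite -ge0_fin_numE// fin_num_measure//; exact: measurable_trunc_event.
- by apply: measurableT_comp => //; apply: measurable_funTS; exact: measurable_funPT.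
- exists C; split; first exact: num_real.
  by move=> M CM w wk /=; rewrite (le_trans (hC _ wk))// ltW.
Qed.

(* The exponential moment generating function restricted to [X <= k] is
   minorized through Jensen's inequality for the measure tilted by [exp (m X)];
   letting k grow, every value below [La m] is attained at m by an affine
   minorant of La. *)
Lemma log_mgf_affine_minorant (m a : R) : a%:E < La m ->
  exists p : R, forall u, (a + p * (u - m))%:E <= La u.
Proof.
move=> am; have {}am : (expR a)%:E < 'M_P X m.
  by move: am; rewrite -lte_expeR lneK ?in_itv/= ?mmt_gen_ge0 ?leey.
have [k ak] : exists k, (expR a)%:E < \int[P]_(w in trunc_event k) (expR (m * X w))%:E.
  have [k _ /(_ k (leqnn k)) kP] := cvge_near_gt (trunc_mgf_cvg (t := m)) am.
  by exists k.
set S := trunc_event k in ak *.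
have mS : measurable S := measurable_trunc_event k.
have expb (t M : R) : exists C : R, forall x, (`|x| <= M)%R -> (`|expR (t * x)| <= C)%R.
  exists (expR (`|t| * M)) => x xM; rewrite ger0_norm ?expR_ge0// ler_expR.
  by rewrite (le_trans (ler_norm _))// normrM ler_wpM2l.
have mexp (t : R) : measurable_fun setT (fun x : R => expR (t * x)).
  by apply: measurableT_comp => //; exact: measurable_funM.
have iexp (t : R) : P.-integrable S (EFin \o (fun w => expR (t * X w))).
  exact: (@trunc_bounded k _ (mexp t) (expb t)).
have ixexp : P.-integrable S (EFin \o (fun w => (X w * expR (m * X w))%R)).
  apply: (@trunc_bounded k (fun x => x * expR (m * x))%R).
    by apply: measurable_funM => //; exact: measurable_id.
  move=> M; have [C HC] := expb m M; exists (`|M| * C)%R => x xM.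
  rewrite normrM; apply: ler_pM => //; last exact: HC.
  by rewrite (le_trans xM)// ler_norm.
pose A := (\int[P]_(w in S) expR (m * X w))%R.
pose B := (\int[P]_(w in S) (X w * expR (m * X w)))%R.
have AE : \int[P]_(w in S) (expR (m * X w))%:E = A%:E.
  by rewrite /A /Rintegral fineK//; exact: integrable_fin_num (iexp m).
have aA : (expR a < A)%R by rewrite -lte_fin -AE.
have A0 : (0 < A)%R by apply: lt_trans aA; exact: expR_gt0.
(* The slope is the mean of X under the probability with density proportional to exp(m X) on S. *)
exists (B / A)%R => u; set p := (B / A)%R.
have ineq : (A * expR ((u - m) * p) <= \int[P]_(w in S) expR (u * X w))%R.
  (* [c1 + c2 * X] is the tangent line of exp((u - m) X) at X = p; it integrates against exp(m X) to
     A exp((u - m) p), because p is the tilted mean. *)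
  pose c1 := (expR ((u - m) * p) * (1 - (u - m) * p))%R.
  pose c2 := (expR ((u - m) * p) * (u - m))%R.
  have -> : (A * expR ((u - m) * p) =
    \int[P]_(w in S) (c1 * expR (m * X w) + c2 * (X w * expR (m * X w))))%R.
    rewrite RintegralD//; last 2 first.
    - exact: integrableZl (iexp m).
    - exact: integrableZl ixexp.
    rewrite !RintegralZl// -/A -/B.
    have -> : B = (p * A)%R by rewrite /p divfK// gt_eqF.
    by rewrite /c1 /c2; ring.
  apply: le_Rintegral => //.
    apply: (@integrableD _ _ _ P S mS (EFin \o (fun w => c1 * expR (m * X w))%R)
      (EFin \o (fun w => c2 * (X w * expR (m * X w)))%R)).
    - exact: integrableZl (iexp m).
    - exact: integrableZl ixexp.
  move=> w Sw.
  have -> : (u * X w = m * X w + ((u - m) * p + (u - m) * (X w - p)))%R by ring.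
  rewrite !expRD.
  have := expR_ge1Dx ((u - m) * (X w - p)).
  rewrite -(ler_pM2l (expR_gt0 ((u - m) * p))) -(ler_pM2l (expR_gt0 (m * X w))).
  by apply: le_trans; rewrite /c1 /c2 le_eqVlt; apply/orP; left; apply/eqP; ring.
rewrite -lee_expeR lneK ?in_itv/= ?mmt_gen_ge0 ?leey//.
apply: (@le_trans _ _ (\int[P]_(w in S) (expR (u * X w))%:E)); last first.
  by rewrite mmt_genE; apply: ge0_subset_integral => //; exact: measurable_expRM.
have -> : \int[P]_(w in S) (expR (u * X w))%:E =
    (\int[P]_(w in S) expR (u * X w))%R%:E.
  by rewrite /Rintegral fineK//; exact: integrable_fin_num (iexp u).
rewrite lee_fin expRD; apply: le_trans ineq.
by rewrite (mulrC p) ler_wpM2r ?expR_ge0// ltW.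
Qed.

Lemma mmt_gen_gt0 t : 0 < 'M_P X t.
Proof.
rewrite mmt_genE; apply: integral_expR_gt0.
by apply: measurable_funM => //; exact: measurable_funPT.
Qed.

Lemma log_mgf_gtNy t : -oo < La t.
Proof.
rewrite /log_mgf; have := mmt_gen_gt0 t; case: ('M_P X t) => [r| |]//.
by rewrite lte_fin => r0; rewrite lne_EFin// ltNyr.
Qed.

Lemma log_mgf0 : La 0 = 0.
Proof.
rewrite /log_mgf mmt_genE (eq_integral (cst 1)).
  by rewrite integral_cst//= mul1e probability_setT lne1.
by move=> w _; rewrite mul0r expR0.
Qed.

(** A minorant nearly touching at the intermediate point is averaged over a and b; infinite values
    then need no separate treatment, as they would with Hölder's inequality. *)
Lemma log_mgf_convex (t a b : R) : (0 <= t <= 1)%R ->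
  La (t * a + (1 - t) * b)%R <= t%:E * La a + (1 - t)%:E * La b.
Proof.
move=> /andP[t0 t1]; apply: lee_real_lt => v /log_mgf_affine_minorant[p Hp].
set m := (t * a + (1 - t) * b)%R in Hp.
have t10 : (0 <= 1 - t)%R by rewrite subr_ge0.
apply: (@le_trans _ _ (t%:E * (v + p * (a - m))%:E + (1 - t)%:E * (v + p * (b - m))%:E)).
  by rewrite -!EFinM -EFinD lee_fin le_eqVlt; apply/orP; left; apply/eqP; rewrite /m; ring.
by apply: leeD; apply: lee_wpmul2l => //; exact: Hp.
Qed.

Lemma log_mgf_lsc : lower_semicontinuous (La : R -> \bar R).
Proof.
move=> m a /lte_real_between[b [ab /log_mgf_affine_minorant[p Hp]]].
exists [set u | (a < b + p * (u - m))%R]; last first.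
  by move=> u /= au; apply: lt_le_trans (Hp u); rewrite lte_fin.
have c : (fun u : R => b + p * (u - m))%R @ m --> (b + p * (m - m))%R.
  apply: cvgD; first exact: cvg_cst.
  by apply: cvgM; [exact: cvg_cst|apply: cvgB; [exact: cvg_id|exact: cvg_cst]].
have /cvgr_gt := c; apply.
by rewrite subrr mulr0 addr0 -lte_fin.
Qed.

Lemma measurable_log_mgf : measurable_fun setT (La : R -> \bar R).
Proof. exact: lower_semicontinuous_measurable log_mgf_lsc. Qed.

Hypothesis X_ge0 : forall w, (0 <= X w)%R.

Lemma log_mgf_nondecreasing (s t : R) : (s <= t)%R -> La s <= La t.
Proof.
move=> st; rewrite lee_lne ?in_itv/= ?mmt_gen_ge0 ?leey//.
rewrite !mmt_genE; apply: ge0_le_integral => //; try exact: measurable_expRM.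
by move=> w _; rewrite lee_fin ler_expR ler_wpM2r.
Qed.

Lemma log_mgf_le0 (t : R) : (t <= 0)%R -> La t <= 0.
Proof. by move=> t0; rewrite -log_mgf0; exact: log_mgf_nondecreasing. Qed.

Lemma log_mgf_ge0 (t : R) : (0 <= t)%R -> 0 <= La t.
Proof. by move=> t0; rewrite -log_mgf0; exact: log_mgf_nondecreasing. Qed.

Lemma log_mgf_neg_fin (t : R) : (t <= 0)%R -> La t \is a fin_num.
Proof.
by move=> t0; rewrite fin_real// log_mgf_gtNy (le_lt_trans (log_mgf_le0 t0))// ltry.
Qed.

(** Dominated convergence: exp(- c X) tends to the indicator of {X = 0}, a null event. *)
Lemma log_mgfNy : P (X @^-1` [set 0%R]) = 0 ->
  forall v : R, exists c : nat, La (- c%:R)%R < v%:E.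
Proof.
move=> P0 v.
have mX0 : measurable (X @^-1` [set 0%R]).
  by rewrite -[X in measurable X]setTI; apply: measurable_funPT => //; exact: measurable_set1.
have : \int[P]_w (expR (- c%:R * X w))%:E @[c --> \oo] -->
    \int[P]_w (\1_(X @^-1` [set 0%R]) w)%:E.
  apply: (@dominated_cvg _ _ _ P setT measurableT _ _ (cst 1)) => //.
  - by move=> c; exact: measurable_expRM.
  - move=> w _; rewrite indicE; have [Xw|Xw] := eqVneq (X w) 0%R.
      rewrite mem_set//=; apply: cvg_near_cst; apply: nearW => c.
      by rewrite Xw mulr0 expR0.
    rewrite memNset/=; last by apply/eqP.
    apply: cvg_EFin; first exact: nearW.
    have Xw0 : (0 < X w)%R by rewrite lt_neqAle eq_sym Xw X_ge0.
    apply/cvgr0Pnorm_le => e e0; near=> c.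
    rewrite /= ger0_norm ?expR_ge0// -[leRHS](lnK e0)// ler_expR mulNr lerNl.
    rewrite -ler_pdivrMr//.
    by near: c; exact: nbhs_infty_ger.
  - by apply/integrableP; split => //; rewrite integral_cst//= normr1 mul1e probability_setT ltry.
  - move=> c w _ /=; rewrite lee_fin ger0_norm ?expR_ge0// -[leRHS]expR0 ler_expR.
    by rewrite mulNr oppr_le0 mulr_ge0.
have -> : \int[P]_w (\1_(X @^-1` [set 0%R]) w)%:E = 0.
  by rewrite integral_indic// setIT; exact: P0.
move=> h; have := @cvge_near_lt _ _ _ (expR v) h; rewrite lte_fin expR_gt0.
move=> /(_ isT)[c _ /(_ c (leqnn c))] /=; rewrite -mmt_genE => Mc; exists c.
rewrite -lte_expeR lneK ?in_itv/= ?mmt_gen_ge0 ?leey//.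
Unshelve. all: by end_near. Qed.

End log_moment_generating_function.

Lemma log_mgf_law {R : realType} {d} {T : measurableType d}
    (P : probability T R) (X Y : {RV P >-> R}) :
  (forall B : set R, measurable B -> distribution P X B = distribution P Y B) ->
  log_mgf X = log_mgf Y.
Proof.
move=> XY; apply/funext => t; rewrite /log_mgf; congr lne; rewrite !mmt_genE.
have mt : measurable_fun [set: R] (fun x : R => (expR (t * x))%:E).
  by apply/measurable_EFinP; apply: measurableT_comp => //; exact: measurable_funM.
have t0 (x : R) : (0 <= (expR (t * x))%:E)%E by rewrite lee_fin expR_ge0.
rewrite -(ge0_integral_distribution X mt t0) -(ge0_integral_distribution Y mt t0).
by apply: eq_measure_integral => B mB _; exact: XY.
Qed.

(** * Repeated differentiability on an open set of reals *)

Section differentiability_order.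
Context {R : realType}.
Implicit Types (D : set R) (phi psi : R -> R).

(** The derivatives are quantified existentially, so stability under products, inverses and [ln]
    follows by induction without formulas for higher derivatives. *)
Fixpoint derivable_order (n : nat) D phi : Prop :=
  if n is m.+1 then
    exists psi, (forall t, D t -> is_derive t 1 phi (psi t)) /\
      derivable_order m D psi
  else True.

Lemma derivable_orderS n D phi : derivable_order n.+1 D phi -> derivable_order n D phi.
Proof.
elim: n phi => [//|n IH] phi [psi [dphi /IH dpsi]].
by exists psi.
Qed.

Lemma derivable_orderD n D phi psi : derivable_order n D phi ->
  derivable_order n D psi -> derivable_order n D (phi \+ psi).
Proof.
elim: n phi psi => [//|n IH] phi psi [phi' [d1 h1]] [psi' [d2 h2]].
exists (phi' \+ psi'); split; last exact: IH.
by move=> t Dt; apply: is_deriveD; [exact: d1|exact: d2].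
Qed.

Lemma derivable_orderM n D phi psi : derivable_order n D phi ->
  derivable_order n D psi -> derivable_order n D (phi \* psi).
Proof.
elim: n phi psi => [//|n IH] phi psi o1 o2.
have [phi' [d1 h1]] := o1; have [psi' [d2 h2]] := o2.
exists ((phi \* psi') \+ (psi \* phi')); split.
  by move=> t Dt; apply: is_deriveM; [exact: d1|exact: d2].
by apply: derivable_orderD; apply: IH => //; exact: derivable_orderS.
Qed.

Lemma derivable_orderN n D phi : derivable_order n D phi ->
  derivable_order n D (fun t => - phi t).
Proof.
elim: n phi => [//|n IH] phi [phi' [d1 h1]].
exists (fun t => - phi' t); split; last exact: IH.
by move=> t Dt; apply: is_deriveN; exact: d1.
Qed.

Lemma derivable_orderV n D phi : (forall t, D t -> phi t != 0) ->
  derivable_order n D phi -> derivable_order n D (fun t => (phi t)^-1).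
Proof.
move=> phi0; elim: n => [//|n IH] o1.
have iV := IH (derivable_orderS o1).
have [phi' [d1 h1]] := o1.
exists ((fun t => - ((phi t)^-1 * (phi t)^-1)) \* phi'); split.
  move=> t Dt; apply: is_derive_eq; first exact: (is_deriveV (phi0 _ Dt) (d1 _ Dt)).
  by rewrite /= expr2 invfM.
by apply: derivable_orderM => //; apply: derivable_orderN; exact: derivable_orderM.
Qed.

Lemma derivable_order_ln n D phi : (forall t, D t -> 0 < phi t) ->
  derivable_order n D phi -> derivable_order n D (fun t => ln (phi t)).
Proof.
case: n => [//|n] phi0 o1.
have iV : derivable_order n D (fun t => (phi t)^-1).
  by apply: derivable_orderV (derivable_orderS o1) => t /phi0 /lt0r_neq0.
have [phi' [d1 h1]] := o1.
exists ((fun t => (phi t)^-1) \* phi'); split; last exact: derivable_orderM.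
by move=> t Dt; exact: (is_derive1_comp (is_derive1_ln (phi0 t Dt)) (d1 t Dt)).
Qed.

Lemma derivable_order_eq n D phi psi : open D -> (forall t, D t -> phi t = psi t) ->
  derivable_order n D phi -> derivable_order n D psi.
Proof.
move=> oD; case: n => [//|n] e [phi' [d1 h1]]; exists phi'; split => // t Dt.
apply: near_eq_is_derive (d1 t Dt).
have : nbhs t D by exact: open_nbhs_nbhs.
by apply: filterS => u Du; exact: e.
Qed.

Lemma derivable_order_derive1 n D phi : open D -> derivable_order n.+1 D phi ->
  derivable_order n D (derive1 phi).
Proof.
move=> oD [psi [dphi]]; apply: derivable_order_eq => // t Dt.
by rewrite derive1E; have /@derive_val -> := dphi t Dt.
Qed.

Lemma derivable_order_is_derive D phi : open D ->
  (forall n, derivable_order n D phi) ->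
  forall k t, D t -> is_derive t 1 (derive1n k phi) (derive1n k.+1 phi t).
Proof.
move=> oD H k; have {}H n : derivable_order n D (derive1n k phi).
  elim: k n => [|k IH] n; first by rewrite derive1n0.
  by rewrite derive1nS; apply: derivable_order_derive1.
move=> t Dt; have [psi [/(_ t Dt) d _]] := H 1%N.
by rewrite derive1nS derive1E; split => //; case: d.
Qed.

End differentiability_order.

(** * Differentiation of the moment generating function *)

Section moments.
Context {R : realType} {d} {T : measurableType d} (P : probability T R).
Variable X : {RV P >-> R}.
Hypothesis X_ge0 : forall w, 0 <= X w.

(** For X >= 0 the generating function is finite on a left half-line, of which this is the interior;
    the margin b - t absorbs any power of X. *)
Definition mgf_dom : set R := [set t | exists2 b, t < b & ('M_P X b < +oo)%E].

Lemma open_mgf_dom : open mgf_dom.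
Proof.
rewrite openE => t [b tb Mb]; have : \forall s \near t, s < b by exact: lt_nbhsl.
by apply: filterS => s sb; exists b.
Qed.

Definition moment (k : nat) (t : R) : R := \int[P]_w (X w ^+ k * expR (t * X w)).

(** With dl = (b - v) / (k + 1), X <= exp(dl X) / dl, and the k-th power costs k dl <= b - v in the
    exponent. The bound does not depend on t, as domination requires. *)
Lemma moment_bound k (t v b : R) w : t <= v -> v < b ->
  X w ^+ k * expR (t * X w) <= (k.+1%:R / (b - v)) ^+ k * expR (b * X w).
Proof.
move=> tv vb; have bv : 0 < b - v by rewrite subr_gt0.
pose dl := (b - v) / k.+1%:R; have dl0 : 0 < dl by rewrite divr_gt0.
have Xe : X w <= k.+1%:R / (b - v) * expR (dl * X w).
  have -> : k.+1%:R / (b - v) = dl^-1 by rewrite /dl invf_div.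
  rewrite -(ler_pM2l dl0) mulrA divff ?gt_eqF// mul1r.
  by apply: le_trans (expR_ge1Dx _); rewrite lerDr.
have Xk : X w ^+ k <= (k.+1%:R / (b - v)) ^+ k * expR (k%:R * (dl * X w)).
  rewrite expRM_natl -exprMn; apply: lerXn2r => //; rewrite nnegrE//.
  by rewrite mulr_ge0 ?expR_ge0// divr_ge0// ltW.
apply: (@le_trans _ _ ((k.+1%:R / (b - v)) ^+ k * expR (k%:R * (dl * X w)) * expR (t * X w))).
  by rewrite ler_wpM2r ?expR_ge0.
rewrite -mulrA -expRD ler_wpM2l ?exprn_ge0 ?divr_ge0 ?(ltW bv)// ler_expR.
rewrite mulrA -mulrDl ler_wpM2r//.
have : k%:R * dl <= b - v.
  by rewrite /dl mulrCA ler_piMr ?(ltW bv)// ler_pdivrMr// mul1r ler_nat.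
lra.
Qed.

Lemma measurable_moment k t : measurable_fun setT (fun w => X w ^+ k * expR (t * X w)).
Proof.
apply: measurable_funM; first by apply: measurable_funX; exact: measurable_funPT.
by apply: measurableT_comp => //; apply: measurable_funM => //; exact: measurable_funPT.
Qed.

Lemma integrable_expRM b : ('M_P X b < +oo)%E ->
  P.-integrable setT (EFin \o (fun w => expR (b * X w))).
Proof.
move=> Mb; apply/integrableP; split; first exact: measurable_expRM.
apply: le_lt_trans Mb; rewrite mmt_genE le_eqVlt; apply/orP; left; apply/eqP.
by apply: eq_integral => w _ /=; rewrite ger0_norm ?expR_ge0.
Qed.

Lemma integrable_moment k t : mgf_dom t ->
  P.-integrable setT (EFin \o (fun w => X w ^+ k * expR (t * X w))).
Proof.
move=> [b tb Mb].
apply: (@le_integrable _ _ _ P setT measurableT _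
  (EFin \o (fun w => (k.+1%:R / (b - t)) ^+ k * expR (b * X w)))).
- by apply/measurable_EFinP; exact: measurable_moment.
- move=> w _ /=; rewrite lee_fin !ger0_norm ?mulr_ge0 ?exprn_ge0 ?expR_ge0 ?divr_ge0 ?subr_ge0 ?(ltW tb)//.
  exact: moment_bound.
- exact: (integrableZl measurableT _ (integrable_expRM Mb)).
Qed.

Lemma is_derive_moment k t : mgf_dom t -> is_derive t 1 (moment k) (moment k.+1 t).
Proof.
(* The midpoint v bounds a neighbourhood of t on which one multiple of exp(b X) dominates all
   derivatives. *)
move=> [b tb Mb]; pose v := (t + b) / 2.
have tv : t < v by rewrite /v; lra.
have vb : v < b by rewrite /v; lra.
have I_t : (`](t - 1), v[%classic : set R) t by rewrite /= in_itv/= tv andbT; lra.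
have der (s : R) w : is_derive s 1 (fun s : R => X w ^+ k * expR (s * X w))
    (X w ^+ k.+1 * expR (s * X w)).
  have h1 : is_derive s 1 (fun s : R => s * X w) (X w).
    have -> : (fun s => s * X w) = X w \*: (id : R -> R).
      by apply/funext => s'; rewrite /= mulrC.
    by apply: is_derive_eq; rewrite /GRing.scale/= mulr1.
  have h2 := @is_derive1_comp _ expR (fun s => s * X w) s _ _ (is_derive_expR (s * X w)) h1.
  have h3 := is_deriveZ (X w ^+ k) h2.
  by apply: (is_derive_eq h3); rewrite /GRing.scale/= exprSr; ring.
have intf (s : R) : `](t - 1), v[%classic s ->
    P.-integrable setT (EFin \o (fun w => X w ^+ k * expR (s * X w))).
  rewrite /= in_itv/= => /andP[_ sv]; apply: integrable_moment; exists b => //.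
  exact: lt_trans vb.
have derf (s : R) w : `](t - 1), v[%classic s -> setT w ->
    derivable (fun s : R => X w ^+ k * expR (s * X w)) s 1.
  by move=> _ _; case: (der s w).
pose G w := (k.+2%:R / (b - v)) ^+ k.+1 * expR (b * X w).
have G0 w : 0 <= G w.
  by rewrite mulr_ge0 ?exprn_ge0 ?expR_ge0 ?divr_ge0 ?subr_ge0 ?(ltW vb).
have iG : P.-integrable setT (EFin \o G).
  exact: (integrableZl measurableT _ (integrable_expRM Mb)).
have GE (s : R) w : partial1of2 (fun (s : R) w => X w ^+ k * expR (s * X w)) s w =
    X w ^+ k.+1 * expR (s * X w).
  by rewrite partial1of2E; have /@derive_val -> := der s w.
have Gub (s : R) w : `](t - 1), v[%classic s -> setT w ->
    `|partial1of2 (fun (s : R) w => X w ^+ k * expR (s * X w)) s w| <= G w.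
  rewrite /= in_itv/= => /andP[_ sv] _; rewrite GE.
  rewrite ger0_norm ?mulr_ge0 ?exprn_ge0 ?expR_ge0//.
  by apply: moment_bound => //; exact: ltW.
have h := cvg_differentiation_under_integral measurableT I_t intf derf G0 iG Gub.
split.
  exact: (derivable_under_integral measurableT I_t intf derf G0 iG Gub).
rewrite -derive1E (differentiation_under_integral measurableT I_t intf derf G0 iG Gub).
by apply: eq_Rintegral => w _; rewrite GE.
Qed.

Lemma derivable_order_moment n k : derivable_order n mgf_dom (moment k).
Proof.
elim: n k => [//|n IH] k; exists (moment k.+1); split => // t Dt.
exact: is_derive_moment.
Qed.

Lemma moment0E t : mgf_dom t -> 'M_P X t = (moment 0 t)%:E.
Proof.
move=> Dt; rewrite mmt_genE /moment /Rintegral fineK.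
  by apply: eq_integral => w _; rewrite expr0 mul1r.
exact: integrable_fin_num (integrable_moment 0 Dt).
Qed.

Lemma moment0_gt0 t : mgf_dom t -> 0 < moment 0 t.
Proof. by move=> Dt; rewrite -lte_fin -moment0E// mmt_gen_gt0. Qed.

Lemma log_mgf_fin_dom t : mgf_dom t -> log_mgf X t = (ln (moment 0 t))%:E.
Proof. by move=> Dt; rewrite /log_mgf moment0E// lne_EFin// moment0_gt0. Qed.

Lemma is_derive_log_mgf k t : mgf_dom t ->
  is_derive t 1 (derive1n k (fine \o log_mgf X)) (derive1n k.+1 (fine \o log_mgf X) t).
Proof.
apply: derivable_order_is_derive; first exact: open_mgf_dom.
move=> n; apply: (@derivable_order_eq _ _ _ (fun t => ln (moment 0 t))).
- exact: open_mgf_dom.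
- by move=> s Ds /=; rewrite log_mgf_fin_dom.
- by apply: derivable_order_ln; [exact: moment0_gt0|exact: derivable_order_moment].
Qed.

Lemma derive_log_mgf_bounded k (a b : R) : mgf_dom b ->
  exists2 C, 0 <= C & forall t, a <= t <= b -> `|(derive1n k (fine \o log_mgf X)) t| <= C.
Proof.
move=> [b' bb' Mb'].
have [ab|ba] := leP a b; last first.
  by exists 0 => // t /andP[h1 h2]; move: (le_trans h1 h2); rewrite leNgt ba.
have : {within `[a, b], continuous (derive1n k (fine \o log_mgf X))}.
  apply: derivable_within_continuous => t; rewrite in_itv/= => /andP[_ tb].
  have Dt : mgf_dom t by exists b' => //; exact: le_lt_trans bb'.
  by case: (is_derive_log_mgf k Dt).
move=> c; have [u uab Hu] := EVT_max ab c; have [v vab Hv] := EVT_min ab c.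
exists (Num.max `|(derive1n k (fine \o log_mgf X)) u| `|(derive1n k (fine \o log_mgf X)) v|).
  by rewrite le_max normr_ge0.
move=> t tab; have t' : t \in `[a, b] by rewrite in_itv.
have h1 := Hu _ t'; have h2 := Hv _ t'.
rewrite le_max !ler_norml.
have [x0|x0] := leP 0 ((derive1n k (fine \o log_mgf X)) t).
  apply/orP; left; rewrite (le_trans h1) ?ler_norm ?andbT//.
  by rewrite (le_trans _ x0)// oppr_le0.
apply/orP; right; rewrite (le_trans (ltW x0)) ?normr_ge0 ?andbT//.
by apply: le_trans h2; rewrite lerNl -normrN ler_norm.
Qed.

End moments.

(** * Products of functions of independent variables *)

Import HBSimple HBNNSimple.

Section independent_weights.
Context {R : realType} {d} {T : measurableType d} (P : probability T R).
Implicit Types (Y W V : T -> R) (phi : R -> R).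
Local Open Scope ereal_scope.

Lemma integral_nnsfun_weight (g : {nnsfun R >-> R}) Y V :
  measurable_fun setT Y -> measurable_fun setT V -> (forall w, (0 <= V w)%R) ->
  \int[P]_w (g (Y w) * V w)%:E = \sum_(y <- fset_set (range g))
    `|y|%:E * \int[P]_w (\1_(g @^-1` [set y]) (Y w) * V w)%:E.
Proof.
move=> mY mV V0.
have gE x : g x = (\sum_(y <- fset_set (range g)) `|y| * \1_(g @^-1` [set y]) x)%R.
  rewrite {1}fimfunE fsbig_finite//=; apply: eq_big_seq => y.
  by rewrite in_fset_set// inE => -[z _ <-]; rewrite ger0_norm.
have mI y : measurable_fun setT (fun w => \1_(g @^-1` [set y]) (Y w) : R).
  by apply: measurableT_comp mY; apply: measurable_indic.
under eq_integral => w _ do rewrite gE mulr_suml -sumEFin.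
rewrite ge0_integral_sum//=.
- apply: eq_bigr => y _; rewrite -ge0_integralZl_EFin//.
  + by apply: eq_integral => w _; rewrite -EFinM mulrA.
  + by move=> w _; rewrite lee_fin mulr_ge0.
  + by apply/measurable_EFinP; exact: measurable_funM.
- move=> y; apply/measurable_EFinP; apply: measurable_funM => //.
  by apply: measurable_funM => //.
- by move=> y w _; rewrite lee_fin !mulr_ge0.
Qed.

Lemma cvg_integral_weight phi Y V (mphi : measurable_fun setT (EFin \o phi)) :
  (forall x, (0 <= phi x)%R) ->
  measurable_fun setT Y -> measurable_fun setT V -> (forall w, (0 <= V w)%R) ->
  \int[P]_w (nnsfun_approx measurableT mphi n (Y w) * V w)%:E @[n --> \oo] -->
  \int[P]_w (phi (Y w) * V w)%:E.
Proof.
move=> phi0 mY mV V0; set g := nnsfun_approx _ _.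
have -> : \int[P]_w (phi (Y w) * V w)%:E =
    \int[P]_w limn (fun n => (g n (Y w) * V w)%:E).
  apply: eq_integral => w _; apply/esym/cvg_lim => //.
  have -> : (fun n => (g n (Y w) * V w)%:E) = (fun n => (g n (Y w))%:E * (V w)%:E).
    by apply/funext => n; rewrite EFinM.
  rewrite EFinM; apply: cvgeZr => //.
  by apply: cvg_nnsfun_approx => // x _; rewrite lee_fin.
apply: cvg_monotone_convergence => //.
- move=> n; apply/measurable_EFinP; apply: measurable_funM => //.
  exact: measurableT_comp mY.
- by move=> n w _; rewrite lee_fin mulr_ge0.
- move=> w _ m n mn; rewrite lee_fin ler_wpM2r//.
  by have /lefP := nd_nnsfun_approx measurableT mphi mn; apply.
Qed.

(** From indicators to nonnegative functions through simple functions and monotone convergence. W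
    will hold the factors of all other variables, so only factorization against events of Y is
    required. *)
Lemma indep_weight phi Y W (C : R) :
  measurable_fun setT phi -> (forall x, (0 <= phi x)%R) ->
  measurable_fun setT Y -> measurable_fun setT W -> (forall w, (0 <= W w)%R) ->
  (forall B : set R, measurable B -> \int[P]_w (\1_B (Y w) * W w)%:E =
     C%:E * P (Y @^-1` B)) ->
  \int[P]_w (phi (Y w) * W w)%:E = C%:E * \int[P]_w (phi (Y w))%:E.
Proof.
move=> /measurable_EFinP mphi phi0 mY mW W0 HC.
have c1 := cvg_integral_weight mphi phi0 mY mW W0.
have c2 := @cvg_integral_weight phi Y (cst 1%R) mphi phi0 mY (measurable_cst _) (fun=> ler01).
have -> : \int[P]_w (phi (Y w))%:E = \int[P]_w (phi (Y w) * cst 1%R w)%:E.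
  by apply: eq_integral => w _; rewrite /= mulr1.
have C0 : (0 <= C)%R.
  have : 0 <= C%:E * P (Y @^-1` setT).
    by rewrite -HC//; apply: integral_ge0 => w _; rewrite lee_fin mulr_ge0.
  by rewrite preimage_setT probability_setT mule1 lee_fin.
have E n : \int[P]_w (nnsfun_approx measurableT mphi n (Y w) * W w)%:E =
    C%:E * \int[P]_w (nnsfun_approx measurableT mphi n (Y w) * cst 1%R w)%:E.
  rewrite !integral_nnsfun_weight// ge0_sume_distrr; last first.
    move=> y _; apply: mule_ge0 => //; apply: integral_ge0 => w _.
    by rewrite lee_fin mulr_ge0.
  apply: eq_bigr => y _; rewrite muleCA; congr (_ * _).
  have mB : measurable (nnsfun_approx measurableT mphi n @^-1` [set y]).
    exact: measurable_sfunP.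
  rewrite HC//; congr (_ * _).
  rewrite -[LHS](_ : \int[P]_w (\1_(Y @^-1` (nnsfun_approx measurableT mphi n @^-1` [set y])) w)%:E = _).
    by apply: eq_integral => w _; rewrite /= mulr1 !indicE.
  by rewrite integral_indic ?setIT// -[X in measurable X]setTI; exact: mY.
have {c2} := cvgeZl (isT : C%:E \is a fin_num) c2.
rewrite (_ : (fun n => C%:E * _) = (fun n =>
  \int[P]_w (nnsfun_approx measurableT mphi n (Y w) * W w)%:E)); last first.
  by apply/funext => n; rewrite E.
by move=> c2; apply: cvg_unique c1 c2; exact: ereal_hausdorff.
Qed.

End independent_weights.

Section independence_products.
Context {R : realType} {d} {T : measurableType d} (P : probability T R).
Variable X : int -> {RV P >-> R}.
Hypothesis X_indep : mutually_independent X.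

Lemma prod_indic (s : seq int) (B : int -> set R) w :
  (\prod_(m <- s) \1_(B m) (X m w) : R)%R =
  \1_(\bigcap_(m in [set` s]) (X m @^-1` B m)) w.
Proof.
elim: s => [|m s IH].
  by rewrite big_nil bigcap_seq big_nil indicT.
by rewrite big_cons IH !bigcap_seq big_cons indicI.
Qed.

Variables (phi : int -> R -> R) (e : int -> R).
Hypothesis mphi : forall m, measurable_fun setT (phi m).
Hypothesis phi_ge0 : forall m x, 0 <= phi m x.

(** The indicator list s2 strengthens the induction: to detach the factor of m by [indep_weight], it
    is first replaced by an indicator, which joins s2, where the induction hypothesis applies. *)
Lemma expectation_prod_mixed (s1 s2 : seq int) (B : int -> set R) :
  uniq (s1 ++ s2) -> (forall m, measurable (B m)) ->
  (forall m, m \in s1 -> (\int[P]_w (phi m (X m w))%:E = (e m)%:E)%E) ->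
  (\int[P]_w ((\prod_(m <- s1) phi m (X m w)) *
     \prod_(m <- s2) \1_(B m) (X m w))%:E =
   ((\prod_(m <- s1) e m) * \prod_(m <- s2) fine (P (X m @^-1` B m)))%:E)%E.
Proof.
elim: s1 s2 B => [|m s1 IH] s2 B us mB he.
  under eq_integral => w _ do rewrite big_nil mul1r prod_indic.
  have mX k (A : set R) : measurable A -> measurable (X k @^-1` A).
    by move=> mA; rewrite -[X in measurable X]setTI; exact: (measurable_funPT (X k)).
  rewrite integral_indic//; last first.
    by apply: fin_bigcap_measurable => // k _; exact: mX.
  have PX : P (\bigcap_(k in [set` s2]) (X k @^-1` B k)) =
      (\prod_(k <- s2) P (X k @^-1` B k))%E by exact: X_indep.
  rewrite setIT [LHS]PX big_nil mul1r -prodEFin; apply: eq_bigr => k _.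
  by rewrite fineK// fin_num_measure//; exact: mX.
move: us; rewrite /= mem_cat negb_or => /andP[/andP[ms1 ms2] us].
pose W w := \prod_(k <- s1) phi k (X k w) * \prod_(k <- s2) \1_(B k) (X k w).
under eq_integral => w _ do rewrite big_cons -mulrA -/(W w).
have mphiX k : measurable_fun setT (fun w => phi k (X k w)).
  by apply: measurableT_comp => //; exact: measurable_funPT.
rewrite (@indep_weight _ _ _ P (phi m) (X m) W
  ((\prod_(k <- s1) e k) * \prod_(k <- s2) fine (P (X k @^-1` B k)))) //.
- rewrite he ?mem_head// -EFinM big_cons; congr EFin; ring.
- apply: measurable_funM; first by apply: measurable_prod => k _; exact: mphiX.
  apply: measurable_prod => k _; apply: measurableT_comp; last exact: measurable_funPT.
  exact: measurable_indic.
- move=> w; rewrite mulr_ge0//; first by apply: prodr_ge0 => k _.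
  by apply: prodr_ge0.
(* As m is not in s2, this changes none of the existing indicators. *)
move=> A mA; pose B' k := if k == m then A else B k.
have mB' k : measurable (B' k) by rewrite /B'; case: ifP.
have B'm : B' m = A by rewrite /B' eqxx.
have us' : uniq (s1 ++ m :: s2).
  rewrite uniq_catC /= mem_cat negb_or ms1 ms2 /=.
  by rewrite uniq_catC.
have B's2 k : k \in s2 -> B' k = B k.
  by move=> ks2; rewrite /B'; case: eqP => // km; rewrite -km ks2 in ms2.
have he1 k : k \in s1 -> (\int[P]_w (phi k (X k w))%:E = (e k)%:E)%E.
  by move=> ks; apply: he; rewrite in_cons ks orbT.
have := IH (m :: s2) B' us' mB' he1.
rewrite [in X in _ = X%:E -> _]big_cons B'm.
have -> : \prod_(k <- s2) fine (P (X k @^-1` B' k)) =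
    \prod_(k <- s2) fine (P (X k @^-1` B k)).
  by apply: eq_big_seq => k /B's2 ->.
move=> IHA; rewrite (_ : (_ * P _)%E = ((\prod_(m <- s1) e m) * (fine (P (X m @^-1` A)) *
   \prod_(k <- s2) fine (P (X k @^-1` B k))))%:E); last first.
  rewrite -[P _](@fineK _ (P (X m @^-1` A))); last first.
    by rewrite fin_num_measure// -[X in measurable X]setTI; exact: (measurable_funPT (X m)).
  by rewrite -EFinM; congr EFin; ring.
rewrite -IHA; apply: eq_integral => w _; congr EFin.
rewrite /W big_cons B'm.
have -> : \prod_(k <- s2) \1_(B' k) (X k w) = \prod_(k <- s2) \1_(B k) (X k w) :> R.
  by apply: eq_big_seq => k /B's2 ->.
by ring.
Qed.

Lemma expectation_prod_indep (s : seq int) : uniq s ->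
  (forall m, m \in s -> (\int[P]_w (phi m (X m w))%:E = (e m)%:E)%E) ->
  (\int[P]_w (\prod_(m <- s) phi m (X m w))%:E = (\prod_(m <- s) e m)%:E)%E.
Proof.
move=> us he.
have := @expectation_prod_mixed s [::] (fun=> setT) _ (fun=> measurableT) he.
rewrite cats0 big_nil mulr1 => <-//.
by apply: eq_integral => w _; rewrite big_nil mulr1.
Qed.

End independence_products.

(** * Integrated log-moment generating functions *)

Definition unit_itv {R : realType} : set R := `[0, 1].

Section unit_interval.
Context {R : realType}.
Local Notation mu := (@lebesgue_measure R).
Local Notation I01 := unit_itv.
Local Open Scope ereal_scope.

Lemma lebesgue_measure01 : mu I01 = 1.
Proof. by rewrite /unit_itv lebesgue_measure_itv/= lte_fin ltr01 oppr0 adde0. Qed.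

Lemma measurable01 : measurable (I01 : set R).
Proof. exact: measurable_itv. Qed.

#[local] Hint Extern 0 (measurable unit_itv) => exact: measurable01 : core.

Lemma integral_cst01 (r : \bar R) : \int[mu]_(s in I01) (cst r) s = r.
Proof.
rewrite integral_cst//; transitivity (r * 1); last exact: mule1.
by congr (_ * _); exact: lebesgue_measure01.
Qed.

Lemma ge0_le_integral01 (f1 f2 : R -> \bar R) : (forall s, I01 s -> 0 <= f1 s) ->
  measurable_fun I01 f1 -> measurable_fun I01 f2 ->
  (forall s, I01 s -> f1 s <= f2 s) ->
  \int[mu]_(s in I01) f1 s <= \int[mu]_(s in I01) f2 s.
Proof. by move=> f10 mf1 mf2 f12; apply: ge0_le_integral. Qed.

Lemma ge0_integralD01 (f1 f2 : R -> \bar R) : (forall s, I01 s -> 0 <= f1 s) ->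
  measurable_fun I01 f1 -> (forall s, I01 s -> 0 <= f2 s) ->
  measurable_fun I01 f2 ->
  \int[mu]_(s in I01) (f1 s + f2 s) =
  \int[mu]_(s in I01) f1 s + \int[mu]_(s in I01) f2 s.
Proof. by move=> f10 mf1 f20 mf2; apply: ge0_integralD. Qed.

Lemma ge0_integralZl01 (k : R) (f : R -> \bar R) : (0 <= k)%R ->
  (forall s, I01 s -> 0 <= f s) -> measurable_fun I01 f ->
  \int[mu]_(s in I01) (k%:E * f s) = k%:E * \int[mu]_(s in I01) f s.
Proof. by move=> k0 f0 mf; apply: ge0_integralZl_EFin. Qed.

Lemma integral_shift (f : R -> \bar R) (D : R) : (0 <= D)%R ->
  measurable_fun I01 f -> (forall s, I01 s -> (- D)%:E <= f s) ->
  \int[mu]_(s in I01) (f s + D%:E) = \int[mu]_(s in I01) f s + D%:E.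
Proof.
move=> D0 mf fD.
have fn s : I01 s -> f^\- s <= D%:E.
  by move=> /fD; rewrite funenegE ge_max lee_fin D0 andbT leeNl.
have ifn : \int[mu]_(s in I01) f^\- s \is a fin_num.
  rewrite ge0_fin_numE; last exact: integral_ge0.
  apply: (@le_lt_trans _ _ (\int[mu]_(s in I01) (cst D%:E) s)).
    by apply: ge0_le_integral01 => //; exact: measurable_funeneg.
  by rewrite integral_cst01 ltry.
have E : \int[mu]_(s in I01) (f s + D%:E) + \int[mu]_(s in I01) f^\- s =
    \int[mu]_(s in I01) f^\+ s + D%:E.
  have fD0 s : I01 s -> 0 <= f s + D%:E.
    by move=> /fD fs; rewrite -leeBlDr// sub0e.
  have mfn := measurable_funeneg mf; have mfp := measurable_funepos mf.
  have mfD : measurable_fun I01 (fun s => f s + D%:E) by exact: emeasurable_funD.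
  rewrite -[in RHS](integral_cst01 D%:E) -!ge0_integralD01//.
  apply: eq_integral => s sI; rewrite /cst addeAC; congr (_ + _).
  rewrite {1}(funeposneg f) /= subeK//.
  move: sI; rewrite inE => /fn fs; rewrite ge0_fin_numE//.
  by apply: le_lt_trans fs _; rewrite ltry.
rewrite [in RHS]integralE addeAC -E addeK//.
Qed.

Lemma integrable_bounded_below (f : R -> \bar R) (D : R) : (0 <= D)%R ->
  measurable_fun I01 f -> (forall s, I01 s -> (- D)%:E <= f s) ->
  \int[mu]_(s in I01) f s < +oo -> mu.-integrable I01 f.
Proof.
move=> D0 mf fD fy; apply/integrableP; split => //.
apply: (@le_lt_trans _ _ (\int[mu]_(s in I01) ((f s + D%:E) + D%:E))).
  apply: ge0_le_integral01 => //.
  - exact: measurableT_comp.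
  - by apply: emeasurable_funD => //; exact: emeasurable_funD.
  - move=> s /fD; case: (f s) => [r| |]//=; rewrite -?EFinD ?lee_fin ?leey// => h.
    have [r0|r0] := leP 0%R r; [rewrite ger0_norm|rewrite ltr0_norm] => //; lra.
rewrite integral_shift//; last 2 first.
  exact: emeasurable_funD.
  by move=> s /fD fs; apply: (@le_trans _ _ 0); [rewrite lee_fin oppr_le0|rewrite -leeBlDr// sub0e].
rewrite integral_shift//; apply: lte_add_pinfty; last exact: ltry.
by apply: lte_add_pinfty => //; exact: ltry.
Qed.

Lemma Rintegral_bounded (h : R -> R) (C : R) (S : set R) :
  measurable_fun I01 h -> measurable S -> mu (I01 `\` S) = 0 ->
  (forall s, I01 s -> S s -> (`|h s| <= C)%R) ->
  mu.-integrable I01 (EFin \o h) /\ (`|\int[mu]_(s in I01) h s| <= `|C|)%R.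
Proof.
move=> mh mS S0 hC.
have le1 : \int[mu]_(s in I01) `|(h s)%:E| <= `|C|%:E.
  have -> : `|C|%:E = \int[mu]_(s in I01) (cst `|C|%:E) s.
    by rewrite integral_cst01.
  apply: ae_ge0_le_integral => //.
  - by apply: measurableT_comp => //; exact/measurable_EFinP.
  - by move=> s _; rewrite lee_fin.
  - exists (I01 `\` S); split => //; first exact: measurableD.
    move=> s /= /not_implyP[Is nh]; split => // Ss; apply: nh.
    by rewrite lee_fin (le_trans (hC _ Is Ss))// ler_norm.
have ih : mu.-integrable I01 (EFin \o h).
  apply/integrableP; split; first exact/measurable_EFinP.
  by apply: le_lt_trans le1 _; rewrite ltry.
split => //; apply: le_trans (le_normr_Rintegral _ ih) _ => //.
rewrite -lee_fin; apply: le_trans le1; rewrite /Rintegral fineK//.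
by apply: integrable_fin_num => //; exact: integrable_norm.
Qed.

End unit_interval.

#[local] Hint Extern 0 (measurable unit_itv) => exact: measurable01 : core.

Section integrated_log_mgf.
Context {R : realType} {d} {T : measurableType d} (P : probability T R).
Variable X : {RV P >-> R}.
Hypothesis X_ge0 : forall w, 0 <= X w.
Context {n : nat}.
Variables (c B : R) (G : R -> 'rV[R]_n).
Hypothesis c_gt0 : 0 < c.
Local Notation mu := (@lebesgue_measure R).
Local Notation I01 := unit_itv.
Hypothesis G_bound : forall s, I01 s -> forall i, `|G s 0 i| <= B.
Hypothesis mG : forall i, measurable_fun I01 (fun s => G s 0 i).

Definition integrated_log_mgf (l : 'rV[R]_n) : \bar R :=
  (\int[mu]_(s in I01) log_mgf X (c * dot l (G s)))%E.
Local Notation L := integrated_log_mgf.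

Lemma measurable_dotG l : measurable_fun I01 (fun s => dot l (G s)).
Proof. by apply: measurable_sum => i; apply: measurable_funM. Qed.

Lemma measurable_log_mgf_dotG l :
  measurable_fun I01 (fun s => log_mgf X (c * dot l (G s))).
Proof.
apply: measurableT_comp; first exact: measurable_log_mgf.
by apply: measurable_funM => //; exact: measurable_dotG.
Qed.

Lemma B_ge0 : n != 0%N -> 0 <= B.
Proof.
case: n G G_bound => // m G' Gb _.
apply: le_trans (normr_ge0 (G' 0 0 ord0)) _.
by apply: Gb; rewrite /unit_itv/= in_itv/= lexx ler01.
Qed.

Lemma dotG_bound l s : I01 s -> `|dot l (G s)| <= l1 l * `|B|.
Proof.
move=> Is; apply: dot_le_coord => i.
by apply: le_trans (ler_norm B); exact: G_bound.
Qed.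

(** Adding this constant makes the integrands of all l with [l1 l <= b] nonnegative: X >= 0 makes
    [log_mgf X] nondecreasing, and finite at nonpositive arguments. *)
Definition lower_const (b : R) : R := - fine (log_mgf X (- (c * (b * `|B|)))).

Lemma lower_const_ge0 b : 0 <= b -> 0 <= lower_const b.
Proof.
move=> b0; have cb : - (c * (b * `|B|)) <= 0 by rewrite oppr_le0 !mulr_ge0// ltW.
by rewrite oppr_ge0 -lee_fin fineK ?log_mgf_neg_fin// log_mgf_le0.
Qed.

Lemma log_mgf_lower b l s : 0 <= b -> I01 s -> l1 l <= b ->
  ((- lower_const b)%:E <= log_mgf X (c * dot l (G s)))%E.
Proof.
move=> b0 Is lb; have cb : - (c * (b * `|B|)) <= 0 by rewrite oppr_le0 !mulr_ge0// ltW.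
rewrite opprK fineK ?log_mgf_neg_fin//; apply: log_mgf_nondecreasing => //.
rewrite -mulrN ler_pM2l//.
have := dotG_bound l Is; rewrite ler_norml => /andP[+ _]; apply: le_trans.
by rewrite lerN2 ler_wpM2r.
Qed.

Lemma integrated_shift b l : 0 <= b -> l1 l <= b ->
  (L l + (lower_const b)%:E =
   \int[mu]_(s in I01) (log_mgf X (c * dot l (G s)) + (lower_const b)%:E))%E.
Proof.
move=> b0 lb; rewrite integral_shift ?lower_const_ge0//.
- exact: measurable_log_mgf_dotG.
- by move=> s Is; exact: log_mgf_lower.
Qed.

Lemma shifted_ge0 b l s : 0 <= b -> l1 l <= b -> I01 s ->
  (0 <= log_mgf X (c * dot l (G s)) + (lower_const b)%:E)%E.
Proof.
by move=> b0 lb Is; have := log_mgf_lower b0 Is lb; rewrite -leeBlDr// sub0e.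
Qed.

Lemma integrated_gtNy l : (-oo < L l)%E.
Proof.
have := integrated_shift (l1_ge0 l) (lexx _).
have : (0 <= \int[mu]_(s in I01) (log_mgf X (c * dot l (G s)) + (lower_const (l1 l))%:E))%E.
  by apply: integral_ge0 => s; apply: shifted_ge0 => //; exact: l1_ge0.
by move=> + E; rewrite -E; case: (L l) => [r| |]//; rewrite ltNyr.
Qed.

Lemma integrated0 : L 0 = 0%E.
Proof.
rewrite /L (eq_integral (cst 0%E)) ?integral0// => s _.
by rewrite dot0l mulr0 log_mgf0.
Qed.

Lemma integrated_convex : econvex L.
Proof.
move=> t l m t01; have /andP[t0 t1] := t01.
have t10 : 0 <= 1 - t by rewrite subr_ge0.
(* A bound common to l, m and their combination, so that one shift serves all three integrals. *)
pose b := l1 l + l1 m.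
have b0 : 0 <= b by rewrite addr_ge0 ?l1_ge0.
have lb : l1 l <= b by rewrite lerDl l1_ge0.
have mb : l1 m <= b by rewrite lerDr l1_ge0.
have tb : l1 (t *: l + (1 - t) *: m) <= b.
  rewrite /b /l1 -big_split; apply: ler_sum => i _; rewrite !mxE.
  apply: le_trans (ler_normD _ _) _; rewrite !normrM (ger0_norm t0) (ger0_norm t10).
  by apply: lerD; rewrite ler_piMl// gerBl.
set D := lower_const b.
rewrite -(@leeD2rE _ D%:E)// integrated_shift//.
have -> : (t%:E * L l + (1 - t)%:E * L m + D%:E =
    t%:E * (L l + D%:E) + (1 - t)%:E * (L m + D%:E))%E.
  move: (L l) (L m) => u v; rewrite !muleDr ?fin_num_adde_defl//.
  rewrite addeACA -!EFinM -EFinD; congr (_ + _)%E; congr EFin; ring.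
have ms k : measurable_fun I01 (fun s => log_mgf X (c * dot k (G s)) + D%:E)%E.
  by apply: emeasurable_funD => //; exact: measurable_log_mgf_dotG.
have s0 k s : l1 k <= b -> I01 s -> (0 <= log_mgf X (c * dot k (G s)) + D%:E)%E.
  by move=> kb; exact: shifted_ge0.
rewrite !integrated_shift// -!ge0_integralZl01//; last 2 first.
- by move=> s; exact: s0.
- by move=> s; exact: s0.
rewrite -ge0_integralD01//; first last.
- exact: measurable_funeM.
- by move=> s Is; rewrite mule_ge0 ?lee_fin//; exact: s0.
- exact: measurable_funeM.
- by move=> s Is; rewrite mule_ge0 ?lee_fin//; exact: s0.
apply: ge0_le_integral01.
- by move=> s; exact: s0.
- exact: ms.
- by apply: emeasurable_funD; exact: measurable_funeM.
move=> s Is; rewrite dotDl !dotZl.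
have -> : c * (t * dot l (G s) + (1 - t) * dot m (G s)) =
    t * (c * dot l (G s)) + (1 - t) * (c * dot m (G s)) by ring.
apply: le_trans (leeD2r _ (log_mgf_convex X _ _ t01)) _.
rewrite !muleDr ?fin_num_adde_defl//= addeACA leeD2l// -!EFinM -EFinD lee_fin.
by rewrite le_eqVlt; apply/orP; left; apply/eqP; ring.
Qed.

Lemma integrated_lsc : lower_semicontinuous L.
Proof.
move=> l a aL; apply: contrapT => H.
have Hk (k : nat) : exists m, `|l - m| < k.+1%:R^-1 /\ (L m <= a%:E)%E.
  apply: contrapT => /forallNP nm; apply: H.
  exists (ball l k.+1%:R^-1); first exact: nbhsx_ballx.
  move=> m; rewrite -ball_normE/= => ml; rewrite ltNge; apply/negP => La.
  exact: nm m (conj ml La).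
have [m_ Hm] := choice Hk.
have m_l : m_ @ \oo --> l.
  apply/cvgrPdist_lt => e e0; near=> k.
  apply: lt_trans (Hm k).1 _; near: k.
  by have := @near_infty_natSinv_lt R (PosNum e0).
have dot_l s : dot (m_ k) (G s) @[k --> \oo] --> dot l (G s).
  have -> : (fun k => dot (m_ k) (G s)) = dot (G s) \o m_.
    by apply/funext => k; rewrite /= dotC.
  rewrite (dotC l); apply: continuous_cvg => //; exact: continuous_dot.
(* Every m_k is within 1 of l in each of the n coordinates, so one shift serves the whole sequence
   and Fatou's lemma applies. *)
pose b := l1 l + n%:R.
have b0 : 0 <= b by rewrite addr_ge0 ?l1_ge0.
have mb k : l1 (m_ k) <= b.
  rewrite /b /l1 -[n in n%:R]card_ord -sumr_const -big_split; apply: ler_sum => i _.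
  have : `|(l - m_ k) 0 i| <= 1.
    apply: le_trans (coord_le_norm _ _) _; apply: le_trans (ltW (Hm k).1) _.
    by rewrite invf_le1// ler1n.
  rewrite !mxE => h; have := ler_normD (l 0 i) (- (l 0 i - m_ k 0 i)).
  rewrite normrN opprB addrC subrK => h'.
  by rewrite -[leRHS]/(`|l 0 i| + 1); lra.
have lb : l1 l <= b by rewrite lerDl.
set D := lower_const b.
have ms k : measurable_fun I01 (fun s => log_mgf X (c * dot k (G s)) + D%:E)%E.
  by apply: emeasurable_funD => //; exact: measurable_log_mgf_dotG.
have := @fatou _ _ _ mu I01 measurable01
  (fun k s => log_mgf X (c * dot (m_ k) (G s)) + D%:E)%E (fun k => ms (m_ k))
  (fun k s Is => shifted_ge0 b0 (mb k) Is).
have h1 : (L l + D%:E <= \int[mu]_(s in I01)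
    limn_einf (fun k => log_mgf X (c * dot (m_ k) (G s)) + D%:E))%E.
  rewrite integrated_shift//; apply: ge0_le_integral01.
  - by move=> s; exact: shifted_ge0.
  - exact: ms.
  - under eq_fun do rewrite /limn_einf.
    apply: measurableT_comp => //; apply: measurable_fun_limn_esup => k.
    by apply: measurableT_comp => //; exact: ms.
  move=> s Is; apply: limn_einf_ge_near => v.
  rewrite -lteBlDr// -EFinB => /(log_mgf_lsc)[V cV HV].
  have : c * dot (m_ k) (G s) @[k --> \oo] --> c * dot l (G s).
    by apply: cvgM => //; exact: cvg_cst.
  move=> /(_ V cV) [j _ Hj]; exists j => // k jk; have := HV _ (Hj k jk).
  by rewrite EFinB lteBlDr// => /ltW.
move=> h2; have := le_trans h1 h2.
have h3 : (limn_einf (fun k => \int[mu]_(s in I01)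
    (log_mgf X (c * dot (m_ k) (G s)) + D%:E)) <= a%:E + D%:E)%E.
  apply: le_trans (limn_einf_sup _) _; apply: limn_esup_le_near => v av.
  near=> k; rewrite -integrated_shift//; apply: le_trans (ltW av).
  by rewrite leeD2r//; have [] := Hm k.
move=> /le_trans/(_ h3); rewrite leeD2rE// => La.
by move: aL; rewrite ltNge La.
Unshelve. all: by end_near. Qed.

Lemma integrated_fin : (forall t, (log_mgf X t < +oo)%E) -> forall l, (L l < +oo)%E.
Proof.
move=> Xfin l; apply: (@le_lt_trans _ _ (\int[mu]_(s in I01)
    (cst (log_mgf X (c * (l1 l * `|B|))) s))%E); last first.
  rewrite integral_cst01; exact: Xfin.
have M0 : 0 <= c * (l1 l * `|B|) by rewrite !mulr_ge0 ?l1_ge0// ltW.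
apply: (@le_trans _ _ (L l + (lower_const (l1 l))%:E - (lower_const (l1 l))%:E)%E).
  by rewrite addeK.
rewrite integrated_shift ?l1_ge0// leeBlDr//.
have D0 := lower_const_ge0 (l1_ge0 l).
rewrite -integral_shift//; last by move=> s _; rewrite (le_trans _ (log_mgf_ge0 _ M0))// lee_fin oppr_le0.
apply: ge0_le_integral01 => //.
- by move=> s; apply: shifted_ge0 => //; exact: l1_ge0.
- by apply: emeasurable_funD => //; exact: measurable_log_mgf_dotG.
- move=> s Is; rewrite leeD2r//; apply: log_mgf_nondecreasing => //.
  rewrite ler_pM2l//; have := dotG_bound l Is.
  by rewrite ler_norml => /andP[].
Qed.

End integrated_log_mgf.

Section quantitative_differentiability.
Context {R : realType}.

(** The bound on |z - x| lets the theorem be applied again, to df between x and z, for a quadratic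
    remainder. *)
Lemma mvt_between (f df : R -> R) (a b x y : R) :
  (forall t, a <= t <= b -> is_derive t 1 f (df t)) ->
  a <= x <= b -> a <= y <= b ->
  exists2 z, a <= z <= b & `|z - x| <= `|y - x| /\ f y - f x = df z * (y - x).
Proof.
move=> Hd /andP[ax xb] /andP[ay yb].
have key u v : u <= v -> a <= u -> v <= b ->
    exists2 z, u <= z <= v & f v - f u = df z * (v - u).
  move=> uv au vb.
  have [||z] := @MVT_segment R f df u v uv.
  - move=> z; rewrite in_itv/= => /andP[uz zv]; apply: Hd.
    by rewrite (le_trans au (ltW uz)) (le_trans (ltW zv) vb).
  - apply: derivable_within_continuous => z; rewrite in_itv/= => /andP[uz zv].
    have := Hd z; rewrite (le_trans au uz) (le_trans zv vb) => /(_ isT).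
    by case.
  - by rewrite in_itv/= => zuv ?; exists z.
have [xy|yx] := leP x y.
  have [z /andP[xz zy] E] := key _ _ xy ax yb; exists z; last split => //.
    by rewrite (le_trans ax xz) (le_trans zy yb).
  by rewrite !ger0_norm ?subr_ge0// lerB.
have [z /andP[yz zx] E] := key _ _ (ltW yx) ay xb; exists z; last split.
- by rewrite (le_trans ay yz) (le_trans zx xb).
- by rewrite distrC (distrC y) !ger0_norm ?subr_ge0 ?(ltW yx)// lerB.
- by rewrite -(opprB (f x)) E; ring.
Qed.

Lemma is_derive_quadratic {V : normedModType R} (f : V -> R) (l v : V) (D C r : R) :
  0 < r -> (forall t, `|t| < r -> `|f (l + t *: v) - f l - t * D| <= C * t ^+ 2) ->
  is_derive l v f D.
Proof.
move=> r0 H.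
have cv : h^-1 *: (f (h *: v + l) - f l) @[h --> 0^'] --> D.
  apply/cvgrPdist_le => e e0; pose q := Num.min r (e / (`|C| + 1)).
  have C1 : 0 < `|C| + 1 by rewrite ltr_wpDl.
  have q0 : 0 < q by rewrite lt_min r0 divr_gt0.
  exists q => // h; rewrite /= sub0r normrN => hq h0.
  have hr : `|h| < r by apply: lt_le_trans hq _; rewrite ge_min lexx.
  have he : `|h| * (`|C| + 1) <= e.
    by rewrite -ler_pdivlMr//; apply: le_trans (ltW hq) _; rewrite ge_min lexx orbT.
  have := H h hr; rewrite (addrC l) => Hh.
  have hn0 : 0 < `|h| by rewrite normr_gt0.
  rewrite -(ler_pM2l hn0) -normrM mulrBr /GRing.scale/= mulrA divff// mul1r.
  rewrite distrC; apply: le_trans Hh _.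
  rewrite -(real_normK (num_real h)) expr2 mulrCA ler_pM2l//.
  by apply: le_trans he; rewrite mulrC ler_wpM2l// (le_trans (ler_norm C))// lerDl ler01.
split; first by apply/cvg_ex; exists D.
exact: cvg_lim cv.
Qed.

End quantitative_differentiability.

(** * Smoothness inside the effective domain *)

Section integrated_log_mgf_smooth.
Context {R : realType} {d} {T : measurableType d} (P : probability T R).
Variable X : {RV P >-> R}.
Hypothesis X_ge0 : forall w, 0 <= X w.
Context {n : nat}.
Variables (c B : R) (G : R -> 'rV[R]_n).
Hypothesis c_gt0 : 0 < c.
Local Notation mu := (@lebesgue_measure R).
Local Notation I01 := unit_itv.
Hypothesis G_bound : forall s, I01 s -> forall i, `|G s 0 i| <= B.
Hypothesis mG : forall i, measurable_fun I01 (fun s => G s 0 i).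
Local Notation L := (integrated_log_mgf X c G).
Local Notation dom := (mgf_dom X).

(* Zero outside the open domain, so as to be measurable everywhere. *)
Definition dlog_mgf k : R -> R := (derive1n k (fine \o log_mgf X)) \_ dom.

Lemma dlog_mgfE k t : dom t -> dlog_mgf k t = derive1n k (fine \o log_mgf X) t.
Proof. by move=> Dt; rewrite /dlog_mgf patchE mem_set. Qed.

Lemma measurable_dlog_mgf k : measurable_fun setT (dlog_mgf k).
Proof.
have oD := @open_mgf_dom _ _ _ P X.
apply/(measurable_restrictT _ _).1; first exact: open_measurable.
apply: open_continuous_measurable_fun => // t; rewrite inE => Dt.
apply/differentiable_continuous/derivable1_diffP.
by case: (is_derive_log_mgf X_ge0 k Dt).
Qed.

Lemma mgf_dom_le b t : t <= b -> dom b -> dom t.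
Proof. by move=> tb [b' bb Mb]; exists b' => //; exact: le_lt_trans bb. Qed.

(** The derivatives of orders k, k+1 and k+2 are bounded on [a, b]; the mean value theorem, used
    once and twice, gives the last two estimates. *)
Lemma dlog_mgf_taylor k (a b : R) : dom b -> exists2 C, 0 <= C &
  forall x y, a <= x <= b -> a <= y <= b ->
    [/\ `|dlog_mgf k x| <= C, `|dlog_mgf k y - dlog_mgf k x| <= C * `|y - x| &
      `|dlog_mgf k y - dlog_mgf k x - dlog_mgf k.+1 x * (y - x)| <= C * `|y - x| ^+ 2].
Proof.
move=> Db.
have [C0 C00 H0] := derive_log_mgf_bounded X_ge0 k a Db.
have [C1 C10 H1] := derive_log_mgf_bounded X_ge0 k.+1 a Db.
have [C2 C20 H2] := derive_log_mgf_bounded X_ge0 k.+2 a Db.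
exists (C0 + C1 + C2); first by rewrite !addr_ge0.
have Dt t : a <= t <= b -> dom t by move=> /andP[_ tb]; exact: mgf_dom_le Db.
have der j t : a <= t <= b -> is_derive t 1 (derive1n j (fine \o log_mgf X))
    (derive1n j.+1 (fine \o log_mgf X) t).
  by move=> /Dt; exact: is_derive_log_mgf.
move=> x y xab yab; rewrite !dlog_mgfE; try exact: Dt.
have [z zab [zx E]] := mvt_between (der k) xab yab.
split.
- by apply: le_trans (H0 _ xab) _; rewrite -addrA lerDl addr_ge0.
- rewrite E normrM ler_wpM2r//; apply: le_trans (H1 _ zab) _.
  by rewrite addrAC lerDr addr_ge0.
- have [z' z'ab [_ E']] := mvt_between (der k.+1) xab zab.
  rewrite E -mulrBl E' !normrM expr2 mulrA ler_wpM2r//.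
  apply: ler_pM => //; apply: le_trans (H2 _ z'ab) _.
  by rewrite lerDr addr_ge0.
Qed.

Lemma l1_le_norm (v : 'rV[R]_n) : l1 v <= n%:R * `|v|.
Proof.
rewrite /l1; apply: (@le_trans _ _ (\sum_(i < n) `|v|)).
  by apply: ler_sum => i _; exact: coord_le_norm.
by rewrite sumr_const card_ord mulr_natl.
Qed.

Lemma dotG_norm (v : 'rV[R]_n) s : I01 s -> `|dot v (G s)| <= n%:R * `|B| * `|v|.
Proof.
move=> Is; apply: le_trans (dotG_bound G_bound v Is) _.
by rewrite mulrAC ler_wpM2r// l1_le_norm.
Qed.

Variable e0 : 'rV[R]_n.
Hypothesis e0G : forall s, I01 s -> dot e0 (G s) = 1.

(* Shifting l0 along e0 raises every dot l (G s) by the same amount; so if L is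
   finite at a shift of l0, then c * dot l (G s) stays, for almost every s and all
   l near l0, in a fixed segment [a, b] of the open domain of the generating
   function. *)
Lemma good_set l0 : interior (effdom L) l0 -> exists S : set R,
  exists r a b : R, [/\ measurable S, mu (I01 `\` S) = 0%E, 0 < r, dom b &
    forall l, `|l - l0| < r -> forall s, I01 s -> S s ->
      a <= c * dot l (G s) <= b].
Proof.
move=> Il0; have /nbhs_ballP[e /= epos eD] := Il0.
pose rho := e / (2 * (1 + `|e0|)).
have e01 : 0 < 1 + `|e0| by rewrite ltr_pwDl.
have rho0 : 0 < rho by rewrite divr_gt0// mulr_gt0.
pose l' := l0 + rho *: e0.
have Ll' : (L l' < +oo)%E.
  apply: eD; rewrite -ball_normE/= /l' opprD addrA subrr sub0r normrN normrZ gtr0_norm//.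
  have rE : rho * (2 * (1 + `|e0|)) = e by rewrite /rho divfK// gt_eqF// mulr_gt0.
  by rewrite -rE ltr_pM2l//; have := normr_ge0 e0; lra.
have l1l' := l1_ge0 l'.
have mK := measurable_log_mgf_dotG X c mG l'.
have iK : mu.-integrable I01 (fun s => log_mgf X (c * dot l' (G s))).
  apply: (@integrable_bounded_below _ _ (lower_const X c B (l1 l'))) => //.
  - exact: (lower_const_ge0 X_ge0 B c_gt0).
  - by move=> s Is; exact: (log_mgf_lower X_ge0 c_gt0 G_bound).
pose S := I01 `&` [set s | (log_mgf X (c * dot l' (G s)) < +oo)%E].
have mS : measurable S by exact: (emeasurable_fun_infty_o measurable01 mK).
have IS : mu (I01 `\` S) = 0%E.
  have [N [mN N0 HN]] : {ae mu, forall s, I01 s -> log_mgf X (c * dot l' (G s)) \is a fin_num}.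
    by apply: integrable_ae.
  apply/eqP; rewrite eq_le measure_ge0 andbT -N0; apply: le_measure; rewrite ?inE//.
    exact: measurableD.
  move=> s [Is nS]; apply: HN => /= /(_ Is) fs; apply: nS; split => //=.
  by move: fs; rewrite fin_numE => /andP[_]; rewrite ltey.
have S0 : exists s, S s.
  apply: contrapT => /forallNP nS; move: IS.
  have -> : I01 `\` S = I01 by apply/seteqP; split => s; [case|move=> Is; split => //; exact: nS].
  by move=> h; have := @lebesgue_measure01 R; rewrite h => /esym/eqP; rewrite onee_eq0.
pose V := [set c * dot l' (G s) | s in S].
have hV : has_sup V.
  split; first by have [s Ss] := S0; exists (c * dot l' (G s)); exists s.
  exists (c * (l1 l' * `|B|)) => _ [s [Is _] <-]; rewrite ler_pM2l//.
  by have := dotG_bound G_bound l' Is; rewrite ler_norml => /andP[].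
pose sg := sup V.
have Vsg s : S s -> c * dot l' (G s) <= sg.
  by move=> Ss; apply: ub_le_sup; [case: hV|exists s].
(* Low enough that some argument at l', with finite value, lies strictly above b; high enough that
   the arguments at l near l0, lower than those at l' by at least c rho / 2, stay below b. *)
pose b := sg - c * rho / 2.
have crho : 0 < c * rho by rewrite mulr_gt0.
have Db : dom b.
  have q0 : 0 < c * rho / 4 by rewrite divr_gt0.
  have [_ [s [Is /= Ms] <-] Hs] := sup_adherent q0 hV.
  exists (c * dot l' (G s)).
    by apply: le_lt_trans Hs; rewrite /b -/sg; lra.
  by move: Ms; rewrite /log_mgf !ltey; apply: contra => /eqP ->.
pose r := rho / 2 / (n%:R * `|B| + 1).
have nB : 0 < n%:R * `|B| + 1 by rewrite ltr_wpDl// mulr_ge0.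
have r0 : 0 < r by rewrite !divr_gt0.
(* The lower end is crude, since the generating function is finite to the left; r makes (l - l0) . G
   s at most rho / 2. *)
exists S, r, (- (c * (l1 l0 * `|B| + rho / 2))), b; split => // l lr s Is Ss.
have h1 : `|dot (l - l0) (G s)| <= rho / 2.
  apply: le_trans (dotG_norm _ Is) _.
  apply: (@le_trans _ _ ((n%:R * `|B| + 1) * `|l - l0|)); first by rewrite ler_wpM2r// lerDl.
  by rewrite mulrC -ler_pdivlMr// ltW.
have h2 := Vsg s Ss; have h3 := dotG_bound G_bound l0 Is.
have El : dot l (G s) = dot l0 (G s) + dot (l - l0) (G s) by rewrite -dotDl addrC subrK.
have El' : dot l' (G s) = dot l0 (G s) + rho by rewrite dotDl dotZl e0G// mulr1.
move: h1 h3; rewrite !ler_norml => /andP[h1a h1b] /andP[h3a h3b].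
rewrite El; apply/andP; split.
  by rewrite -mulrN ler_pM2l//; lra.
have : c * (dot l0 (G s) + dot (l - l0) (G s)) <= c * (dot l' (G s) - rho / 2).
  by rewrite ler_pM2l// El'; lra.
rewrite /b; move: h2; rewrite mulrBr; lra.
Qed.

(** The class of all iterated partial derivatives of L: differentiating along v raises k by one and
    multiplies W by c v . G. *)
Definition weighted k (W : R -> R) l : R :=
  \int[mu]_(s in I01) (dlog_mgf k (c * dot l (G s)) * W s).

Definition bounded_weight (W : R -> R) : Prop :=
  measurable_fun I01 W /\ exists C : R, forall s, I01 s -> `|W s| <= C.

Lemma bounded_weightM W v : bounded_weight W ->
  bounded_weight (fun s => W s * (c * dot v (G s))).
Proof.
move=> [mW [C HC]]; split.
  apply: measurable_funM => //; apply: measurable_funM => //; exact: measurable_dotG.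
exists (C * (c * (n%:R * `|B| * `|v|))) => s Is.
rewrite !normrM (gtr0_norm c_gt0); apply: ler_pM => //; first by rewrite mulr_ge0// ltW.
  exact: HC.
by rewrite ler_pM2l//; exact: dotG_norm.
Qed.

Lemma measurable_weighted k W l : bounded_weight W ->
  measurable_fun I01 (fun s => dlog_mgf k (c * dot l (G s)) * W s).
Proof.
move=> [mW _]; apply: measurable_funM => //.
apply: measurableT_comp; first exact: measurable_dlog_mgf.
by apply: measurable_funM => //; exact: measurable_dotG.
Qed.

Lemma integrable_weighted k W l : bounded_weight W -> interior (effdom L) l ->
  mu.-integrable I01 (EFin \o (fun s => dlog_mgf k (c * dot l (G s)) * W s)).
Proof.
move=> bW Il; have [S [r [a [b [mS S0 r0 Db Hab]]]]] := good_set Il.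
have [C C0 HC] := dlog_mgf_taylor k a Db.
have [mW [CW HW]] := bW.
have [] // := @Rintegral_bounded R (fun s => dlog_mgf k (c * dot l (G s)) * W s) (C * CW) S.
  exact: measurable_weighted.
move=> s Is Ss; have xab : a <= c * dot l (G s) <= b by apply: Hab => //; rewrite subrr normr0.
by rewrite normrM; apply: ler_pM => //; [have [] := HC _ _ xab xab|exact: HW].
Qed.

(** The pointwise Taylor estimates are integrated over the full-measure set of [good_set]. The first
    yields continuity, the second differentiability. *)
Lemma weighted_estimates k W l0 : bounded_weight W -> interior (effdom L) l0 ->
  exists C r, 0 < r /\ forall l, `|l - l0| < r -> interior (effdom L) l ->
    `|weighted k W l - weighted k W l0| <= C * `|l - l0| /\
    `|weighted k W l - weighted k W l0 -
      weighted k.+1 (fun s => W s * (c * dot (l - l0) (G s))) l0| <= C * `|l - l0| ^+ 2.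
Proof.
move=> bW Il0; have [S [r [a [b [mS S0 r0 Db Hab]]]]] := good_set Il0.
have [C C0 HC] := dlog_mgf_taylor k a Db.
have [mW [CW HW]] := bW.
have [K K0 KE] : exists2 K, 0 <= K & K = c * (n%:R * `|B|).
  by exists (c * (n%:R * `|B|)) => //; rewrite !mulr_ge0// ltW.
pose C' := C * `|CW| * (K + K ^+ 2).
have C'0 : 0 <= C' by rewrite !mulr_ge0// addr_ge0// exprn_ge0.
exists C', r; split => // l lr Il.
pose x0 s := c * dot l0 (G s); pose xl s := c * dot l (G s).
have dx s : I01 s -> `|xl s - x0 s| <= K * `|l - l0|.
  move=> Is; rewrite /xl /x0 -mulrBr normrM (gtr0_norm c_gt0) KE -mulrA ler_pM2l//.
  by have := dotG_norm (l - l0) Is; rewrite dotDl dotNl.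
have il := integrable_weighted k bW Il; have il0 := integrable_weighted k bW Il0.
have bW' := bounded_weightM (l - l0) bW.
have il1 := integrable_weighted k.+1 bW' Il0.
have x0ab s : I01 s -> S s -> a <= x0 s <= b.
  by move=> Is Ss; apply: Hab => //; rewrite subrr normr0.
have xlab s : I01 s -> S s -> a <= xl s <= b by move=> Is Ss; exact: Hab.
have CWn s : I01 s -> `|W s| <= `|CW| by move=> Is; apply: le_trans (HW _ Is) (ler_norm _).
split.
  rewrite /weighted -RintegralB//.
  apply: le_trans (Rintegral_bounded (C := C * (K * `|l - l0|) * `|CW|) _ mS S0 _).2 _.
  - by apply: measurable_funB; exact: measurable_weighted.
  - move=> s Is Ss; rewrite -mulrBl normrM; apply: ler_pM => //; last exact: CWn.
    have [_ + _] := HC _ _ (x0ab _ Is Ss) (xlab _ Is Ss); move/le_trans; apply.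
    by rewrite ler_wpM2l//; exact: dx.
  - rewrite ger0_norm ?mulr_ge0//.
    rewrite (_ : _ * _ * _ = C * `|CW| * K * `|l - l0|); last by ring.
    by rewrite ler_wpM2r// ler_wpM2l ?mulr_ge0// lerDl exprn_ge0.
have il2 : mu.-integrable I01 (EFin \o (fun s => dlog_mgf k (c * dot l (G s)) * W s -
    dlog_mgf k (c * dot l0 (G s)) * W s)) by exact: (integrableB _ il il0).
rewrite /weighted -[X in `|X - _|]RintegralB// -RintegralB//.
apply: le_trans (Rintegral_bounded (C := C * (K * `|l - l0|) ^+ 2 * `|CW|) _ mS S0 _).2 _.
- by apply: measurable_funB; [apply: measurable_funB|]; exact: measurable_weighted.
- move=> s Is Ss.
  rewrite (_ : _ - _ - _ = (dlog_mgf k (xl s) - dlog_mgf k (x0 s) -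
      dlog_mgf k.+1 (x0 s) * (xl s - x0 s)) * W s); last first.
    by rewrite /xl /x0 dotDl dotNl; ring.
  rewrite normrM; apply: ler_pM => //; last exact: CWn.
  have [_ _] := HC _ _ (x0ab _ Is Ss) (xlab _ Is Ss); move/le_trans; apply.
  by rewrite ler_wpM2l// lerXn2r ?nnegrE ?mulr_ge0//; exact: dx.
- rewrite ger0_norm ?mulr_ge0 ?exprn_ge0 ?mulr_ge0//.
  rewrite (_ : _ * _ * _ = C * `|CW| * K ^+ 2 * `|l - l0| ^+ 2); last by ring.
  by rewrite ler_wpM2r ?exprn_ge0// ler_wpM2l ?mulr_ge0// lerDr.
Qed.

Lemma continuous_weighted k W l0 : bounded_weight W -> interior (effdom L) l0 ->
  {for l0, continuous (weighted k W)}.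
Proof.
move=> bW Il0; have [C [r [r0 H]]] := weighted_estimates k bW Il0.
move=> A /nbhs_ballP[e /= epos eA].
have /nbhs_ballP[r1 /= r10 r1I] : nbhs l0 (interior (effdom L)).
  by apply: open_nbhs_nbhs; split => //; exact: open_interior.
have C1 : 0 < `|C| + 1 by rewrite ltr_wpDl.
have [q [q0 qr qr1 qe]] := exists_pos_lt3 r0 r10 (divr_gt0 epos C1).
apply/nbhs_ballP; exists q => //= l; rewrite -ball_normE/= distrC => lq.
apply: eA; rewrite -ball_normE/= distrC.
have Il : interior (effdom L) l.
  by apply: r1I; rewrite -ball_normE/= distrC; exact: lt_trans qr1.
have [h _] := H l (lt_trans lq qr) Il.
apply: le_lt_trans h _; apply: (@le_lt_trans _ _ ((`|C| + 1) * q)).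
  apply: (@le_trans _ _ ((`|C| + 1) * `|l - l0|)).
    by rewrite ler_wpM2r// (le_trans (ler_norm C))// lerDl ler01.
  by rewrite ler_pM2l// ltW.
by rewrite mulrC -ltr_pdivlMr.
Qed.

Lemma weightedZ k W t v l : bounded_weight W -> interior (effdom L) l ->
  weighted k (fun s => W s * (c * dot (t *: v) (G s))) l =
  t * weighted k (fun s => W s * (c * dot v (G s))) l.
Proof.
move=> bW Il; have := integrable_weighted k (bounded_weightM v bW) Il => iv.
rewrite /weighted -RintegralZl//; apply: eq_Rintegral => s _.
by rewrite dotZl; ring.
Qed.

Lemma is_derive_weighted k W l v : bounded_weight W -> interior (effdom L) l ->
  is_derive l v (weighted k W)
    (weighted k.+1 (fun s => W s * (c * dot v (G s))) l).
Proof.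
move=> bW Il; have [C [r [r0 H]]] := weighted_estimates k bW Il.
have /nbhs_ballP[r1 /= r10 r1I] : nbhs l (interior (effdom L)).
  by apply: open_nbhs_nbhs; split => //; exact: open_interior.
have v1 : 0 < `|v| + 1 by rewrite ltr_wpDl.
have [q [q0 qr qr1 _]] := exists_pos_lt3 (divr_gt0 r0 v1) (divr_gt0 r10 v1) ltr01.
apply: (@is_derive_quadratic _ _ _ _ _ _ (C * `|v| ^+ 2) _ q0) => t tq.
have tv : `|t *: v| <= q * (`|v| + 1).
  by rewrite normrZ; apply: ler_pM => //; [exact: ltW|rewrite lerDl].
have dl : l + t *: v - l = t *: v by rewrite addrC addrA addNr add0r.
have tr : `|l + t *: v - l| < r.
  by rewrite dl; apply: le_lt_trans tv _; rewrite -ltr_pdivlMr.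
have It : interior (effdom L) (l + t *: v).
  apply: r1I; rewrite -ball_normE/= distrC dl.
  by apply: le_lt_trans tv _; rewrite -ltr_pdivlMr.
have [_] := H _ tr It; rewrite dl weightedZ// normrZ => h.
by apply: le_trans h _; rewrite exprMn real_normK ?num_real// (mulrC (t ^+ 2)) mulrA.
Qed.

Lemma bounded_weight1 : bounded_weight (cst 1).
Proof. by split => //; exists 1 => s _; rewrite normr1. Qed.

Lemma fine_integrated_log_mgf l : interior (effdom L) l ->
  fine (L l) = weighted 0 (cst 1) l.
Proof.
move=> Il; have [S [r [a [b [mS S0 r0 Db Hab]]]]] := good_set Il.
rewrite /weighted /Rintegral; congr fine; apply: ae_eq_integral => //.
- exact: measurable_log_mgf_dotG.
- by apply/measurable_EFinP; apply: measurable_weighted; exact: bounded_weight1.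
exists (unit_itv `\` S); split => //; first exact: measurableD.
move=> s /= /not_implyP[Is ne]; split => // Ss; apply: ne.
have /andP[_ xb] : a <= c * dot l (G s) <= b by apply: Hab => //; rewrite subrr normr0.
have Dx := mgf_dom_le xb Db.
by rewrite mulr1 dlog_mgfE// derive1n0/= log_mgf_fin_dom.
Qed.

Lemma is_derive_integrated l v : interior (effdom L) l ->
  is_derive l v (fine \o L) (weighted 1 (fun s => 1 * (c * dot v (G s))) l).
Proof.
move=> Il; apply: near_eq_is_derive (is_derive_weighted 0 v bounded_weight1 Il).
have : nbhs l (interior (effdom L)).
  by apply: open_nbhs_nbhs; split => //; exact: open_interior.
by apply: filterS => m Im; rewrite /= fine_integrated_log_mgf.
Qed.

Lemma weightedD k W u v l : bounded_weight W -> interior (effdom L) l ->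
  weighted k (fun s => W s * (c * dot (u + v) (G s))) l =
  weighted k (fun s => W s * (c * dot u (G s))) l +
  weighted k (fun s => W s * (c * dot v (G s))) l.
Proof.
move=> bW Il; have iu := integrable_weighted k (bounded_weightM u bW) Il.
have iv := integrable_weighted k (bounded_weightM v bW) Il.
rewrite /weighted -RintegralD//; apply: eq_Rintegral => s _.
by rewrite dotDl; ring.
Qed.

Lemma integrated_derive_gradient l v : interior (effdom L) l ->
  is_derive l v (fine \o L) (dot (gradient (fine \o L) l) v).
Proof.
move=> Il; apply: (is_derive_eq (is_derive_integrated v Il)).
have bW := bounded_weight1.
rewrite [in LHS](row_sum_delta v) /dot.
transitivity (\sum_i v 0 i * weighted 1 (fun s => 1 * (c * dot (delta_mx 0 i) (G s))) l).
  apply: (big_ind2 (fun (u : 'rV[R]_n) (x : R) =>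
    weighted 1 (fun s => 1 * (c * dot u (G s))) l = x)).
  - by rewrite -(scale0r (0 : 'rV[R]_n)) (@weightedZ 1 (cst 1))// mul0r.
  - by move=> u x u' x' <- <-; rewrite (@weightedD 1 (cst 1)).
  - by move=> i _; rewrite (@weightedZ 1 (cst 1)).
apply: eq_bigr => i _; rewrite mulrC !mxE /partial_deriv; congr (_ * _).
by have /@derive_val -> := is_derive_integrated (delta_mx 0 i) Il.
Qed.

Definition weight_of (s : seq 'I_n) (t : R) : R := \prod_(i <- s) (c * G t 0 i).

Lemma bounded_weight_of s : bounded_weight (weight_of s).
Proof.
elim: s => [|i s IH].
  have -> : weight_of [::] = cst 1 by apply/funext => t; rewrite /weight_of big_nil.
  exact: bounded_weight1.
have -> : weight_of (i :: s) = fun t => weight_of s t * (c * dot (delta_mx 0 i) (G t)).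
  by apply/funext => t; rewrite /weight_of big_cons dot_delta mulrC.
exact: bounded_weightM.
Qed.

Lemma iter_partial_integrated s l : interior (effdom L) l ->
  iter_partial s (fine \o L) l = weighted (size s) (weight_of s) l.
Proof.
elim: s l => [|i s IH] l Il.
  rewrite /iter_partial/= fine_integrated_log_mgf//; apply: eq_Rintegral => t _.
  by rewrite /weight_of big_nil.
rewrite [LHS]/(partial_deriv i (iter_partial s (fine \o L)) l) /partial_deriv.
rewrite (@near_eq_derive _ _ _ _ (weighted (size s) (weight_of s))); last first.
  have : nbhs l (interior (effdom L)).
    by apply: open_nbhs_nbhs; split => //; exact: open_interior.
  by apply: filterS => m Im; rewrite IH.
have /@derive_val -> := is_derive_weighted (size s) (delta_mx 0 i) (bounded_weight_of s) Il.
apply: eq_Rintegral => t _; congr (_ * _).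
by rewrite /weight_of big_cons dot_delta mulrC.
Qed.

Lemma integrated_smooth : smooth_on (interior (effdom L)) (fine \o L).
Proof.
move=> s l Il.
have nI : nbhs l (interior (effdom L)).
  by apply: open_nbhs_nbhs; split => //; exact: open_interior.
have ne : \near l, weighted (size s) (weight_of s) l = iter_partial s (fine \o L) l.
  by apply: filterS nI => m Im; rewrite iter_partial_integrated.
split.
  have h := @continuous_weighted (size s) _ l (bounded_weight_of s) Il.
  rewrite /prop_for /continuous_at iter_partial_integrated//.
  move=> A /h; rewrite !nbhs_simpl/= => hA; apply: filterS2 ne hA => m /= E.
  by rewrite E.
move=> i; apply: near_eq_derivable ne _.
by case: (is_derive_weighted (size s) (delta_mx 0 i) (bounded_weight_of s) Il).
Qed.

End integrated_log_mgf_smooth.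

(** * The medium, the vector Z and the boundary value problem *)

Lemma integrable_cst_fin {R : realType} (D : set R) (r : R) : measurable D ->
  (@lebesgue_measure R D < +oo)%E ->
  (@lebesgue_measure R).-integrable D (EFin \o cst r).
Proof.
move=> mD Dy; apply/integrableP; split; first by apply/measurable_EFinP; exact: measurable_cst.
by rewrite (eq_integral (cst `|r|%:E))// integral_cst// lte_mul_pinfty.
Qed.

Section cells.
Context {R : realType}.
Local Notation mu := (@lebesgue_measure R).
Variable N : nat.
Local Notation n := N.+1.

(** Cells are numbered from 0 and the gammas from 1: at scale 1/n the medium on [cell k] is the
    inverse of gamma_(k+1). *)
Definition cell (k : nat) : set R := `[k%:R / n%:R, k.+1%:R / n%:R[.

Lemma cellP k s : cell k s <-> k%:R <= s * n%:R < k.+1%:R.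
Proof. by rewrite /cell/= in_itv/= ler_pdivrMr ?ltr0n// ltr_pdivlMr ?ltr0n. Qed.

Lemma measurable_cell k : measurable (cell k).
Proof. exact: measurable_itv. Qed.

Lemma cell_inj k j s : cell k s -> cell j s -> k = j.
Proof.
move=> /cellP/andP[ks sk] /cellP/andP[js sj]; apply/eqP; rewrite eqn_leq.
by apply/andP; split; rewrite -ltnS -(ltr_nat R); [exact: le_lt_trans ks sj|exact: le_lt_trans js sk].
Qed.

Lemma cell_unit k : (k < n)%N -> cell k `<=` unit_itv.
Proof.
move=> kn s /cellP/andP[ks sk]; rewrite /unit_itv/= in_itv/=.
have s0 : 0 <= s by rewrite -(pmulr_lge0 _ (ltr0Sn R N)) (le_trans _ ks).
rewrite s0 -(ler_pM2r (ltr0Sn R N)) mul1r; apply: le_trans (ltW sk) _.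
by rewrite ler_nat.
Qed.

Lemma cell_ex s : 0 <= s < 1 -> exists2 k, (k < n)%N & cell k s.
Proof.
move=> /andP[s0 s1]; have sn0 : 0 <= s * n%:R by rewrite mulr_ge0.
exists (Num.truncn (s * n%:R)); last by apply/cellP; rewrite truncn_itv.
have /andP[h _] := truncn_itv sn0.
rewrite -(ltr_nat R); apply: le_lt_trans h _.
by rewrite -[ltRHS]mul1r ltr_pM2r.
Qed.

Lemma lebesgue_measure_cell k : mu (cell k) = (n%:R^-1)%:E.
Proof.
have h : k%:R / n%:R < k.+1%:R / n%:R :> R by rewrite ltr_pM2r ?invr_gt0// ltr_nat.
rewrite /cell lebesgue_measure_itv/= lte_fin h; congr EFin.
by rewrite -mulrBl -natrB// subSnn mul1r.
Qed.

Lemma trivIset_cell (D : set nat) : trivIset D cell.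
Proof. by move=> i j _ _ [s [ci cj]]; exact: cell_inj ci cj. Qed.

Lemma bigcup_cell : \big[setU/set0]_(k <- iota 0 n) cell k = `[0, 1[%classic.
Proof.
rewrite -bigcup_seq; apply/seteqP; split => s.
  move=> [k kin]; have := kin : k \in iota 0 n; rewrite mem_iota add0n => /= kn /cellP/andP[ks sk].
  rewrite in_itv/= -(pmulr_lge0 _ (ltr0Sn R N)) (le_trans _ ks)//=.
  rewrite -(ltr_pM2r (ltr0Sn R N)) mul1r; apply: lt_le_trans sk _.
  by rewrite ler_nat.
rewrite /= in_itv/= => /cell_ex[k kn ck]; exists k => //.
by have : k \in iota 0 n by rewrite mem_iota.
Qed.

Lemma subset_ico01 : `[0, 1[ `<=` @unit_itv R.
Proof. by move=> s; rewrite /unit_itv/= !in_itv/= => /andP[-> /ltW]. Qed.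

Lemma ge0_integral_cells (h : R -> \bar R) : measurable_fun unit_itv h ->
  (forall s, unit_itv s -> (0 <= h s)%E) ->
  (\int[mu]_(s in unit_itv) h s = \sum_(k < n) \int[mu]_(s in cell k) h s)%E.
Proof.
move=> mh h0; rewrite /unit_itv -integral_itv_bndo_bndc; last first.
  by apply: measurable_funS mh => //; exact: subset_ico01.
rewrite -bigcup_cell ge0_integral_bigsetU//.
- by rewrite -(big_mkord xpredT (fun k => \int[mu]_(s in cell k) h s)%E) /index_iota subn0.
- exact: measurable_cell.
- exact: iota_uniq.
- exact: trivIset_cell.
- by rewrite bigcup_cell; apply: measurable_funS mh => //; exact: subset_ico01.
- by rewrite bigcup_cell => s /subset_ico01; exact: h0.
Qed.

Lemma integrable_cell (h : R -> R) k : mu.-integrable unit_itv (EFin \o h) ->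
  (k < n)%N -> mu.-integrable (cell k) (EFin \o h).
Proof.
move=> ih kn; apply: integrableS ih => //; first exact: measurable_cell.
exact: cell_unit.
Qed.

Lemma Rintegral_cells (h : R -> R) : mu.-integrable unit_itv (EFin \o h) ->
  \int[mu]_(s in unit_itv) h s = \sum_(k < n) \int[mu]_(s in cell k) h s.
Proof.
move=> ih; have mh : measurable_fun unit_itv (EFin \o h) by exact: measurable_int ih.
have mI : measurable_fun (`[0, 1[ : set R) (EFin \o h).
  by apply: measurable_funS mh => //; exact: subset_ico01.
rewrite /Rintegral /unit_itv -integral_itv_bndo_bndc//.
rewrite -bigcup_cell integral_bigsetU_EFin//.
- transitivity (fine (\sum_(k < n) \int[mu]_(s in cell k) (h s)%:E)%E).
    rewrite -(big_mkord xpredT (fun k => \int[mu]_(s in cell k) (h s)%:E)%E).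
    by rewrite /index_iota subn0.
  rewrite (eq_bigr (fun k : 'I_n => (fine (\int[mu]_(s in cell k) (h s)%:E))%:E)).
    by rewrite sumEFin.
  move=> k _; rewrite fineK//.
  have := @integrable_fin_num _ _ _ mu (cell k) (measurable_cell k) (EFin \o h).
  by apply; exact: integrable_cell.
- exact: measurable_cell.
- exact: iota_uniq.
- exact: trivIset_cell.
- by rewrite bigcup_cell.
Qed.

Lemma Rintegral_cell_cst (r : R) k : \int[mu]_(s in cell k) r = r / n%:R.
Proof.
rewrite Rintegral_cst; last exact: measurable_cell.
by congr (_ * _); have := lebesgue_measure_cell k => /= ->.
Qed.

Lemma cell_average_le (h1 h2 : R -> R) k :
  mu.-integrable (cell k) (EFin \o h1) -> mu.-integrable (cell k) (EFin \o h2) ->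
  (forall s, cell k s -> h1 s <= h2 s) ->
  \int[mu]_(s in cell k) h1 s <= \int[mu]_(s in cell k) h2 s.
Proof. by move=> i1 i2 h12; apply: le_Rintegral => //; exact: measurable_cell. Qed.

Lemma integrable_cell_cst (r : R) k : mu.-integrable (cell k) (EFin \o cst r).
Proof.
apply: integrable_cst_fin; first exact: measurable_cell.
by have /= -> := lebesgue_measure_cell k; rewrite ltry.
Qed.

Lemma cell_average_bound (h : R -> R) (a e : R) k :
  mu.-integrable (cell k) (EFin \o h) ->
  (forall s, cell k s -> `|h s - a| <= e) ->
  `|n%:R * \int[mu]_(s in cell k) h s - a| <= e.
Proof.
move=> ih he; have n0 : 0 < n%:R :> R by rewrite ltr0n.
have h1 : \int[mu]_(s in cell k) h s <= (a + e) / n%:R.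
  rewrite -(Rintegral_cell_cst (a + e) k); apply: cell_average_le => //.
    exact: integrable_cell_cst.
  by move=> s /he; rewrite ler_norml => /andP[_]; lra.
have h2 : (a - e) / n%:R <= \int[mu]_(s in cell k) h s.
  rewrite -(Rintegral_cell_cst (a - e) k); apply: cell_average_le => //.
    exact: integrable_cell_cst.
  by move=> s /he; rewrite ler_norml => /andP[]; lra.
move: h1 h2; rewrite ler_pdivlMr// ler_pdivrMr// mulrC ler_norml => h1 h2.
by apply/andP; split; lra.
Qed.

End cells.

(** * The function H: bounds, measurability, continuity away from x *)

Section profile.
Context {R : realType}.
Local Notation mu := (@lebesgue_measure R).
Variables (f : R -> R) (x : R).
Hypothesis f_meas : measurable_fun (`[0, 1] : set R) f.
Hypothesis f_L2 : mu.-integrable (`[0, 1] : set R) (fun t => (f t ^+ 2)%:E).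
Hypothesis x01 : 0 < x < 1.
Local Notation Hf := (H f x).

Lemma integrable_f : mu.-integrable unit_itv (EFin \o f).
Proof.
(* On a set of finite measure L^2 is contained in L^1, by |f| <= 1 + f^2. *)
have i1 : mu.-integrable unit_itv (fun t => (1 + f t ^+ 2)%:E).
  apply: (@eq_integrable _ _ _ mu unit_itv measurable01 (cst 1%E \+ (fun t => (f t ^+ 2)%:E))).
    by move=> t _; rewrite /= EFinD.
  apply: integrableD => //.
  apply: integrable_cst_fin => //; have := @lebesgue_measure01 R.
  by move=> /= ->; rewrite ltry.
apply: (@le_integrable _ _ _ mu unit_itv measurable01 _ _ _ _ i1).
  exact/measurable_EFinP.
move=> t _ /=; rewrite lee_fin [leRHS]ger0_norm ?addr_ge0 ?sqr_ge0//.
have : `|f t| ^+ 2 = f t ^+ 2 by rewrite real_normK ?num_real.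
by have : 0 <= `|f t| by []; move: `|f t| => y y0 <-; nra.
Qed.

Lemma antideriv_bound s : unit_itv s ->
  `|antideriv f s| <= \int[mu]_(t in unit_itv) `|f t|.
Proof.
rewrite /unit_itv/= in_itv/= => /andP[s0 s1].
have sub : `[0, s] `<=` @unit_itv R.
  by move=> t; rewrite /unit_itv/= !in_itv/= => /andP[-> ts]; exact: le_trans s1.
have is' : mu.-integrable `[0, s] (EFin \o f) by apply: integrableS integrable_f.
apply: le_trans (le_normr_Rintegral _ is') _ => //.
rewrite /Rintegral fine_le//.
- by apply: integrable_fin_num => //; exact: integrable_norm.
- by apply: integrable_fin_num => //; apply: integrable_norm integrable_f.
- apply: ge0_subset_integral => //.
  apply/measurable_EFinP; apply: measurableT_comp => //.
Qed.

Lemma antideriv_continuous s : 0 < s < 1 -> {for s, continuous (antideriv f)}.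
Proof.
move=> s01.
have /(continuous_within_itvP _ (@ltr01 R))[+ _ _] :=
  parameterized_integral_continuous (@ler01 R) integrable_f.
by apply; rewrite in_itv.
Qed.

(** The integral bounds the two coordinates containing F, and 1 bounds the other two. *)
Definition H_bound : R := 1 + \int[mu]_(t in unit_itv) `|f t|.

Lemma H0E s : Hf s 0 (inord 0) = antideriv f s * \1_(`]0, x[ : set R) s.
Proof. by rewrite mxE /= inordK. Qed.

Lemma H1E s : Hf s 0 (inord 1) = antideriv f s.
Proof. by rewrite mxE /= inordK. Qed.

Lemma H2E s : Hf s 0 (inord 2) = \1_(`]0, x[ : set R) s.
Proof. by rewrite mxE /= inordK. Qed.

Lemma H3E s : Hf s 0 (inord 3) = 1.
Proof. by rewrite mxE /= inordK. Qed.

Lemma ord4P (Q : 'I_4 -> Prop) : Q (inord 0) -> Q (inord 1) -> Q (inord 2) ->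
  Q (inord 3) -> forall i, Q i.
Proof.
move=> q0 q1 q2 q3 [[|[|[|[|//]]]] Hi].
- by rewrite (_ : Ordinal Hi = inord 0)//; apply/val_inj; rewrite /= inordK.
- by rewrite (_ : Ordinal Hi = inord 1)//; apply/val_inj; rewrite /= inordK.
- by rewrite (_ : Ordinal Hi = inord 2)//; apply/val_inj; rewrite /= inordK.
- by rewrite (_ : Ordinal Hi = inord 3)//; apply/val_inj; rewrite /= inordK.
Qed.

Lemma indic_le1 (A : set R) s : 0 <= (\1_A s : R) <= 1.
Proof. by rewrite indicE; case: (s \in A); rewrite /= ?lexx ?ler01. Qed.

Lemma H_boundP s : unit_itv s -> forall i, `|Hf s 0 i| <= H_bound.
Proof.
move=> Is; have F0 := antideriv_bound Is; have F1 := normr_ge0 (antideriv f s).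
have /andP[i0 i1] := indic_le1 `]0, x[ s.
apply: ord4P; rewrite ?H0E ?H1E ?H2E ?H3E /H_bound.
- rewrite normrM (ger0_norm i0); apply: (@le_trans _ _ `|antideriv f s|).
    by rewrite ler_piMr.
  lra.
- lra.
- rewrite ger0_norm//; lra.
- rewrite normr1; lra.
Qed.

Lemma measurable_antideriv : measurable_fun unit_itv (antideriv f).
Proof.
have c := parameterized_integral_continuous (@ler01 R) integrable_f.
exact: (subspace_continuous_measurable_fun _ c).
Qed.

Lemma measurable_H i : measurable_fun unit_itv (fun s => Hf s 0 i).
Proof.
have mF := measurable_antideriv.
have mi : measurable_fun unit_itv (\1_(`]0, x[ : set R) : R -> R).
  exact: measurable_indic.
move: i; apply: ord4P.
- by under eq_fun do rewrite H0E; exact: measurable_funM.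
- by under eq_fun do rewrite H1E.
- by under eq_fun do rewrite H2E.
- by under eq_fun do rewrite H3E; exact: measurable_cst.
Qed.

Lemma integrable_H_mul i (r : R) (D : set R) : measurable D -> D `<=` unit_itv ->
  mu.-integrable D (EFin \o (fun s => Hf s 0 i * r)).
Proof.
move=> mD sD; apply: (@integrableS _ _ _ mu unit_itv) => //.
have [] // := @Rintegral_bounded R (fun s => Hf s 0 i * r) (H_bound * `|r|) unit_itv.
- by apply: measurable_funM => //; exact: measurable_H.
- by rewrite setDv measure0.
- by move=> s Is _; rewrite normrM ler_wpM2r// H_boundP.
Qed.

Lemma indic_continuous s : s != 0 -> s != x ->
  {for s, continuous (\1_(`]0, x[ : set R) : R -> R)}.
Proof.
move=> s0 sx.
have [sin|sout] := boolP (0 < s < x).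
  have /cvg_trans : \1_(`]0, x[ : set R) y @[y --> s] --> (1 : R).
    apply: cvg_near_cst.
    have : \forall y \near s, `]0, x[%classic y.
      by apply: near_in_itvoo; rewrite in_itv.
    by apply: filterS => y Iy; rewrite indicE mem_set.
  move=> h; have E : \1_(`]0, x[ : set R) s = (1 : R) by rewrite indicE mem_set//= in_itv.
  by rewrite /prop_for /continuous_at E; exact: h.
have E : \1_(`]0, x[ : set R) s = (0 : R).
  by rewrite indicE memNset//= in_itv/=; exact/negP.
rewrite /prop_for /continuous_at E; apply: cvg_near_cst.
have [sl|sl] := ltP s 0.
  apply: filterS (lt_nbhsl sl) => y y0; rewrite indicE memNset//= in_itv/=.
  by move=> /andP[/lt_trans/(_ y0)]; rewrite ltxx.
have s0' : 0 < s by rewrite lt_def s0.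
have xs : x < s by rewrite lt_def sx /= leNgt; move: sout; rewrite s0'.
apply: filterS (lt_nbhsr xs) => y y0; rewrite indicE memNset//= in_itv/=.
by move=> /andP[_ /lt_trans/(_ y0)]; rewrite ltxx.
Qed.

Lemma dotH_continuous (l : 'rV[R]_4) s : 0 < s < 1 -> s != x ->
  {for s, continuous (fun s => dot l (Hf s))}.
Proof.
move=> s01 sx; have s0 : s != 0 by rewrite gt_eqF//; have /andP[] := s01.
have cF := antideriv_continuous s01; have ci := indic_continuous s0 sx.
apply: (@cvg_big _ _ +%R 0 xpredT add_continuous _ (nbhs s)) => i _.
apply: (@cvgM _ _ (nbhs s) _ (cst (l 0 i)) (fun s => Hf s 0 i)); first exact: cvg_cst.
move: i; apply: ord4P.
- under eq_fun do rewrite H0E; rewrite H0E.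
  exact: (@cvgM _ _ (nbhs s) _ (antideriv f)).
- by under eq_fun do rewrite H1E; rewrite H1E.
- by under eq_fun do rewrite H2E; rewrite H2E.
- by under eq_fun do rewrite H3E; rewrite H3E; exact: cvg_cst.
Qed.

Lemma dot_H3 s : dot (delta_mx 0 (inord 3)) (Hf s) = 1.
Proof. by rewrite dot_delta H3E. Qed.

End profile.

(** * Sums over the integers as limits over symmetric windows *)

Section windows.
Context {R : realType}.
Implicit Types (a : int -> \bar R).
Local Open Scope ereal_scope.

(** The integers from -M to M as a duplicate-free list, the form in which independence is stated. *)
Definition window (M : nat) : seq int := [seq (i%:Z - M%:Z)%R | i <- iota 0 (M.*2).+1].

Lemma mem_window M m : (m \in window M) = (`|m|%N <= M)%N.
Proof.
apply/mapP/idP => [[i]|mM].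
  by rewrite mem_iota => /andP[_ iM] ->; rewrite -muln2 in iM; lia.
exists `|(m + M%:Z)%R|%N; last by lia.
by rewrite mem_iota -muln2; lia.
Qed.

Lemma uniq_window M : uniq (window M).
Proof. by rewrite map_inj_uniq ?iota_uniq// => i j; lia. Qed.

Lemma window_cover (s : seq int) : exists M, {subset s <= window M}.
Proof.
elim: s => [|m s [M HM]]; first by exists 0%N.
exists (maxn `|m|%N M) => k; rewrite inE mem_window => /orP[/eqP ->|/HM].
  exact: leq_maxl.
by rewrite mem_window => /leq_trans; apply; exact: leq_maxr.
Qed.

Lemma subset_window M M' : (M <= M')%N -> {subset window M <= window M'}.
Proof. by move=> MM' m; rewrite !mem_window => /leq_trans; exact. Qed.

Lemma le_sum_subset a (s1 s2 : seq int) : uniq s1 -> uniq s2 ->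
  {subset s1 <= s2} -> (forall m, 0 <= a m) ->
  \sum_(m <- s1) a m <= \sum_(m <- s2) a m.
Proof.
move=> u1 u2 s12 a0; rewrite [leRHS](bigID (mem s1))/=.
have -> : \sum_(m <- s2 | m \in s1) a m = \sum_(m <- s1) a m.
  rewrite -big_filter; apply: perm_big; apply: uniq_perm => //.
    exact: filter_uniq.
  by move=> m; rewrite mem_filter; case: (boolP (m \in s1)) => //= /s12.
by rewrite leeDl// sume_ge0.
Qed.

Lemma window_sum_le a M : (forall m, 0 <= a m) ->
  \sum_(m <- window M) a m <= \esum_(m in [set: int]) a m.
Proof.
move=> a0; apply: esum_ge; exists [set` window M].
  by split => //; exact: finite_seq.
by rewrite fsbig_seq//; exact: uniq_window.
Qed.

Lemma cvg_window a : (forall m, 0 <= a m) ->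
  \sum_(m <- window M) a m @[M --> \oo] --> \esum_(m in [set: int]) a m.
Proof.
move=> a0.
have nd : nondecreasing_seq (fun M => \sum_(m <- window M) a m).
  by move=> M M' MM'; apply: le_sum_subset => //; rewrite ?uniq_window//; exact: subset_window.
have -> : \esum_(m in [set: int]) a m = ereal_sup (range (fun M => \sum_(m <- window M) a m)).
  apply/eqP; rewrite eq_le; apply/andP; split; last first.
    by apply: ge_ereal_sup => _ [M _ <-]; exact: window_sum_le.
  apply: ge_ereal_sup => _ [A [fA _] <-].
  have /finite_seqP[s As] := fA.
  have [M HM] := window_cover (undup s).
  apply: le_trans (ereal_sup_ubound _); last by exists M.
  rewrite As; have -> : [set` s] = [set` undup s].
    by apply/seteqP; split => m /=; rewrite mem_undup.
  rewrite -fsbig_seq ?undup_uniq//.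
  by apply: le_sum_subset => //; rewrite ?undup_uniq ?uniq_window.
exact: ereal_nondecreasing_cvgn.
Qed.

Lemma esum_reflect a (k : int) : (forall m, 0 <= a m) ->
  \esum_(m in [set: int]) a (k - m)%R = \esum_(m in [set: int]) a m.
Proof.
move=> a0; rewrite -(reindex_esum [set: int] [set: int] (fun m => k - m)%R a)//.
split => //= [m m' _ _|m _]; first by lia.
by exists (k - m)%R => //=; lia.
Qed.

Lemma cvg_window_fin (b : int -> R) : (forall m, 0 <= b m)%R ->
  \esum_(m in [set: int]) (b m)%:E < +oo ->
  (\sum_(m <- window M) b m)%R @[M --> \oo] --> fine (\esum_(m in [set: int]) (b m)%:E).
Proof.
move=> b0 by'; have b0' m : 0 <= (b m)%:E by rewrite lee_fin.
have h : (\sum_(m <- window M) b m)%:E @[M --> \oo] -->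
    (fine (\esum_(m in [set: int]) (b m)%:E))%:E.
  rewrite fineK ?ge0_fin_numE ?esum_ge0//.
  by have := cvg_window b0'; under eq_cvg do rewrite sumEFin.
exact: (fine_cvg h).
Qed.

Lemma window_sum_le_fin (b : int -> R) M : (forall m, 0 <= b m)%R ->
  \esum_(m in [set: int]) (b m)%:E < +oo ->
  (\sum_(m <- window M) b m <= fine (\esum_(m in [set: int]) (b m)%:E))%R.
Proof.
move=> b0 by'; rewrite -lee_fin fineK ?ge0_fin_numE ?esum_ge0//; last first.
  by move=> m _; rewrite lee_fin.
by rewrite -sumEFin; apply: window_sum_le => m; rewrite lee_fin.
Qed.

Lemma esum_lty_bounded (b : int -> R) (C : R) : (forall m, 0 <= b m)%R ->
  (forall M, \sum_(m <- window M) b m <= C)%R ->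
  \esum_(m in [set: int]) (b m)%:E < +oo.
Proof.
move=> b0 bC; apply: (@le_lt_trans _ _ C%:E); last exact: ltry.
have b0' m : 0 <= (b m)%:E by rewrite lee_fin.
apply: (cvge_le _ (cvg_window b0')); exists 0%N => // M _ /=.
by rewrite sumEFin lee_fin.
Qed.

End windows.

(** An open set is the union of the countably many rational boxes inside it, and a box is a finite
    intersection of conditions on coordinates. *)
Lemma borel_measurable_rV {R : realType} {n : nat} d (T : measurableType d)
    (Y : T -> 'rV[R]_n) :
  (forall i, measurable_fun setT (fun w => Y w 0 i)) -> borel_measurable Y.
Proof.
move=> mY U oU.
pose box (p : 'rV[rat]_n * rat) : set 'rV[R]_n :=
  [set z : 'rV[R]_n | forall i, `|z 0 i - ratr (p.1 0 i)| <= ratr p.2].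
pose A (p : 'rV[rat]_n * rat) : set T := [set w | box p `<=` U /\ box p (Y w)].
have -> : Y @^-1` U = \bigcup_p A p.
  apply/seteqP; split => [w /= Uw|w [p _ [pU pw]]]; last exact: pU.
  have : nbhs (Y w) U by apply: open_nbhs_nbhs.
  move=> /nbhs_ballP[e /= e0 eU].
  have [q] := rat_in_itvoo (divr_gt0 e0 (@ltr0Sn R 2)); rewrite in_itv/= => /andP[q0 qe].
  have ex i : exists r : rat, `|Y w 0 i - ratr r| <= ratr q :> R.
    have lt : Y w 0 i - ratr q < Y w 0 i + ratr q by lra.
    have [r] := rat_in_itvoo lt; rewrite in_itv/= => /andP[r1 r2]; exists r.
    by rewrite ler_norml; apply/andP; split; lra.
  have [r Hr] := choice ex.
  have bw : box (\row_i r i, q) (Y w) by move=> i; rewrite mxE.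
  exists (\row_i r i, q) => //; split => // z bz; apply: eU; rewrite -ball_normE/=.
  apply: (@le_lt_trans _ _ (ratr q + ratr q)); last by lra.
  apply: norm_le_coord => [|i]; first by lra.
  rewrite !mxE; have := bz i; have := bw i => /=; rewrite !mxE !ler_norml.
  by move=> /andP[? ?] /andP[? ?]; apply/andP; split; lra.
apply: countable_bigcupT_measurable; first exact: countableP.
move=> p; have [pU|npU] := pselect (box p `<=` U); last first.
  by have -> : A p = set0 by apply/seteqP; split => // w [].
have -> : A p = \bigcap_(i in [set: 'I_n])
    (fun w => Y w 0 i - ratr (p.1 0 i)) @^-1` `[- ratr p.2, ratr p.2].
  apply/seteqP; split => w /=.
    by move=> [_ h] i _; have := h i; rewrite /= in_itv/= ler_norml.
  by move=> h; split => // i; have := h i I; rewrite /= in_itv/= ler_norml.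
apply: fin_bigcap_measurable; first exact: finite_finset.
move=> i _; rewrite -[X in measurable X]setTI.
by apply: (measurable_funB (mY i)) => //; exact: measurable_cst.
Qed.

Lemma integrable_scale {R : realType} (D : set R) (c : R) (F : R -> R) :
  measurable D -> (@lebesgue_measure R).-integrable D (EFin \o F) ->
  (@lebesgue_measure R).-integrable D (EFin \o (fun t => c * F t)).
Proof. by move=> mD iF; have := @integrableZl _ _ _ (@lebesgue_measure R) D mD c _ iF. Qed.

Lemma Rintegral_lincomb {R : realType} {I : Type} (s : seq I) (D : set R)
    (c : I -> R) (G : I -> R -> R) : measurable D ->
  (forall i, (@lebesgue_measure R).-integrable D (EFin \o G i)) ->
  (@lebesgue_measure R).-integrable D (EFin \o (fun t => \sum_(i <- s) c i * G i t)) /\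
  \int[@lebesgue_measure R]_(t in D) (\sum_(i <- s) c i * G i t) =
  \sum_(i <- s) c i * \int[@lebesgue_measure R]_(t in D) G i t.
Proof.
move=> mD iG; elim: s => [|i s [IH1 IH2]].
  under eq_fun do rewrite big_nil.
  rewrite big_nil Rintegral_cst// mul0r; split => //; exact: integrable0.
under eq_fun do rewrite big_cons.
have iZ : (@lebesgue_measure R).-integrable D (EFin \o (fun t => c i * G i t)).
  exact: integrable_scale.
split.
  apply: (@eq_integrable _ _ _ (@lebesgue_measure R) D mD
    ((fun t => (c i * G i t)%:E) \+ (fun t => (\sum_(i <- s) c i * G i t)%:E))%E).
    by move=> t _; rewrite /= EFinD.
  exact: (@integrableD _ _ _ (@lebesgue_measure R) D mD _ _ iZ IH1).
by rewrite big_cons RintegralD// IH2 RintegralZl.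
Qed.

(** * The medium at a fixed scale *)

Section medium_theory.
Context {R : realType} {d} {T : measurableType d} (P : probability T R).
Local Notation mu := (@lebesgue_measure R).
Variables (h : int -> R) (X : int -> {RV P >-> R}).
Hypothesis h_ge0 : forall k, 0 <= h k.
Hypothesis X_ge0 : forall m w, 0 <= X m w.
Local Notation gam k w := (fine (gamma h X k w)).

Lemma gamma_term_ge0 k w m : (0 <= (h (k - m) * X m w)%:E)%E.
Proof. by rewrite lee_fin mulr_ge0. Qed.

Lemma gamma_ge0 k w : (0 <= gamma h X k w)%E.
Proof. by apply: esum_ge0 => m _; exact: gamma_term_ge0. Qed.

Lemma gam_ge0 k w : 0 <= gam k w.
Proof. by rewrite fine_ge0// gamma_ge0. Qed.

Lemma measurable_gamma k : measurable_fun setT (gamma h X k).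
Proof.
apply: (@emeasurable_fun_cvg _ _ _ _ (fun M w =>
    \sum_(m <- window M) (h (k - m) * X m w)%:E)%E).
  move=> M; apply: emeasurable_sum => m; apply/measurable_EFinP.
  by apply: measurable_funM.
move=> w _; apply: cvg_window => m; exact: gamma_term_ge0.
Qed.

Lemma measurable_gam k : measurable_fun setT (fun w => gam k w).
Proof. by apply: measurableT_comp => //; exact: measurable_gamma. Qed.

Lemma cvg_gam k w : (gamma h X k w < +oo)%E ->
  (\sum_(m <- window M) h (k - m) * X m w) @[M --> \oo] --> gam k w.
Proof. by move=> gy; apply: cvg_window_fin => // m; rewrite mulr_ge0. Qed.

(** Only the term of index k + 1 is nonzero at s, so the partial sums are constant once that index
    is included. *)
Lemma inv_medium_cell w (s : R) (k : nat) : k%:R <= s < k.+1%:R ->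
  inv_medium h X w s = gamma h X k.+1%:Z w.
Proof.
move=> /andP[ks sk]; apply: lim_near_cst => //.
exists k.+2 => // m /= km.
rewrite (bigD1_seq k.+1) ?iota_uniq//=; last by rewrite mem_index_iota /= km.
rewrite indicE mem_set ?mul1e/=; last by rewrite in_itv/= ks sk.
rewrite big1 ?adde0// => j jk; rewrite indicE memNset ?mul0e//= in_itv/=.
move=> /andP[js sj]; have kj := le_lt_trans ks sj; have jk' := le_lt_trans js sk.
by move: kj jk'; rewrite !ltr_nat; move: jk; lia.
Qed.

Section fixed_scale.
Variable N : nat.
Local Notation n := N.+1.
Local Notation a_ := (medium_eps h X (scale N)).

Lemma medium_eps_cell w k s : cell N k s -> a_ w s = (gam k.+1%:Z w)^-1.
Proof.
move=> /cellP ks; rewrite /medium_eps /medium /scale invrK.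
by rewrite (@inv_medium_cell _ _ k).
Qed.

Lemma gam_pos : {ae P, forall w, exists nu1 nu2 : R, 0 < nu1 /\
    forall s, 0 < s < 1 -> nu1 <= a_ w s <= nu2} ->
  {ae P, forall w, forall k, (k < n)%N -> 0 < gam k.+1%:Z w}.
Proof.
apply: filterS => w [nu1 [nu2 [nu0 H]]] k kn.
(* The midpoint of the cell: the bounds hold on the open interval only, which excludes the left end
   of the first cell. *)
pose s : R := (k%:R + 2^-1) / n%:R.
have n0 : 0 < n%:R :> R by rewrite ltr0n.
have k0 : 0 <= k%:R :> R by [].
have cs : cell N k s.
  by apply/cellP; rewrite /s divfK ?gt_eqF// -[k.+1%:R]natr1; apply/andP; split; lra.
have s01 : 0 < s < 1.
  have s0 : 0 < s by rewrite /s divr_gt0//; lra.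
  rewrite s0 /s ltr_pdivrMr// mul1r.
  apply: (@lt_le_trans _ _ k.+1%:R); last by rewrite ler_nat.
  by rewrite -[k.+1%:R]natr1; lra.
have /andP[] := H s s01; rewrite (medium_eps_cell _ cs) => /(lt_le_trans nu0).
by rewrite invr_gt0.
Qed.

Lemma gam_pos_lty k w : 0 < gam k w -> (gamma h X k w < +oo)%E.
Proof. by case: (gamma h _ k w) => [r| |] /=; rewrite ?ltry ?ltNyr ?ltxx. Qed.

Lemma medium_integral w (G : R -> R) (C : R) : measurable_fun unit_itv G ->
  (forall s, unit_itv s -> `|G s| <= C) ->
  mu.-integrable unit_itv (EFin \o (fun s => G s / a_ w s)) /\
  \int[mu]_(s in unit_itv) (G s / a_ w s) =
  \sum_(k < n) gam k.+1%:Z w * \int[mu]_(s in cell N k) G s.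
Proof.
move=> mG GC.
(* Equal to 1 / a on [0, 1[. At s = 1 the medium already belongs to the next cell, which is why
   equality is claimed only almost everywhere. *)
pose q (s : R) : R := \sum_(k < n) gam k.+1%:Z w * (\1_(cell N k) s : R).
have qE k s : (k < n)%N -> cell N k s -> q s = gam k.+1%:Z w.
  move=> kn cs; rewrite /q (bigD1 (Ordinal kn))//= indicE mem_set// mulr1.
  rewrite big1 ?addr0// => j jk; rewrite indicE memNset ?mulr0// => cj.
  by move/eqP: jk; apply; apply/val_inj; exact: cell_inj cj cs.
have mq : measurable_fun unit_itv q.
  apply: measurable_sum => k; apply: measurable_funM => //.
  by apply: measurable_indic; exact: measurable_cell.
have C0 : 0 <= C.
  have I0 : unit_itv (0 : R) by rewrite /unit_itv/= in_itv/= lexx ler01.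
  exact: le_trans (GC _ I0).
have sg0 : 0 <= \sum_(k < n) gam k.+1%:Z w by apply: sumr_ge0 => k _; exact: gam_ge0.
have qb s : `|q s| <= \sum_(k < n) gam k.+1%:Z w.
  rewrite ger0_norm; last first.
    by apply: sumr_ge0 => k _; rewrite mulr_ge0 ?gam_ge0// indicE; case: (_ \in _).
  by apply: ler_sum => k _; rewrite ler_piMr ?gam_ge0// indicE; case: (_ \in _).
have mGq : measurable_fun unit_itv (fun s => G s * q s) by exact: measurable_funM.
have iGq : mu.-integrable unit_itv (EFin \o (fun s => G s * q s)).
  have [] // := @Rintegral_bounded R (fun s => G s * q s) (C * \sum_(k < n) gam k.+1%:Z w) unit_itv.
  - by rewrite setDv measure0.
  - by move=> s Is _; rewrite normrM; apply: ler_pM => //; exact: GC.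
have E s : `[0, 1[%classic s -> G s * q s = G s / a_ w s.
  rewrite /= in_itv/= => /(cell_ex N)[k kn ck].
  by rewrite (qE k)// (medium_eps_cell w ck) invrK.
have mGa : measurable_fun (`[0, 1[ : set R) (fun s => G s / a_ w s).
  apply: (eq_measurable_fun (fun s => G s * q s)).
    by move=> s; rewrite inE; exact: E.
  by apply: measurable_funS mGq => //; exact: subset_ico01.
have mGa1 : measurable_fun unit_itv (fun s => G s / a_ w s).
  have -> : @unit_itv R = `[0, 1[ `|` [set 1].
    by rewrite /unit_itv setUitv1// bnd_simp.
  by apply/measurable_funU => //; split => //; exact: measurable_fun_set1.
have aeE : ae_eq mu unit_itv (EFin \o (fun s => G s / a_ w s)) (EFin \o (fun s => G s * q s)).
  exists [set 1]; split => //; first exact: lebesgue_measure_set1.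
  move=> s /= /not_implyP[Is ne]; apply: contrapT => s1; apply: ne; congr EFin.
  apply/esym/E; rewrite /= in_itv/=; move: Is; rewrite /unit_itv/= in_itv/=.
  by move=> /andP[-> sl]; rewrite lt_neqAle sl andbT; apply/eqP.
split.
  have [] // := @Rintegral_bounded R (fun s => G s / a_ w s) (C * \sum_(k < n) gam k.+1%:Z w) `[0, 1[.
    apply: (subset_measure0 _ _ _ (lebesgue_measure_set1 (1 : R))) => //.
      exact: measurableD.
    move=> s []; rewrite /unit_itv/= !in_itv/= => /andP[-> s1] /negP; rewrite -leNgt => s1'.
    by apply/eqP; rewrite eq_le s1 s1'.
  by move=> s Is s01; rewrite -(E _ s01) normrM; apply: ler_pM => //; exact: GC.
transitivity (\int[mu]_(s in unit_itv) (G s * q s)).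
  rewrite /Rintegral; congr fine; apply: ae_eq_integral => //; exact/measurable_EFinP.
rewrite (Rintegral_cells N iGq); apply: eq_bigr => k _.
transitivity (\int[mu]_(s in cell N k) (gam k.+1%:Z w * G s)).
  by apply: eq_Rintegral => s; rewrite inE => cs; rewrite (qE k)// mulrC.
rewrite RintegralZl//; first exact: measurable_cell.
apply: integrable_cell => //.
have [] // := @Rintegral_bounded R G C unit_itv.
- by rewrite setDv measure0.
- by move=> s Is _; exact: GC.
Qed.

Variables (f : R -> R) (x : R).
Hypothesis f_meas : measurable_fun (`[0, 1] : set R) f.
Hypothesis f_L2 : mu.-integrable (`[0, 1] : set R) (fun t => (f t ^+ 2)%:E).
Hypothesis x01 : 0 < x < 1.
Local Notation Hf := (H f x).
Local Notation Zf := (Z h X f x (scale N)).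

Lemma Z_coord w i :
  Zf w 0 i = \sum_(k < n) gam k.+1%:Z w * \int[mu]_(s in cell N k) Hf s 0 i.
Proof.
rewrite mxE; have mH := @measurable_H R f x f_meas f_L2 i.
by have [_ <-] := medium_integral w mH (fun s Is => H_boundP x f_meas f_L2 Is i).
Qed.

Lemma integrable_H_cell i k : (k < n)%N ->
  mu.-integrable (cell N k) (EFin \o (fun s => Hf s 0 i)).
Proof.
move=> kn; have := @integrable_H_mul R f x f_meas f_L2 i 1 (cell N k) (measurable_cell N k) (cell_unit kn).
by under eq_fun do rewrite mulr1.
Qed.

Lemma Rintegral_dotH (l : 'rV[R]_4) k : (k < n)%N ->
  mu.-integrable (cell N k) (EFin \o (fun s => dot l (Hf s))) /\
  \int[mu]_(s in cell N k) dot l (Hf s) =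
  \sum_i l 0 i * \int[mu]_(s in cell N k) Hf s 0 i.
Proof.
move=> kn; apply: Rintegral_lincomb => [|i]; first exact: measurable_cell.
exact: integrable_H_cell.
Qed.

Definition cell_mean (l : 'rV[R]_4) (k : nat) : R :=
  n%:R * \int[mu]_(s in cell N k) dot l (Hf s).

Lemma dot_Z l w : (scale N)^-1 * dot l (Zf w) = \sum_(k < n) gam k.+1%:Z w * cell_mean l k.
Proof.
rewrite /scale invrK /dot.
under eq_bigr do rewrite Z_coord mulr_sumr.
rewrite exchange_big/= mulr_sumr; apply: eq_bigr => k _.
rewrite /cell_mean (Rintegral_dotH l (ltn_ord k)).2 mulrCA; congr (_ * _).
by rewrite mulr_sumr; apply: eq_bigr => i _; rewrite mulrCA.
Qed.

Lemma measurable_Z i : measurable_fun setT (fun w => Zf w 0 i).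
Proof.
under eq_fun do rewrite Z_coord.
by apply: measurable_sum => k; apply: measurable_funM => //; exact: measurable_gam.
Qed.

Lemma borel_measurable_Z : borel_measurable Zf.
Proof. by apply: borel_measurable_rV => i; exact: measurable_Z. Qed.

Lemma Z3E w : Zf w 0 (inord 3) = \sum_(k < n) gam k.+1%:Z w / n%:R.
Proof.
rewrite Z_coord; apply: eq_bigr => k _; congr (_ * _).
under eq_Rintegral do rewrite H3E.
by rewrite Rintegral_cell_cst mul1r.
Qed.

(** Since the gammas are nonnegative, pointwise inequalities between coordinates of H pass to Z; the
    inequalities of the cone are all obtained this way. *)
Lemma Z_sub_le (i j : 'I_4) (c1 c2 : R) w :
  (forall s, unit_itv s -> c1 * Hf s 0 i <= c2 * Hf s 0 j) ->
  c1 * Zf w 0 i <= c2 * Zf w 0 j.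
Proof.
move=> Hij; rewrite !Z_coord !mulr_sumr; apply: ler_sum => k _.
rewrite mulrCA [leRHS]mulrCA ler_wpM2l ?gam_ge0//.
have iH q := integrable_H_cell q (ltn_ord k).
rewrite -!RintegralZl//; try exact: measurable_cell.
apply: le_Rintegral; first exact: measurable_cell.
- by apply: integrable_scale => //; exact: measurable_cell.
- by apply: integrable_scale => //; exact: measurable_cell.
- by move=> s /(cell_unit (ltn_ord k)); exact: Hij.
Qed.

Lemma Z_limit_cone w : limit_cone (H_bound f) (Zf w).
Proof.
have F0 s : unit_itv s -> `|antideriv f s| <= H_bound f.
  by move=> /(antideriv_bound f_meas f_L2); rewrite /H_bound; lra.
have i01 s := indic_le1 (`]0, x[ : set R) s.
split.
- have h1 : 1 * Zf w 0 (inord 0) <= H_bound f * Zf w 0 (inord 2).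
    apply: Z_sub_le => s /F0; rewrite H0E H2E mul1r ler_norml => /andP[_ Fs].
    by rewrite ler_wpM2r//; have /andP[] := i01 s.
  have h2 : -1 * Zf w 0 (inord 0) <= H_bound f * Zf w 0 (inord 2).
    apply: Z_sub_le => s /F0; rewrite H0E H2E mulN1r -mulNr ler_norml => /andP[Fs _].
    by rewrite ler_wpM2r//; lra.
  by rewrite ler_norml; apply/andP; split; lra.
- have h1 : 1 * Zf w 0 (inord 1) <= H_bound f * Zf w 0 (inord 3).
    apply: Z_sub_le => s /F0; rewrite H1E H3E mul1r mulr1 ler_norml => /andP[_ //].
  have h2 : -1 * Zf w 0 (inord 1) <= H_bound f * Zf w 0 (inord 3).
    apply: Z_sub_le => s /F0; rewrite H1E H3E mulN1r mulr1 ler_norml => /andP[Fs _].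
    by lra.
  by rewrite ler_norml; apply/andP; split; lra.
- have : 0 * Zf w 0 (inord 2) <= 1 * Zf w 0 (inord 2).
    by apply: Z_sub_le => s _; rewrite mul0r mul1r H2E; have /andP[] := i01 s.
  by rewrite mul0r mul1r.
- have : 1 * Zf w 0 (inord 2) <= 1 * Zf w 0 (inord 3).
    by apply: Z_sub_le => s _; rewrite !mul1r H2E H3E; have /andP[] := i01 s.
  by rewrite !mul1r.
Qed.

(** From a v = q(0) - F one gets u(y) as q(0) times the integral of 1/a minus that of F/a over
    [0, y]. The condition u(1) = 0 then reads q(0) = Z_2 / Z_4, where Z_4 > 0. *)
Lemma solves_bvp_g w (u : R -> R) : (forall k, (k < n)%N -> 0 < gam k.+1%:Z w) ->
  solves_bvp (a_ w) f u -> u x = g (Zf w).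
Proof.
move=> gpos [v [q [iv Hu Hq aev [u0 u1]]]].
have apos s : 0 < s < 1 -> 0 < a_ w s.
  move=> /andP[s0 s1]; have s01 : 0 <= s < 1 by rewrite ltW.
  have [k kn ck] := cell_ex N s01.
  by rewrite (medium_eps_cell w ck) invr_gt0 gpos.
have mF := measurable_antideriv f_meas f_L2.
have [iF _] := medium_integral w mF (fun s Is => antideriv_bound f_meas f_L2 Is).
have m1 : measurable_fun unit_itv (cst 1 : R -> R) by exact: measurable_cst.
have c1 (s : R) : unit_itv s -> `|(cst 1 : R -> R) s| <= 1 by rewrite normr1.
have [i1 _] := medium_integral w m1 c1.
have key y : 0 <= y <= 1 -> u y = q 0 * \int[mu]_(s in `[0, y]) (1 / a_ w s) -
    \int[mu]_(s in `[0, y]) (antideriv f s / a_ w s).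
  move=> y01; have /andP[y0 y1] := y01; rewrite Hu// u0 add0r.
  have sub : `[0, y] `<=` @unit_itv R.
    by move=> s; rewrite /unit_itv/= !in_itv/= => /andP[-> sy]; exact: le_trans y1.
  have i1y : mu.-integrable `[0, y] (EFin \o (fun s => 1 / a_ w s)).
    by apply: integrableS i1.
  have iFy : mu.-integrable `[0, y] (EFin \o (fun s => antideriv f s / a_ w s)).
    by apply: integrableS iF.
  have ivy : mu.-integrable `[0, y] (EFin \o v).
    by apply: integrableS iv.
  have iZy : mu.-integrable `[0, y] (EFin \o (fun s => q 0 * (1 / a_ w s))).
    exact: integrable_scale.
  rewrite -RintegralZl// -RintegralB//.
  rewrite /Rintegral; congr fine; apply: ae_eq_integral => //.
  - exact: measurable_int ivy.
  - by apply/measurable_EFinP; apply: measurable_funB; apply/measurable_EFinP;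
      [exact: measurable_int iZy|exact: measurable_int iFy].
  have [A [mA A0 HA]] := aev.
  exists (A `|` [set 0; 1]); split.
  - by apply: measurableU => //; apply: measurableU.
  - have m1' : measurable ([set 1] : set R) by [].
    have m2 : measurable ([set 0; 1] : set R) by exact: measurableU.
    have z2 : mu [set 0; 1] = 0%E.
      by apply: countable_lebesgue_measure0; apply: finite_set_countable; exact: finite_set2.
    exact: (@null_set_setU _ _ _ mu A [set 0; 1] mA m2 A0 z2).
  move=> s /= nE; apply: contrapT => /not_orP[nA /not_orP[s0 s1]]; apply: nE.
  have as_ : 0 < s < 1 -> a_ w s * v s = q s by apply: contrapT => /HA.
  rewrite /= in_itv/= => /andP[s0' sy]; congr EFin.
  have s01 : 0 < s < 1.
    rewrite !lt_neqAle s0' (le_trans sy y1) !andbT; apply/andP; split; apply/eqP => //.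
    by move=> /esym.
  have a0 : a_ w s != 0 by rewrite gt_eqF// apos.
  have -> : v s = q s / a_ w s by rewrite -as_// mulrAC divff// mul1r.
  rewrite Hq ?s0' ?(le_trans sy)// mulrBl mul1r; congr (_ - _).
have Zind (G : R -> R) : mu.-integrable unit_itv (EFin \o (fun s => G s / a_ w s)) ->
    \int[mu]_(s in unit_itv) (G s * \1_(`]0, x[ : set R) s / a_ w s) =
    \int[mu]_(s in `[0, x]) (G s / a_ w s).
  move=> iG; have /andP[x0 x1] := x01.
  have sub : `[0, x] `<=` @unit_itv R.
    by move=> s; rewrite /unit_itv/= !in_itv/= => /andP[-> sx]; exact: le_trans (ltW x1).
  have iGx : mu.-integrable `[0, x] (EFin \o (fun s => G s / a_ w s)) by apply: integrableS iG.
  have iGo : mu.-integrable `]0, x[ (EFin \o (fun s => G s / a_ w s)).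
    by apply: integrableS iGx => //; exact: subset_itv_oo_cc.
  have iGoc : mu.-integrable `]0, x] (EFin \o (fun s => G s / a_ w s)).
    by apply: integrableS iGx => //; exact: subset_itv_oc_cc.
  rewrite -(Rintegral_itv_obnd_cbnd iGoc) -(Rintegral_itv_bndo_bndc iGo).
  have Eset : (`]0, x[%classic : set R) = unit_itv `&` (`]0, x[%classic : set R).
    apply/seteqP; split => s /=; last by case.
    rewrite /unit_itv /= !in_itv/= => /andP[s0 sx]; split; last by rewrite s0.
    by rewrite !ltW//; exact: lt_trans x1.
  rewrite [in RHS]Eset Rintegral_mkcondr; apply: eq_Rintegral => s sI; rewrite patchE indicE.
  by case: ifP; rewrite ?mulr1 ?mulr0 ?mul0r.
have Z0 : Zf w 0 (inord 0) = \int[mu]_(s in `[0, x]) (antideriv f s / a_ w s).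
  by rewrite mxE -(Zind _ iF); apply: eq_Rintegral => s _; rewrite H0E.
have Z2 : Zf w 0 (inord 2) = \int[mu]_(s in `[0, x]) (1 / a_ w s).
  by rewrite mxE -(Zind _ i1); apply: eq_Rintegral => s _; rewrite H2E mul1r.
have Z1 : Zf w 0 (inord 1) = \int[mu]_(s in unit_itv) (antideriv f s / a_ w s).
  by rewrite mxE; apply: eq_Rintegral => s _; rewrite H1E.
have Z3 : Zf w 0 (inord 3) = \int[mu]_(s in unit_itv) (1 / a_ w s).
  by rewrite mxE; apply: eq_Rintegral => s _; rewrite H3E.
have Z3pos : 0 < Zf w 0 (inord 3).
  rewrite Z3E; apply: (@lt_le_trans _ _ (gam 1%:Z w / n%:R)).
    by rewrite divr_gt0 ?gpos.
  rewrite (bigD1 ord0)//= lerDl sumr_ge0// => k _; rewrite divr_ge0//.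
  exact: gam_ge0.
have /andP[x0 x1] := x01.
have := key 1; rewrite u1 lexx ler01 -Z3 -Z1 => /(_ isT) /esym/eqP.
rewrite subr_eq0 => /eqP q0E.
rewrite key ?ltW// -Z2 -Z0 /g -q0E; field.
by rewrite gt_eqF.
Qed.

End fixed_scale.
End medium_theory.

Lemma le_Rintegral_ae {R : realType} (D : set R) (f1 f2 : R -> R) :
  measurable D ->
  (@lebesgue_measure R).-integrable D (EFin \o f1) ->
  (@lebesgue_measure R).-integrable D (EFin \o f2) ->
  {ae @lebesgue_measure R, forall s, D s -> f1 s <= f2 s} ->
  \int[@lebesgue_measure R]_(s in D) f1 s <= \int[@lebesgue_measure R]_(s in D) f2 s.
Proof.
move=> mD i1 i2 f12; rewrite -subr_ge0 -RintegralB//.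
have iB : (@lebesgue_measure R).-integrable D (EFin \o (fun s => f2 s - f1 s)).
  exact: (@integrableB _ _ _ (@lebesgue_measure R) D mD _ _ i2 i1).
have mB := measurable_int _ iB.
have E : (\int[@lebesgue_measure R]_(s in D) (f2 s - f1 s)%:E =
    \int[@lebesgue_measure R]_(s in D) `|f2 s - f1 s|%:E)%E.
  apply: ae_eq_integral => //.
  - by apply/measurable_EFinP; apply: measurableT_comp => //; exact/measurable_EFinP.
  - have [N [mN N0 HN]] := f12; exists N; split => // s nE; apply: HN => h; apply: nE => Ds.
    by rewrite /= ger0_norm// subr_ge0 h.
by rewrite /Rintegral E; apply: fine_ge0; apply: integral_ge0 => s _; rewrite lee_fin.
Qed.

(** * The exponential growth rate *)

Section upper_bound.
Context {R : realType} {d} {T : measurableType d} (P : probability T R).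
Local Notation mu := (@lebesgue_measure R).
Variable X : int -> {RV P >-> R}.
Hypothesis X_ge0 : forall m w, 0 <= X m w.
Hypothesis X_law : forall m, log_mgf (X m) = log_mgf (X 0).
Hypothesis X_indep : mutually_independent X.
Local Notation La := (log_mgf (X 0)).

Lemma expectation_exp m (t : R) : (La t < +oo)%E ->
  (\int[P]_w (expR (t * X m w))%:E = (expR (fine (La t)))%:E)%E.
Proof.
move=> Lt; have fL : La t \is a fin_num by rewrite fin_real// log_mgf_gtNy.
have -> : (expR (fine (La t)))%:E = expeR (log_mgf (X m) t).
  by rewrite X_law -[in RHS](fineK fL).
by rewrite lneK ?in_itv/= ?mmt_gen_ge0 ?leey// mmt_genE.
Qed.

(* Fatou over growing windows, each window sum having independent terms. *)
Lemma exp_le_windows (Y : T -> R) (t e : int -> R) (E : R) :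
  measurable_fun setT Y ->
  {ae P, forall w, \sum_(m <- window M) t m * X m w @[M --> \oo] --> Y w} ->
  (forall m, (La (t m) <= (e m)%:E)%E) ->
  \sum_(m <- window M) e m @[M --> \oo] --> E ->
  (\int[P]_w (expR (Y w))%:E <= (expR E)%:E)%E.
Proof.
move=> mY cY Le cE.
pose V M w := (expR (\sum_(m <- window M) t m * X m w))%:E.
have mV M : measurable_fun setT (V M).
  apply/measurable_EFinP; apply: measurableT_comp => //.
  by apply: measurable_sum => m; apply: measurable_funM.
have IV M : (\int[P]_w V M w <= (expR (\sum_(m <- window M) e m))%:E)%E.
  have VE w : V M w = (\prod_(m <- window M) (fun m y => expR (t m * y)) m (X m w))%:E.
    by rewrite /V expR_sum.
  under eq_integral do rewrite VE.
  have -> : (\int[P]_w (\prod_(m <- window M) expR (t m * X m w))%:E =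
      (\prod_(m <- window M) expR (fine (La (t m))))%:E)%E.
    apply: (expectation_prod_indep X_indep (phi := fun m y => expR (t m * y))).
    - by move=> m; apply: measurableT_comp => //; exact: measurable_funM.
    - by move=> m y; exact: expR_ge0.
    - exact: uniq_window.
    - by move=> m _; apply: expectation_exp; rewrite (le_lt_trans (Le m))// ltry.
  rewrite lee_fin -expR_sum ler_expR; apply: ler_sum => m _.
  by rewrite -lee_fin fineK// fin_real// log_mgf_gtNy (le_lt_trans (Le m))// ltry.
have V0 M w : (0 <= V M w)%E by rewrite lee_fin expR_ge0.
apply: (@le_trans _ _ (\int[P]_w limn_einf (fun M => V M w))%E).
  apply: ae_ge0_le_integral => //.
  - by apply/measurable_EFinP; exact: measurableT_comp.
  - move=> w _; apply: limn_einf_ge_near => v v0.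
    by exists 0%N => // M _ /=; apply: le_trans (ltW v0) _; exact: V0.
  - under eq_fun do rewrite /limn_einf.
    apply: measurableT_comp => //; apply: measurable_fun_limn_esup => k.
    by apply: measurableT_comp.
  apply: filterS cY => w cw _; apply: limn_einf_ge_near => v; rewrite lte_fin => vY.
  have cV : expR (\sum_(m <- window M) t m * X m w) @[M --> \oo] --> expR (Y w).
    by apply: continuous_cvg => //; exact: continuous_expR.
  have /cvgrPdist_lt/(_ (expR (Y w) - v)) := cV; rewrite subr_gt0 => /(_ vY).
  apply: filterS => M h; rewrite lee_fin.
  by move: h; rewrite ltr_distlC => /andP[]; lra.
apply: le_trans (fatou _ _ mV _) _ => //.
apply: le_trans (limn_einf_sup _) _; apply: limn_esup_le_near => v; rewrite lte_fin => Ev.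
have cV : expR (\sum_(m <- window M) e m) @[M --> \oo] --> expR E.
  by apply: continuous_cvg => //; exact: continuous_expR.
have /cvgrPdist_lt/(_ (v - expR E)) := cV; rewrite subr_gt0 => /(_ Ev).
apply: filterS => M h; apply: le_trans (IV M) _; rewrite lee_fin.
by move: h; rewrite ltr_distlC => /andP[_]; lra.
Qed.

Variable h : int -> R.
Hypothesis h_ge0 : forall k, 0 <= h k.
Hypothesis h_fin : (l1norm h < +oo)%E.
Local Notation c := (fine (l1norm h)).
Hypothesis c_gt0 : 0 < c.
Variables (phi : R -> R) (B : R).
Hypothesis mphi : measurable_fun unit_itv phi.
Hypothesis phi_bound : forall s, unit_itv s -> `|phi s| <= B.
Local Notation L := (\int[mu]_(s in unit_itv) La (c * phi s))%E.

Lemma measurable_log_mgf_phi : measurable_fun unit_itv (fun s => La (c * phi s)).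
Proof. by apply: measurableT_comp; [exact: measurable_log_mgf|exact: measurable_funM]. Qed.

Definition lower_La : R := - fine (La (- (c * B))).

Lemma phi_B_ge0 : 0 <= B.
Proof.
have I0 : unit_itv (0 : R) by rewrite /unit_itv/= in_itv/= lexx ler01.
exact: le_trans (phi_bound I0).
Qed.

Lemma lower_LaP t : - (c * B) <= t -> ((- lower_La)%:E <= La t)%E.
Proof.
move=> ct; have cB : - (c * B) <= 0 by rewrite oppr_le0 mulr_ge0 ?phi_B_ge0 ?ltW.
by rewrite opprK fineK ?log_mgf_neg_fin//; exact: log_mgf_nondecreasing.
Qed.

Lemma lower_La_ge0 : 0 <= lower_La.
Proof.
have cB : - (c * B) <= 0 by rewrite oppr_le0 mulr_ge0 ?phi_B_ge0 ?ltW.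
by rewrite oppr_ge0 -lee_fin fineK ?log_mgf_neg_fin// log_mgf_le0.
Qed.

Lemma lower_La_phi s : unit_itv s -> ((- lower_La)%:E <= La (c * phi s))%E.
Proof.
move=> Is; apply: lower_LaP; rewrite -mulrN ler_pM2l//.
by have := phi_bound Is; rewrite ler_norml => /andP[].
Qed.

Variable N : nat.
Local Notation n := N.+1.

Lemma integrable_phi_cell k : (k < n)%N -> mu.-integrable (cell N k) (EFin \o phi).
Proof.
move=> kn; apply: integrable_cell => //.
have [] // := @Rintegral_bounded R phi B unit_itv mphi.
- by rewrite setDv measure0.
- by move=> s Is _; exact: phi_bound.
Qed.

Definition ymean (k : nat) : R := n%:R * \int[mu]_(s in cell N k) phi s.

(* With phi s = dot l (H s), N.+1 * dot l Z is both the sum over k of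
   gamma_(k+1) * ymean k and the sum over m of tcoef m * beta_m. *)
Definition tcoef (m : int) : R := \sum_(k < n) ymean k * h (k.+1%:Z - m).

Lemma ymean_bound k : (k < n)%N -> `|ymean k| <= B.
Proof.
move=> kn; rewrite -[ymean k]subr0; apply: cell_average_bound.
  exact: integrable_phi_cell.
by move=> s /(cell_unit kn); rewrite subr0; exact: phi_bound.
Qed.

Lemma cvg_h_window k : \sum_(m <- window M) h (k - m) @[M --> \oo] --> c.
Proof.
have -> : l1norm h = \esum_(m in [set: int]) (h (k - m))%:E.
  by rewrite (esum_reflect (a := fun m => (h m)%:E))// => m; rewrite lee_fin.
apply: cvg_window_fin => //.
by rewrite (esum_reflect (a := fun m => (h m)%:E))// => m; rewrite lee_fin.
Qed.

Lemma sum_h_le_c k (s : seq int) : uniq s -> \sum_(m <- s) h (k - m) <= c.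
Proof.
move=> us; have [M HM] := window_cover s.
rewrite -lee_fin -sumEFin.
apply: (@le_trans _ _ (\sum_(m <- window M) (h (k - m))%:E)%E).
  by apply: le_sum_subset => //; [exact: uniq_window|move=> m; rewrite lee_fin].
apply: le_trans (window_sum_le _ _) _; first by move=> m; rewrite lee_fin.
rewrite (esum_reflect (a := fun m => (h m)%:E)); last by move=> m; rewrite lee_fin.
by rewrite fineK// ge0_fin_numE// esum_ge0// => m _; rewrite lee_fin.
Qed.

Lemma sum_h_col (m : int) : \sum_(k < n) h (k.+1%:Z - m) <= c.
Proof.
have -> : \sum_(k < n) h (k.+1%:Z - m) =
    \sum_(j <- [seq m - k.+1%:Z | k <- iota 0 n]) h (0 - j).
  rewrite big_map -(big_mkord xpredT (fun k => h (k.+1%:Z - m))) /index_iota subn0.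
  by apply: eq_bigr => k _; congr h; lia.
by apply: sum_h_le_c; rewrite map_inj_uniq ?iota_uniq// => i j; lia.
Qed.

Definition emean (k : nat) : R := n%:R * \int[mu]_(s in cell N k) fine (La (c * phi s)).

Hypothesis L_fin : (L < +oo)%E.

Lemma integrable_La_phi : mu.-integrable unit_itv (fun s => La (c * phi s)).
Proof.
apply: (@integrable_bounded_below _ _ lower_La) => //.
- exact: lower_La_ge0.
- exact: measurable_log_mgf_phi.
- exact: lower_La_phi.
Qed.

Lemma ae_fin_La_phi : {ae mu, forall s, unit_itv s -> La (c * phi s) \is a fin_num}.
Proof. by apply: integrable_ae => //; exact: integrable_La_phi. Qed.

Lemma ae_eq_La_phi : ae_eq mu unit_itv (EFin \o (fun s => fine (La (c * phi s))))
  (fun s => La (c * phi s)).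
Proof.
have [A [mA A0 HA]] := ae_fin_La_phi; exists A; split => // s nE; apply: HA => H.
by apply: nE => Is; rewrite /= fineK ?H.
Qed.

Lemma integrable_fine_La : mu.-integrable unit_itv (EFin \o (fun s => fine (La (c * phi s)))).
Proof.
have iL := integrable_La_phi.
apply/integrableP; split.
  apply/measurable_EFinP; apply: measurableT_comp => //; exact: measurable_log_mgf_phi.
have /integrableP[_] := iL; apply: le_lt_trans.
apply: ae_ge0_le_integral => //.
- apply: measurableT_comp => //; apply/measurable_EFinP; apply: measurableT_comp => //.
  exact: measurable_log_mgf_phi.
- by apply: measurableT_comp => //; exact: measurable_log_mgf_phi.
have [A [mA A0 HA]] := ae_fin_La_phi; exists A; split => // s nE; apply: HA => H.
by apply: nE => Is; rewrite /= -[in leRHS](fineK (H Is)).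
Qed.

Lemma sum_emean : (\sum_(k < n) emean k)%:E = (n%:R%:E * L)%E.
Proof.
rewrite /emean -mulr_sumr -Rintegral_cells; last exact: integrable_fine_La.
rewrite EFinM; congr (_ * _)%E; rewrite /Rintegral fineK; last first.
  by apply: integrable_fin_num => //; exact: integrable_fine_La.
apply: ae_eq_integral => //.
- exact: (measurable_int _ integrable_fine_La).
- exact: measurable_log_mgf_phi.
- exact: ae_eq_La_phi.
Qed.

(** Jensen's inequality on one cell: an affine minorant is averaged exactly. *)
Lemma minorant_mean (a p t : R) k : (k < n)%N ->
  (forall u, ((a + p * (u - t))%:E <= La u)%E) ->
  a + p * (c * ymean k - t) <= emean k.
Proof.
move=> kn Hp; have iphi := integrable_phi_cell kn.
have n0 : 0 < n%:R :> R by rewrite ltr0n.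
have mc := measurable_cell (R := R) N k.
have i1 : mu.-integrable (cell N k) (EFin \o (fun s => (p * c) * phi s)).
  exact: integrable_scale.
have i2 := @integrable_cell_cst R N (a - p * t) k.
have i3 : mu.-integrable (cell N k) (EFin \o (fun s => (p * c) * phi s + (a - p * t))).
  exact: (@integrableD _ _ _ mu _ mc _ _ i1 i2).
have -> : a + p * (c * ymean k - t) =
    n%:R * \int[mu]_(s in cell N k) ((p * c) * phi s + (a - p * t)).
  rewrite RintegralD// RintegralZl// Rintegral_cell_cst /ymean; field.
  by rewrite gt_eqF.
rewrite /emean ler_pM2l//; apply: le_Rintegral_ae => //.
  by apply: integrable_cell => //; exact: integrable_fine_La.
have [A [mA A0 HA]] := ae_fin_La_phi; exists A; split => // s nE; apply: HA => H.
apply: nE => cs; have Is := cell_unit kn cs.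
rewrite -lee_fin fineK ?H//; apply: le_trans (Hp _); rewrite lee_fin.
by rewrite le_eqVlt; apply/orP; left; apply/eqP; ring.
Qed.

(* Jensen: tcoef m is the combination of the numbers c * ymean k with weights
   h (k.+1 - m) / c of total mass at most 1; the missing mass sits at 0, where
   the log-moment generating function vanishes. *)
Lemma log_mgf_tcoef m :
  (La (tcoef m) <= (\sum_(k < n) h (k.+1%:Z - m) / c * emean k)%:E)%E.
Proof.
apply: lee_real_lt => a /log_mgf_affine_minorant[p Hp]; rewrite lee_fin.
have h0 := Hp 0; rewrite log_mgf0 lee_fin in h0.
have qc := sum_h_col m; set q := \sum_(k < n) h (k.+1%:Z - m) in qc.
(* [tcoef m] is the barycentre of the points [c * ymean k] and 0, so the affine minorant averages to
   its value a there; [h0] makes the term at 0 nonpositive. *)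
have -> : a = \sum_(k < n) (h (k.+1%:Z - m) / c * (a + p * (c * ymean k - tcoef m))) +
    (1 - q / c) * (a + p * (0 - tcoef m)).
  have -> : \sum_(k < n) (h (k.+1%:Z - m) / c * (a + p * (c * ymean k - tcoef m))) =
      q / c * (a - p * tcoef m) + p * tcoef m.
    have Et : p * tcoef m = \sum_(k < n) h (k.+1%:Z - m) / c * (p * c * ymean k).
      rewrite /tcoef mulr_sumr; apply: eq_bigr => k _; field.
      by rewrite gt_eqF.
    rewrite [X in _ = _ + X]Et /q !mulr_suml -big_split/=.
    by apply: eq_bigr => k _; ring.
  by ring.
rewrite -[leRHS]addr0; apply: lerD.
  apply: ler_sum => k _; apply: ler_wpM2l; first by rewrite divr_ge0// ltW.
  exact: minorant_mean.
by rewrite mulr_ge0_le0// subr_ge0 ler_pdivrMr// mul1r.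
Qed.

(** For a fixed cell the weights h (k + 1 - m) / c sum to 1 over all m, so the Jensen bounds add up
    to the plain sum of cell means. *)
Lemma cvg_emean_window :
  \sum_(m <- window M) (\sum_(k < n) h (k.+1%:Z - m) / c * emean k) @[M --> \oo] -->
  \sum_(k < n) emean k.
Proof.
under eq_fun do rewrite exchange_big/=.
apply: (@cvg_big _ _ +%R 0 xpredT add_continuous _ \oo) => k _.
have -> : (fun M => \sum_(m <- window M) h (k.+1%:Z - m) / c * emean k) =
    (fun M => (\sum_(m <- window M) h (k.+1%:Z - m)) * (c^-1 * emean k)).
  apply/funext => M; under eq_bigr do rewrite -mulrA.
  by rewrite -mulr_suml.
rewrite -[X in _ --> X](@mulVKf _ c) ?gt_eqF//.
apply: cvgM; last exact: cvg_cst.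
exact: cvg_h_window.
Qed.

Lemma cvg_gam_window (w : T) :
  (forall k, (k < n)%N -> (gamma h X k.+1%:Z w < +oo)%E) ->
  \sum_(m <- window M) tcoef m * X m w @[M --> \oo] -->
  \sum_(k < n) fine (gamma h X k.+1%:Z w) * ymean k.
Proof.
move=> gy.
have -> : (fun M => \sum_(m <- window M) tcoef m * X m w) =
    (fun M => \sum_(k < n) (\sum_(m <- window M) h (k.+1%:Z - m) * X m w) * ymean k).
  apply/funext => M; under eq_bigr do rewrite /tcoef mulr_suml.
  rewrite exchange_big/=; apply: eq_bigr => k _; rewrite mulr_suml.
  by apply: eq_bigr => m _; ring.
apply: (@cvg_big _ _ +%R 0 xpredT add_continuous _ \oo) => k _.
apply: cvgM; last exact: cvg_cst.
by apply: cvg_gam => //; exact: gy.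
Qed.

End upper_bound.

(** * Tails of summable families and their means *)

Section summable_tails.
Context {R : realType}.
Variable b : int -> R.
Hypothesis b_ge0 : forall m, 0 <= b m.
Hypothesis b_fin : (\esum_(m in [set: int]) (b m)%:E < +oo)%E.
Local Notation S := (fine (\esum_(m in [set: int]) (b m)%:E)).

Definition window_tail (p : nat) : R := S - \sum_(m <- window p) b m.

Lemma sum_le_esum (s : seq int) : uniq s -> \sum_(m <- s) b m <= S.
Proof.
move=> us; have [M HM] := window_cover s.
apply: le_trans (window_sum_le_fin M b_ge0 b_fin).
rewrite -lee_fin -!sumEFin; apply: le_sum_subset => //; exact: uniq_window.
Qed.

Lemma window_tail_ge0 p : 0 <= window_tail p.
Proof. by rewrite subr_ge0 sum_le_esum// uniq_window. Qed.

Lemma sum_le_window_tail p (s : seq int) : uniq s ->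
  (forall m, m \in s -> (p < `|m|)%N) -> \sum_(m <- s) b m <= window_tail p.
Proof.
move=> us sp; rewrite lerBrDr -big_cat; apply: sum_le_esum.
rewrite cat_uniq us (uniq_window p) andbT andTb; apply/hasPn => m.
by rewrite mem_window => mp; apply/negP => /sp; rewrite ltnNge mp.
Qed.

Lemma window_tail_cvg : window_tail p @[p --> \oo] --> 0.
Proof.
rewrite -(subrr S); apply: cvgB; first exact: cvg_cst.
exact: cvg_window_fin.
Qed.

Lemma window_tail_mean_cvg :
  n.+1%:R^-1 * \sum_(k < n.+1) window_tail k @[n --> \oo] --> 0.
Proof.
have := cesaro window_tail_cvg; rewrite /arithmetic_mean /series/=.
by under eq_fun do rewrite big_mkord.
Qed.

End summable_tails.

(** Some F k may be +oo; real values strictly below them, with sum still above v, serve as exponents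
    for the truncated factors. *)
Lemma choose_below {R : realType} (n : nat) (F : nat -> \bar R) (v : R) :
  (forall k, (k < n)%N -> (-oo < F k)%E) -> (v%:E < \sum_(k < n) F k)%E ->
  exists a : nat -> R, (forall k, (k < n)%N -> ((a k)%:E < F k)%E) /\
    v < \sum_(k < n) a k.
Proof.
elim: n v => [|n IH] v FN; first by rewrite big_ord0 => v0; exists (fun=> 0); rewrite big_ord0.
rewrite big_ord_recr/= => vF.
have FN' k : (k < n)%N -> (-oo < F k)%E by move=> kn; apply: FN; exact: ltnW.
have SN : (-oo < \sum_(k < n) F k)%E.
  by rewrite ltNye; apply/eqP => /esum_eqNyP[i [_ _ Fi]]; have := FN' i (ltn_ord i); rewrite Fi.
have Fn := FN n (ltnSn n).
have [r [rS rF]] : exists r : R, (r%:E < \sum_(k < n) F k)%E /\ ((v - r)%:E < F n)%E.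
  move: vF SN Fn; case: (\sum_(k < n) F k)%E => [S| |]//; case: (F n) => [f| |]//.
  - rewrite -EFinD !lte_fin => vSf _ _; exists (S - (S + f - v) / 2).
    by rewrite !lte_fin; split; lra.
  - by move=> _ _ _; exists (S - 1); rewrite !lte_fin ltry; split => //; lra.
  - by move=> _ _ _; exists (v - f + 1); rewrite lte_fin ltry; split => //; lra.
  - by move=> _ _ _; exists 0; rewrite !ltry.
have [a [aF ra]] := IH r FN' rS.
have [z [vz zF]] := lte_real_between rF.
exists (fun k => if (k < n)%N then a k else z); split => [k|].
  rewrite ltnS leq_eqVlt; case: ltnP => [kn _|nk]; first exact: aF.
  by rewrite orbF => /eqP ->.
rewrite big_ord_recr/= ltnn; under eq_bigr do rewrite ltn_ord.
by move: vz; rewrite lte_fin; lra.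
Qed.

(** * The lower bound at a fixed scale *)

Section lower_bound.
Context {R : realType} {d} {T : measurableType d} (P : probability T R).
Local Notation mu := (@lebesgue_measure R).
Variable X : int -> {RV P >-> R}.
Hypothesis X_ge0 : forall m w, 0 <= X m w.
Hypothesis X_law : forall m, log_mgf (X m) = log_mgf (X 0).
Hypothesis X_indep : mutually_independent X.
Local Notation La := (log_mgf (X 0)).

(** The Laplace exponent - log E exp(- u beta), finite for u >= 0 because beta >= 0. *)
Definition psi (u : R) : R := - fine (La (- u)).

Lemma psi_ge0 u : 0 <= u -> 0 <= psi u.
Proof.
move=> u0; have u0' : - u <= 0 by rewrite oppr_le0.
by rewrite oppr_ge0 -lee_fin fineK ?log_mgf_neg_fin// log_mgf_le0.
Qed.

(* psi is concave with psi 0 = 0, hence subadditive. *)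
Lemma psi_concave0 u a : 0 <= u -> 0 <= a <= 1 -> a * psi u <= psi (a * u).
Proof.
move=> u0 /andP[a0 a1]; have u0' : - u <= 0 by rewrite oppr_le0.
have au0 : - (a * u) <= 0 by rewrite oppr_le0 mulr_ge0.
rewrite /psi mulrN lerN2 -lee_fin EFinM !fineK ?log_mgf_neg_fin//.
have := @log_mgf_convex _ _ _ P (X 0) a (- u) 0; rewrite a0 a1 => /(_ isT).
by rewrite mulr0 addr0 log_mgf0 mule0 adde0 mulrN.
Qed.

Lemma psi_subadd u v : 0 <= u -> 0 <= v -> psi (u + v) <= psi u + psi v.
Proof.
move=> u0 v0; have [uv|uv] := eqVneq (u + v) 0.
  have -> : u = 0 by lra.
  have -> : v = 0 by lra.
  by rewrite addr0 /psi oppr0 log_mgf0 /= oppr0 addr0.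
have uv0 : 0 < u + v by rewrite lt_def uv addr_ge0.
have h1 := @psi_concave0 (u + v) (u / (u + v)) (ltW uv0).
have h2 := @psi_concave0 (u + v) (v / (u + v)) (ltW uv0).
rewrite divfK// divr_ge0 ?(ltW uv0)// ler_pdivrMr// mul1r lerDl v0 in h1.
rewrite divfK// divr_ge0 ?(ltW uv0)// ler_pdivrMr// mul1r lerDr u0 in h2.
apply: le_trans (lerD (h1 isT) (h2 isT)).
by rewrite -mulrDl -mulrDl divff// mul1r.
Qed.

Lemma psi_sum (I : Type) (s : seq I) (F : I -> R) : (forall i, 0 <= F i) ->
  psi (\sum_(i <- s) F i) <= \sum_(i <- s) psi (F i).
Proof.
move=> F0; elim: s => [|i s IH]; first by rewrite !big_nil /psi oppr0 log_mgf0 /= oppr0.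
rewrite !big_cons; apply: le_trans (psi_subadd _ _) _ => //; first exact: sumr_ge0.
by rewrite lerD2l.
Qed.

Lemma expectation_exp_neg m u : 0 <= u ->
  (\int[P]_w (expR (- u * X m w))%:E = (expR (- psi u))%:E)%E.
Proof.
move=> u0; rewrite (expectation_exp X_law)// ?opprK//.
by apply: le_lt_trans (ltry 0); rewrite log_mgf_le0// oppr_le0.
Qed.

(** Monotone convergence in K. It covers [La t = +oo], where a bounded factor with large expectation
    replaces a non-integrable one. *)
Lemma truncated_exp m (t a : R) : (a%:E < La t)%E -> exists K : nat,
  ((expR a)%:E <= \int[P]_w (Num.min (expR (t * X m w)) K%:R)%:E)%E.
Proof.
rewrite -(X_law m) => at'.
have aM : ((expR a)%:E < 'M_P (X m) t)%E.
  by move: at'; rewrite -lte_expeR lneK ?in_itv/= ?mmt_gen_ge0 ?leey.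
have me : measurable_fun setT (fun w => expR (t * X m w)).
  by apply/measurable_EFinP; exact: measurable_expRM.
have cK : (\int[P]_w (Num.min (expR (t * X m w)) K%:R)%:E)%E @[K --> \oo] --> 'M_P (X m) t.
  rewrite mmt_genE.
  have -> : (\int[P]_w (expR (t * X m w))%:E =
      \int[P]_w (limn (fun K => (Num.min (expR (t * X m w)) K%:R)%:E)))%E.
    apply: eq_integral => w _; apply/esym/lim_near_cst => //; near=> K.
    by congr EFin; apply/min_idPl; near: K; exact: nbhs_infty_ger.
  apply: cvg_monotone_convergence => //.
  - by move=> K; apply/measurable_EFinP; exact: measurable_minr.
  - by move=> w _ j k jk; rewrite lee_fin le_min !ge_min lexx ler_nat jk orbT.
have [K _ HK] := cvge_near_gt cK aM.
by exists K; apply/ltW/HK => /=.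
Unshelve. all: by end_near. Qed.

Variable h : int -> R.
Hypothesis h_ge0 : forall k, 0 <= h k.
Hypothesis h_fin : (l1norm h < +oo)%E.
Local Notation c := (fine (l1norm h)).
Variable B : R.
Hypothesis B_ge0 : 0 <= B.

Local Notation q := (fun j => psi (B * h j)).

Lemma q_ge0 j : 0 <= q j.
Proof. by apply: psi_ge0; rewrite mulr_ge0. Qed.

(* Summability comes from 0 < E[exp (- B gamma_1)], gamma_1 being finite a.s. *)
Lemma q_fin : {ae P, forall w, (gamma h X 1 w < +oo)%E} ->
  (\esum_(m in [set: int]) (q m)%:E < +oo)%E.
Proof.
move=> gy; rewrite -(esum_reflect 1 (a := fun m => (q m)%:E)); last first.
  by move=> m; rewrite lee_fin q_ge0.
have mg := measurable_gam h_ge0 X_ge0 1.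
have mY : measurable_fun setT (fun w => - B * fine (gamma h X 1 w)).
  exact: measurable_funM.
have d0 := integral_expR_gt0 P mY.
apply: (@esum_lty_bounded _ _ (- ln (fine (\int[P]_w (expR (- B * fine (gamma h X 1 w)))%:E)))).
  by move=> m; exact: q_ge0.
move=> M; rewrite lerNr.
have le : (\int[P]_w (expR (- B * fine (gamma h X 1 w)))%:E <=
    (expR (- \sum_(m <- window M) q (1 - m)))%:E)%E.
  rewrite -sumrN expR_sum.
  have <- : (\int[P]_w (\prod_(m <- window M) expR (- (B * h (1 - m)) * X m w))%:E =
      (\prod_(m <- window M) expR (- q (1 - m)))%:E)%E.
    apply: (expectation_prod_indep X_indep (phi := fun m y => expR (- (B * h (1 - m)) * y))).
    - by move=> m; apply: measurableT_comp => //; exact: measurable_funM.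
    - by move=> m y; exact: expR_ge0.
    - exact: uniq_window.
    - by move=> m _; apply: expectation_exp_neg; rewrite mulr_ge0.
  apply: ae_ge0_le_integral => //.
  - by apply/measurable_EFinP; exact: measurableT_comp.
  - move=> w _; rewrite lee_fin prodr_ge0// => m _; exact: expR_ge0.
  - apply/measurable_EFinP; apply: measurable_prod => m _.
    by apply: measurableT_comp => //; exact: measurable_funM.
  apply: filterS gy => w gw _; rewrite lee_fin -expR_sum ler_expR.
  have -> : \sum_(m <- window M) - (B * h (1 - m)) * X m w =
      - B * \sum_(m <- window M) h (1 - m) * X m w.
    by rewrite mulr_sumr; apply: eq_bigr => m _; ring.
  rewrite !mulNr lerN2 ler_wpM2l//.
  by apply: (window_sum_le_fin (b := fun m => h (1 - m) * X m w)) => // m; rewrite mulr_ge0.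
have fI : (\int[P]_w (expR (- B * fine (gamma h X 1 w)))%:E)%E \is a fin_num.
  by rewrite ge0_fin_numE ?ltW//; apply: le_lt_trans le _; rewrite ltry.
rewrite -(fineK fI) lte_fin in d0; rewrite -(fineK fI) lee_fin in le.
by rewrite -ler_expR lnK.
Qed.

Variables (phi : R -> R).
Hypothesis mphi : measurable_fun unit_itv phi.
Hypothesis phi_bound : forall s, unit_itv s -> `|phi s| <= B.
Variable N : nat.
Local Notation n := N.+1.
Local Notation tco := (tcoef h phi N).

Definition core (m : int) : bool := (0 < m <= n%:Z)%R.

Lemma core_perm M : (n <= M)%N ->
  perm_eq [seq m <- window M | core m] [seq k.+1%:Z | k <- iota 0 n].
Proof.
move=> nM; apply: uniq_perm.
- by rewrite filter_uniq// uniq_window.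
- by rewrite map_inj_uniq ?iota_uniq// => i j; lia.
move=> m; rewrite mem_filter mem_window; apply/idP/mapP.
  rewrite /core => /andP[mn _]; exists `|m|.-1%N; last by lia.
  by rewrite mem_iota; lia.
by move=> [k]; rewrite mem_iota => kn ->; rewrite /core; lia.
Qed.

Lemma big_core (A : Type) (idx : A) (op : Monoid.com_law idx) (F : int -> A) M :
  (n <= M)%N ->
  \big[op/idx]_(m <- window M | core m) F m = \big[op/idx]_(k < n) F k.+1%:Z.
Proof.
move=> nM; rewrite -big_filter (perm_big _ (core_perm nM)) big_map.
by rewrite -(big_mkord xpredT (fun k => F k.+1%:Z)) /index_iota subn0.
Qed.

Definition scoef (m : int) : R := \sum_(k < n) h (k.+1%:Z - m).

Lemma scoef_ge0 m : 0 <= scoef m.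
Proof. exact: sumr_ge0. Qed.

Lemma tcoef_scoef m : `|tco m| <= B * scoef m.
Proof.
rewrite /tcoef /scoef mulr_sumr; apply: le_trans (ler_norm_sum _ _ _) _.
apply: ler_sum => k _; rewrite normrM (ger0_norm (h_ge0 _)) ler_wpM2r//.
exact: (ymean_bound mphi phi_bound).
Qed.

(* The variables with index in the core 1..N.+1 are kept, truncated at a level K
   so that dominated convergence applies; those outside are only bounded below,
   through |tcoef| <= B * scoef, at a total cost tau. *)
Lemma exp_ge_windows (a : int -> R) (tau : R) :
  (forall m, core m -> ((a m)%:E < La (tco m))%E) ->
  {ae P, forall w, forall k, (k < n)%N -> (gamma h X k.+1%:Z w < +oo)%E} ->
  (forall M, \sum_(m <- window M | ~~ core m) psi (B * scoef m) <= tau) ->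
  ((expR (\sum_(k < n) a k.+1%:Z - tau))%:E <=
   \int[P]_w (expR (\sum_(k < n) fine (gamma h X k.+1%:Z w) * ymean phi N k))%:E)%E.
Proof.
move=> aLa gy Htau.
have exK m : exists K : nat, core m ->
    ((expR (a m))%:E <= \int[P]_w (Num.min (expR (tco m * X m w)) K%:R)%:E)%E.
  have [cm|ncm] := boolP (core m); last by exists 0%N.
  by have [K HK] := truncated_exp m (aLa m cm); exists K.
have [K HK] := choice exK.
pose F m (y : R) : R := if core m then Num.min (expR (tco m * y)) (K m)%:R
  else expR (- (B * scoef m) * y).
have mF m : measurable_fun setT (F m).
  rewrite /F; case: (core m).
    by apply: measurable_minr => //; apply: measurableT_comp => //; exact: measurable_funM.
  by apply: measurableT_comp => //; exact: measurable_funM.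
have F0 m y : 0 <= F m y.
  by rewrite /F; case: ifP => _; rewrite ?le_min expR_ge0//=.
have Bs0 m : 0 <= B * scoef m by rewrite mulr_ge0// scoef_ge0.
have F1 m w : ~~ core m -> F m (X m w) <= 1.
  move=> /negbTE cm; rewrite /F cm -expR0 ler_expR mulNr oppr_le0.
  by rewrite mulr_ge0.
have Fexp m w : F m (X m w) <= expR (tco m * X m w).
  rewrite /F; case: ifP => _; first by rewrite ge_min lexx.
  rewrite ler_expR ler_wpM2r//; have := tcoef_scoef m.
  by rewrite ler_norml => /andP[].
have Ffin m : (\int[P]_w (F m (X m w))%:E)%E \is a fin_num.
  have mFX : measurable_fun setT (fun w => (F m (X m w))%:E).
    by apply/measurable_EFinP; apply: measurableT_comp.
  rewrite ge0_fin_numE; last by apply: integral_ge0 => w _; rewrite lee_fin.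
  apply: (@le_lt_trans _ _ (\int[P]_w (cst ((K m)%:R + 1)%:E w))%E).
    apply: ge0_le_integral => //.
      by move=> w _; rewrite lee_fin.
    move=> w _; rewrite lee_fin; have [cm|ncm] := boolP (core m).
      by rewrite /F cm ge_min; apply/orP; right; rewrite lerDl.
    by apply: le_trans (F1 _ _ ncm) _; rewrite lerDr.
  rewrite [X in (X < _)%E]integral_cst//; apply: lte_mul_pinfty => //.
  by have /= -> := probability_setT P; rewrite ltry.
pose V M w := \prod_(m <- window M) F m (X m w).
have IV M : (n <= M)%N -> ((expR (\sum_(k < n) a k.+1%:Z - tau))%:E <= \int[P]_w (V M w)%:E)%E.
  move=> nM; rewrite (@expectation_prod_indep _ _ _ _ _ X_indep F
    (fun m => fine (\int[P]_w (F m (X m w))%:E)%E)) ?uniq_window//; last first.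
    by move=> m _; rewrite fineK.
  rewrite lee_fin.
  apply: (@le_trans _ _ (\prod_(m <- window M)
      expR (if core m then a m else - psi (B * scoef m)))).
    rewrite -expR_sum ler_expR (bigID core)/=; apply: lerD.
      rewrite -(big_core _ a nM) le_eqVlt; apply/orP; left; apply/eqP.
      by apply: eq_bigr => m ->.
    rewrite (eq_bigr (fun m => - psi (B * scoef m))); last by move=> m /negbTE ->.
    by rewrite sumrN lerN2.
  apply: ler_prod => m _; rewrite expR_ge0 -lee_fin fineK//=.
  have [cm|ncm] := boolP (core m); first by rewrite /F cm HK.
  rewrite -(expectation_exp_neg m (Bs0 m)) /F (negbTE ncm)//.
(* Factors outside the core are at most 1, so this bounds [V M] independently of M. *)
pose C : R := \prod_(k < n) (K k.+1%:Z)%:R.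
have VC M w : (n <= M)%N -> V M w <= C.
  move=> nM; rewrite /V (bigID core)/= -[leRHS]mulr1 /C -(big_core _ (fun m => (K m)%:R) nM).
  apply: ler_pM.
  - by apply: prodr_ge0 => m _; exact: F0.
  - by apply: prodr_ge0 => m _; exact: F0.
  - by apply: ler_prod => m cm; rewrite F0/= /F cm ge_min lexx orbT.
  - apply: (@le_trans _ _ (\prod_(m <- window M | ~~ core m) 1)); last by rewrite big1.
    by apply: ler_prod => m cm; rewrite F0 F1.
have VE M w : V M w <= expR (\sum_(m <- window M) tco m * X m w).
  by rewrite expR_sum; apply: ler_prod => m _; rewrite F0 Fexp.
(* [V (M + n)] is below both terms of the minimum; U is bounded by C, so its integrals converge, to
   a limit at most E exp(Y). The shift by n puts the core inside the window. *)
pose U M w : R := Num.min (expR (\sum_(m <- window (M + n)) tco m * X m w)) C.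
pose Y w := \sum_(k < n) fine (gamma h X k.+1%:Z w) * ymean phi N k.
have mY : measurable_fun setT Y.
  apply: measurable_sum => k; apply: measurable_funM => //.
  exact: measurable_gam.
have C0 : 0 <= C by apply: prodr_ge0.
have mU M : measurable_fun setT (fun w => (U M w)%:E).
  apply/measurable_EFinP; apply: measurable_minr => //; apply: measurableT_comp => //.
  by apply: measurable_sum => m; exact: measurable_funM.
have mYC : measurable_fun setT (fun w => (Num.min (expR (Y w)) C)%:E).
  by apply/measurable_EFinP; apply: measurable_minr => //; exact: measurableT_comp.
have cU : (\int[P]_w (U M w)%:E)%E @[M --> \oo] --> (\int[P]_w (Num.min (expR (Y w)) C)%:E)%E.
  have [] // := @dominated_convergence _ _ _ P setT measurableT
    (fun M w => (U M w)%:E) (fun w => (Num.min (expR (Y w)) C)%:E) (cst C%:E) mU mYC.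
  - apply: filterS gy => w gw _.
    have cX := @cvg_gam_window _ _ _ _ X X_ge0 h h_ge0 phi N w gw.
    have cE : expR (\sum_(m <- window (M + n)) tco m * X m w) @[M --> \oo] --> expR (Y w).
      have : expR (\sum_(m <- window M) tco m * X m w) @[M --> \oo] --> expR (Y w).
        by apply: continuous_cvg => //; exact: continuous_expR.
      by rewrite -(cvg_shiftn n).
    have cm : {for expR (Y w), continuous (fun y : R => Num.min y C : R)}.
      exact: (@continuous_min _ _ id (cst C) _ cvg_id (cvg_cst C)).
    apply: cvg_EFin; first exact: nearW.
    exact: (continuous_cvg _ cm cE).
  - by apply: finite_measure_integrable_cst.
  - by apply: nearW => w M _; rewrite /= lee_fin ger0_norm ?le_min ?expR_ge0// ge_min lexx orbT.
apply: (@le_trans _ _ (\int[P]_w (Num.min (expR (Y w)) C)%:E)%E); last first.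
  apply: ge0_le_integral => //.
  - by move=> w _; rewrite lee_fin le_min expR_ge0.
  - by apply/measurable_EFinP; exact: measurableT_comp.
  - by move=> w _; rewrite lee_fin ge_min lexx.
apply: (cvge_ge _ cU); apply: nearW => M.
have nM : (n <= M + n)%N by exact: leq_addl.
apply: le_trans (IV _ nM) _; apply: ge0_le_integral => //.
- by move=> w _; rewrite lee_fin; apply: prodr_ge0 => m _; exact: F0.
- apply/measurable_EFinP; apply: measurable_prod => m _.
  by apply: measurableT_comp.
- by move=> w _; rewrite lee_fin le_min VE VC.
Qed.

(** An index m outside 1..n is at distance more than k from k + 1 if m <= 0, and more than n - 1 - k
    if m > n. *)
Definition boundary_cost : R :=
  \sum_(k < n) (window_tail q k + window_tail q (n.-1 - k)).

(** Subadditivity splits the cost of m over the cells; after exchanging the sums, each cell sees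
    only a tail of q. *)
Lemma sum_psi_scoef : (\esum_(m in [set: int]) (q m)%:E < +oo)%E ->
  forall M, \sum_(m <- window M | ~~ core m) psi (B * scoef m) <= boundary_cost.
Proof.
move=> qf M.
apply: (@le_trans _ _ (\sum_(m <- window M | ~~ core m) \sum_(k < n) q (k.+1%:Z - m))).
  apply: ler_sum => m _; rewrite /scoef mulr_sumr; apply: psi_sum => k.
  by rewrite mulr_ge0.
rewrite exchange_big/=; apply: ler_sum => k _.
have kn := ltn_ord k.
apply: (@le_trans _ _ (window_tail q (minn k (n.-1 - k)))); last first.
  have h1 := window_tail_ge0 q_ge0 qf k.
  have h2 := window_tail_ge0 q_ge0 qf (n.-1 - k).
  by have [_|_] := leqP; rewrite ?lerDl ?lerDr.
rewrite -big_filter.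
have -> : \sum_(m <- [seq m <- window M | ~~ core m]) q (k.+1%:Z - m) =
    \sum_(j <- [seq k.+1%:Z - m | m <- window M & ~~ core m]) q j by rewrite big_map.
apply: sum_le_window_tail => //.
- exact: q_ge0.
- by rewrite map_inj_uniq ?filter_uniq ?uniq_window// => i j; lia.
- move=> m /mapP[j]; rewrite mem_filter /core => /andP[cj _] ->.
  have : (minn k (n.-1 - k) <= k)%N by exact: geq_minl.
  have : (minn k (n.-1 - k) <= n.-1 - k)%N by exact: geq_minr.
  by move: cj => /=; lia.
Qed.

End lower_bound.

(** * Passage to the limit in the lower bound *)

Section lower_limit.
Context {R : realType} {d} {T : measurableType d} (P : probability T R).
Local Notation mu := (@lebesgue_measure R).
Variable X : int -> {RV P >-> R}.
Hypothesis X_ge0 : forall m w, 0 <= X m w.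
Hypothesis X_law : forall m, log_mgf (X m) = log_mgf (X 0).
Hypothesis X_indep : mutually_independent X.
Local Notation La := (log_mgf (X 0)).
Variable h : int -> R.
Hypothesis h_ge0 : forall k, 0 <= h k.
Hypothesis h_fin : (l1norm h < +oo)%E.
Local Notation c := (fine (l1norm h)).
Hypothesis c_gt0 : 0 < c.
Variables (phi : R -> R) (B x : R).
Hypothesis mphi : measurable_fun unit_itv phi.
Hypothesis phi_bound : forall s, unit_itv s -> `|phi s| <= B.
Hypothesis phi_cont : forall s, 0 < s < 1 -> s != x -> {for s, continuous phi}.
Local Notation L := (\int[mu]_(s in unit_itv) La (c * phi s))%E.
Local Notation tco N k := (tcoef h phi N k.+1%:Z).

Let B0 : 0 <= B := phi_B_ge0 phi_bound.

Lemma tcoef_lower N m : - (c * B) <= tcoef h phi N m.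
Proof.
have := tcoef_scoef h_ge0 mphi phi_bound N m.
have := sum_h_col h_ge0 h_fin c_gt0 N m; rewrite -/(scoef h N m) => sc.
rewrite ler_norml => /andP[+ _]; apply: le_trans.
by rewrite lerN2 (mulrC c) ler_wpM2l.
Qed.

Lemma near_scale_lt (J : nat) (e : R) : 0 < e -> \forall N \near \oo, J.+1%:R < e * N.+1%:R.
Proof.
move=> e0; near=> N; rewrite mulrC -ltr_pdivrMr//.
apply: (@lt_trans _ _ N%:R); last by rewrite ltr_nat.
by near: N; exact: nbhs_infty_gtr.
Unshelve. all: by end_near. Qed.

(** Cells within J of k contribute at most e c; for those further away the difference is at most 2 B
    times the tail of h; the mass of h falling outside the n cells costs another B times the
    tail. *)
Lemma tcoef_bound N k (J : nat) (e s : R) :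
  (forall i, (i < N.+1)%N -> (`|i%:Z - k%:Z|%N <= J)%N -> `|ymean phi N i - phi s| <= e) ->
  unit_itv s -> 0 <= e -> (J <= k)%N -> (k + J < N.+1)%N ->
  `|tco N k - c * phi s| <= e * c + 3 * B * window_tail h J.
Proof.
move=> Hy Is e0 Jk kJ; set n := N.+1.
pose F (i : nat) := h (i.+1%:Z - k.+1%:Z).
have F0 i : 0 <= F i by exact: h_ge0.
have Fc : \sum_(i < n) F i <= c := sum_h_col h_ge0 h_fin c_gt0 N k.+1.
have FJ : c - window_tail h J <= \sum_(i < n) F i.
  rewrite /window_tail opprB addrC subrK.
  have -> : \sum_(i < n) F i = \sum_(j <- [seq i.+1%:Z - k.+1%:Z | i <- iota 0 n]) h j.
    by rewrite big_map -(big_mkord xpredT F) /index_iota subn0.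
  rewrite -lee_fin -!sumEFin; apply: le_sum_subset => //.
  - exact: uniq_window.
  - by rewrite map_inj_uniq ?iota_uniq// => i j; lia.
  - move=> m; rewrite mem_window => mJ; apply/mapP; exists `|(m + k%:Z)%R|%N; last by lia.
    by rewrite mem_iota /n; lia.
have Ftail : \sum_(i < n | (J < `|i%:Z - k%:Z|)%N) F i <= window_tail h J.
  rewrite -(big_mkord (fun i => (J < `|i%:Z - k%:Z|)%N) F) /index_iota subn0 -big_filter.
  have -> : \sum_(i <- [seq i <- iota 0 n | (J < `|i%:Z - k%:Z|)%N]) F i =
    \sum_(j <- [seq i.+1%:Z - k.+1%:Z | i <- iota 0 n & (J < `|i%:Z - k%:Z|)%N]) h j.
    by rewrite big_map.
  apply: sum_le_window_tail => //.
  - by rewrite map_inj_uniq ?filter_uniq ?iota_uniq// => i j; lia.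
  - by move=> m /mapP[i]; rewrite mem_filter => /andP[iJ _] ->; lia.
have -> : tco N k - c * phi s =
    \sum_(i < n) (ymean phi N i - phi s) * F i + phi s * (\sum_(i < n) F i - c).
  under [in RHS]eq_bigr do rewrite mulrBl.
  by rewrite big_split/= sumrN -mulr_sumr /tcoef; ring.
have Bs : `|phi s| <= B by exact: phi_bound.
have W0 := window_tail_ge0 h_ge0 h_fin J.
have t2 : `|phi s * (\sum_(i < n) F i - c)| <= B * window_tail h J.
  rewrite normrM ler_pM//.
  by rewrite distrC ger0_norm ?subr_ge0//; lra.
have t1 : `|\sum_(i < n) (ymean phi N i - phi s) * F i| <= e * c + 2 * B * window_tail h J.
  apply: le_trans (ler_norm_sum _ _ _) _.
  apply: (@le_trans _ _ (\sum_(i < n) (e * F i + 2 * B * (if (J < `|i%:Z - k%:Z|)%N then F i else 0)))).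
    apply: ler_sum => i _; rewrite normrM (ger0_norm (F0 i)).
    case: ltnP => iJ; last by rewrite mulr0 addr0 ler_wpM2r// Hy.
    rewrite -mulrDl ler_wpM2r//.
    apply: le_trans (ler_normB _ _) _.
    by have := ymean_bound mphi phi_bound (ltn_ord i); lra.
  rewrite big_split/= -!mulr_sumr -big_mkcond/=; apply: lerD.
    by rewrite ler_wpM2l.
  by rewrite ler_wpM2l// mulr_ge0.
by apply: le_trans (ler_normD _ _) _; lra.
Qed.

Lemma tcoef_cvg (s e : R) : 0 < s < 1 -> s != x -> 0 < e ->
  \forall N \near \oo, forall k, cell N k s -> `|tco N k - c * phi s| < e.
Proof.
move=> s01 sx e0; have /andP[s0 s1] := s01.
have Is : unit_itv s by rewrite /unit_itv/= in_itv/= !ltW.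
(* So that e1 c + 3 B e1 < e in the bound of [tcoef_bound]. *)
pose e1 := e / (2 * (c + 3 * B + 1)).
have d0 : 0 < c + 3 * B + 1 by move: B0 c_gt0; lra.
have e10 : 0 < e1 by rewrite divr_gt0// mulr_gt0.
have [J _ HJ] : \forall J \near \oo, window_tail h J <= e1.
  have := window_tail_cvg h_ge0 h_fin => /cvgrPdist_le/(_ e1 e10).
  by apply: filterS => J; rewrite sub0r normrN; apply: le_trans; exact: ler_norm.
have {}HJ := HJ J (leqnn J).
have /cvgrPdist_le/(_ e1 e10)/nbhs_ballP[dl /= dl0 Hd] := phi_cont s01 sx.
have s10 : 0 < 1 - s by rewrite subr_gt0.
(* Once J + 1 cells have length below p, the cells within J of k stay inside (0, 1) and within the
   radius of continuity of s. *)
have [p [p0 pd ps p1]] := exists_pos_lt3 dl0 s0 s10.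
near=> N => k cs.
have Jp : J.+1%:R < p * N.+1%:R by near: N; exact: near_scale_lt.
have n0 : 0 < N.+1%:R :> R by [].
have /cellP/andP[ks sk] := cs.
have Jk : (J <= k)%N.
  rewrite -ltnS -(ltr_nat R); apply: le_lt_trans sk.
  apply: (@le_trans _ _ J.+1%:R); first by rewrite ler_nat.
  by apply: le_trans (ltW Jp) _; rewrite ler_pM2r// ltW.
have kJ : (k + J < N.+1)%N.
  rewrite -(ltr_nat R) natrD.
  have h1 : p * N.+1%:R <= (1 - s) * N.+1%:R by rewrite ler_pM2r// ltW.
  by move: Jp h1; rewrite -[J.+1%:R]natr1 mulrBl mul1r; lra.
have W1 : 3 * B * window_tail h J <= 3 * B * e1 by rewrite ler_wpM2l// mulr_ge0.
apply: (@le_lt_trans _ _ (e1 * c + 3 * B * e1)); last first.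
  rewrite (_ : _ + _ = (c + 3 * B) * e1); last by ring.
  have ee : e1 * (2 * (c + 3 * B + 1)) = e by rewrite /e1 divfK// gt_eqF// mulr_gt0.
  have B3 : 0 <= (c + 3 * B) * e1 by rewrite mulr_ge0 ?ltW//; move: B0 c_gt0; lra.
  by rewrite -ee; lra.
apply: le_trans (tcoef_bound (k := k) (J := J) (e := e1) _ Is (ltW e10) Jk kJ) _; last first.
  by rewrite lerD2l.
move=> i iN ik; apply: cell_average_bound.
  exact: integrable_phi_cell mphi phi_bound _ _ iN.
move=> s' /cellP/andP[is' s'i]; rewrite distrC; apply: Hd; rewrite -ball_normE/=.
apply: le_lt_trans pd; rewrite -(ler_pM2r n0); apply: le_trans (ltW Jp).
have -> : `|s - s'| * N.+1%:R = `|s * N.+1%:R - s' * N.+1%:R|.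
  by rewrite -mulrBl normrM (ger0_norm (ltW n0)).
have iJ : i%:R <= k%:R + J%:R :> R by rewrite -natrD ler_nat; move: ik; clear; lia.
have kJ' : k%:R <= i%:R + J%:R :> R by rewrite -natrD ler_nat; move: ik; clear; lia.
move: ks sk is' s'i; rewrite -[J.+1%:R]natr1 -[k.+1%:R]natr1 -[i.+1%:R]natr1.
by rewrite ler_norml => *; apply/andP; split; lra.
Unshelve. all: by end_near. Qed.

Local Notation D := (lower_La X h B).

(* The step function whose integral is the mean of the shifted values of La at
   tcoef 1, ..., tcoef N.+1; Fatou is applied to it as N grows. *)
Definition step_La (N : nat) (s : R) : \bar R :=
  (\sum_(k < N.+1) (La (tco N k) + D%:E) * (\1_(cell N k) s)%:E)%E.

Lemma tcoef_shift_ge0 N k : (0 <= La (tco N k) + D%:E)%E.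
Proof.
have := lower_LaP X_ge0 c_gt0 phi_bound (tcoef_lower N k.+1).
by rewrite -leeBlDr// sub0e.
Qed.

Lemma step_LaE N k s : (k < N.+1)%N -> cell N k s ->
  (step_La N s = La (tco N k) + D%:E)%E.
Proof.
move=> kn cs; rewrite /step_La (bigD1 (Ordinal kn))//= indicE mem_set// mule1.
rewrite big1 ?adde0// => j jk; rewrite indicE memNset ?mule0// => cj.
by move/eqP: jk; apply; apply/val_inj; exact: cell_inj cj cs.
Qed.

Lemma step_La_ge0 N s : (0 <= step_La N s)%E.
Proof.
by apply: sume_ge0 => k _; rewrite mule_ge0 ?tcoef_shift_ge0// lee_fin indicE.
Qed.

Lemma measurable_step_La N : measurable_fun unit_itv (step_La N).
Proof.
apply: emeasurable_sum => k; apply: measurable_funeM; apply/measurable_EFinP.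
by apply: measurable_indic; exact: measurable_cell.
Qed.

Lemma integral_step_La N : (\int[mu]_(s in unit_itv) step_La N s =
  \sum_(k < N.+1) (La (tco N k) + D%:E) * (N.+1%:R^-1)%:E)%E.
Proof.
rewrite (ge0_integral_cells N) //; last 2 first.
- exact: measurable_step_La.
- by move=> s _; exact: step_La_ge0.
apply: eq_bigr => k _.
rewrite (eq_integral (cst (La (tco N k) + D%:E)%E)); last first.
  by move=> s; rewrite inE => cs; rewrite (step_LaE (ltn_ord k) cs).
rewrite integral_cst; last exact: measurable_cell.
by congr (_ * _)%E; exact: lebesgue_measure_cell.
Qed.

Lemma fatou_step_La : (L + D%:E <= limn_einf (fun N =>
  \sum_(k < N.+1) (La (tco N k) + D%:E) * (N.+1%:R^-1)%:E))%E.
Proof.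
rewrite (_ : (fun N => _) = (fun N => \int[mu]_(s in unit_itv) step_La N s)%E); last first.
  by apply/funext => N; rewrite integral_step_La.
have fat := @fatou _ _ _ mu unit_itv measurable01 step_La measurable_step_La
  (fun N s _ => step_La_ge0 N s).
apply: le_trans fat.
have mL : measurable_fun unit_itv (fun s => La (c * phi s)).
  exact: measurable_log_mgf_phi.
have D0 := lower_La_ge0 X_ge0 c_gt0 phi_bound.
rewrite -integral_shift//; last by move=> s Is; exact: (lower_La_phi X_ge0 c_gt0 phi_bound).
apply: ae_ge0_le_integral => //.
- move=> s Is; have := lower_La_phi X_ge0 c_gt0 phi_bound Is.
  by rewrite -leeBlDr// sub0e.
- exact: emeasurable_funD.
- move=> s _; apply: limn_einf_ge_near => v v0; apply: nearW => N.
  by apply: le_trans (ltW v0) _; exact: step_La_ge0.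
- under eq_fun do rewrite /limn_einf.
  apply: measurableT_comp => //; apply: measurable_fun_limn_esup => k.
  by apply: measurableT_comp => //; exact: measurable_step_La.
(* The end points and the possible discontinuity x of phi form the exceptional null set. *)
exists ([set 0; 1] `|` [set x]); split.
- by apply: measurableU => //; exact: measurableU.
- apply: countable_lebesgue_measure0; apply: finite_set_countable.
  by rewrite finite_setU; split; [exact: finite_set2|exact: finite_set1].
move=> s /= nE; apply: contrapT => /not_orP[/not_orP[s0 s1] sx]; apply: nE => Is.
have s01 : 0 < s < 1.
  move: Is; rewrite /unit_itv/= in_itv/= => /andP[s0' s1'].
  rewrite !lt_neqAle s0' s1' !andbT; apply/andP; split; apply/eqP => //.
  by move=> /esym.
have {}sx : s != x by apply/eqP.
apply: limn_einf_ge_near => v; rewrite -lteBlDr// -EFinB => /log_mgf_lsc[V cV HV].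
have /nbhs_ballP[e /= e0 eV] := cV.
have := tcoef_cvg s01 sx e0; apply: filterS => N HN.
have s01' : 0 <= s < 1 by have /andP[/ltW -> ->] := s01.
have [k kN cs] := cell_ex N s01'.
rewrite (step_LaE kN cs); apply: ltW; rewrite -lteBlDr// -EFinB; apply: HV; apply: eV.
by rewrite -ball_normE/= distrC; exact: HN.
Qed.

Hypothesis gamma_fin : forall N, {ae P, forall w, forall k, (k < N.+1)%N ->
  (gamma h X k.+1%:Z w < +oo)%E}.

(** Reversing the order of the cells identifies the two sums, and the Cesàro means of a null
    sequence vanish. *)
Lemma boundary_cost_cvg :
  N.+1%:R^-1 * boundary_cost X h B N @[N --> \oo] --> 0.
Proof.
have g1 : {ae P, forall w, (gamma h X 1 w < +oo)%E}.
  by apply: filterS (gamma_fin 0) => w /(_ 0%N isT).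
have qf := q_fin X_ge0 X_law X_indep h_ge0 B0 g1.
have q0 := q_ge0 X_ge0 h_ge0 B0.
have E N : N.+1%:R^-1 * boundary_cost X h B N =
    2 * (N.+1%:R^-1 * \sum_(k < N.+1) window_tail (fun j => psi X (B * h j)) k).
  rewrite /boundary_cost big_split/= mulrCA; congr (_ * _).
  rewrite [X in _ + X](reindex_inj rev_ord_inj)/= mulr_natl mulr2n; congr (_ + _).
  apply: eq_bigr => k _; congr (window_tail _ _).
  by have := ltn_ord k; clear; lia.
under eq_fun do rewrite E.
have h0 := @window_tail_mean_cvg R _ q0 qf.
have h2 : 2 * (N.+1%:R^-1 * \sum_(k < N.+1) window_tail (fun j => psi X (B * h j)) k)
  @[N --> \oo] --> (2 * 0 : R) by apply: cvgM => //; exact: cvg_cst.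
by rewrite mulr0 in h2; exact: h2.
Qed.

Lemma lower_rate (v : R) : (v%:E < L)%E -> \forall N \near \oo,
  (v%:E <= (scale N)%:E * lne (\int[P]_w
    (expR (\sum_(k < N.+1) fine (gamma h X k.+1%:Z w) * ymean phi N k))%:E))%E.
Proof.
move=> /lte_real_between[v' [vv']]; rewrite lte_fin in vv'.
have g1 : {ae P, forall w, (gamma h X 1 w < +oo)%E}.
  by apply: filterS (gamma_fin 0) => w /(_ 0%N isT).
have qf := q_fin X_ge0 X_law X_indep h_ge0 B0 g1.
move=> v'L; have : ((v' + D)%:E < L + D%:E)%E by rewrite EFinD lteD2rE.
move=> /lt_le_trans/(_ fatou_step_La)/near_lt_limn_einf near1.
have vv0 : 0 < v' - v by rewrite subr_gt0.
have /cvgrPdist_lt/(_ _ vv0) near2 := boundary_cost_cvg.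
apply: filterS2 near1 near2 => N h1 h2.
have n0 : 0 < N.+1%:R :> R by [].
have FN k : (k < N.+1)%N -> (-oo < (La (tco N k) + D%:E) * (N.+1%:R^-1)%:E)%E.
  by move=> _; apply: (@lt_le_trans _ _ 0%E) => //; rewrite mule_ge0 ?tcoef_shift_ge0// lee_fin.
have [a [aF va]] := choose_below FN h1.
(* Undoes the factor 1/n and the shift D; the core index m = k + 1 is sent back to the cell k. *)
pose a' (m : int) := N.+1%:R * a `|m|.-1%N - D.
have a'La m : core N m -> ((a' m)%:E < La (tcoef h phi N m))%E.
  move=> cm; have [k kN ->] : exists2 k : nat, (k < N.+1)%N & m = k.+1%:Z.
    by exists `|m|.-1%N; move: cm; rewrite /core; clear; lia.
  rewrite /a' EFinB lteBlDr// EFinM -lte_pdivlMl//= muleC; exact: aF.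
have := exp_ge_windows X_ge0 X_law X_indep h_ge0 h_fin B0 mphi phi_bound a'La
  (gamma_fin N) (sum_psi_scoef X_ge0 h_ge0 h_fin B0 N qf).
move=> h3; rewrite rate_ge; last by apply: integral_ge0 => w _; rewrite lee_fin expR_ge0.
apply: le_trans h3; rewrite lee_fin ler_expR.
have -> : \sum_(k < N.+1) a' k.+1%:Z = N.+1%:R * \sum_(k < N.+1) a k - N.+1%:R * D.
  by rewrite /a' big_split/= sumrN sumr_const card_ord mulr_sumr -[D *+ _]mulr_natl.
have h4 : boundary_cost X h B N <= N.+1%:R * (v' - v).
  rewrite -ler_pdivrMl//; move: h2; rewrite sub0r normrN => h2.
  by apply: le_trans (ler_norm _) (ltW h2).
have h5 : N.+1%:R * (v' + D) <= N.+1%:R * \sum_(k < N.+1) a k by rewrite ler_pM2l// ltW.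
by move: h4 h5; rewrite mulrBr mulrDr; lra.
Qed.

End lower_limit.

(** * The limit for Z, and the rate outside the domain of g *)

Section convolved_medium.
Context {R : realType} {d} {T : measurableType d} (P : probability T R).
Local Notation mu := (@lebesgue_measure R).
Variable h : int -> R.
Hypothesis h_ge0 : forall k, 0 <= h k.
Hypothesis h_fin : (l1norm h < +oo)%E.
Variable X : int -> {RV P >-> R}.
Hypothesis X_ge0 : forall m w, 0 <= X m w.
Hypothesis X_law : forall m, log_mgf (X m) = log_mgf (X 0).
Hypothesis X_indep : mutually_independent X.
Hypothesis gamma_pos : forall N, {ae P, forall w, forall k, (k < N.+1)%N ->
  0 < fine (gamma h X k.+1%:Z w)}.
Local Notation c := (fine (l1norm h)).

(** If h vanished identically, gamma_1 would be 0 everywhere, against its almost sure positivity. *)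
Lemma l1norm_gt0 : 0 < c.
Proof.
have c0 : 0 <= c by apply: fine_ge0; apply: esum_ge0 => k _; rewrite lee_fin.
rewrite lt_def c0 andbT; apply/negP => /eqP cE.
have l1E : l1norm h = 0%E.
  by rewrite -[LHS]fineK ?cE// ge0_fin_numE// esum_ge0// => k _; rewrite lee_fin.
have hk k : h k = 0.
  have : ((h k)%:E <= l1norm h)%E by apply: esum_ge; exists [set k]; [split|rewrite fsbig_set1].
  by rewrite l1E lee_fin => hk; apply/eqP; rewrite eq_le h_ge0 hk.
have [A [mA A0 HA]] := gamma_pos 0.
have := probability_setT P; rewrite (_ : setT = A).
  by move=> /eqP; rewrite A0 eq_sym onee_eq0.
apply/seteqP; split => // w _; apply: HA => /= /(_ 0%N isT).
rewrite /gamma (eq_esum (b := fun=> 0%E)) ?esum1 ?ltxx//.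
by move=> m _; rewrite hk mul0r.
Qed.

Lemma gamma_lty N : {ae P, forall w, forall k, (k < N.+1)%N ->
  (gamma h X k.+1%:Z w < +oo)%E}.
Proof. by apply: filterS (gamma_pos N) => w H k kn; apply/gam_pos_lty/H. Qed.

Section rate.
Variables (phi : R -> R) (B x : R).
Hypothesis mphi : measurable_fun unit_itv phi.
Hypothesis phi_bound : forall s, unit_itv s -> `|phi s| <= B.
Hypothesis phi_cont : forall s, 0 < s < 1 -> s != x -> {for s, continuous phi}.
Local Notation L := (\int[mu]_(s in unit_itv) log_mgf (X 0) (c * phi s))%E.
Local Notation Y N w :=
  (\sum_(k < N.+1) fine (gamma h X k.+1%:Z w) * ymean phi N k).

Lemma upper_rate (v : R) N : (L < v%:E)%E ->
  ((scale N)%:E * lne (\int[P]_w (expR (Y N w))%:E) <= v%:E)%E.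
Proof.
move=> Lv; have c0 := l1norm_gt0.
have Ly : (L < +oo)%E by apply: lt_trans Lv _; exact: ltry.
rewrite rate_le; last by apply: integral_ge0 => w _; rewrite lee_fin expR_ge0.
have mY : measurable_fun setT (fun w => Y N w).
  apply: measurable_sum => k; apply: measurable_funM => //; exact: measurable_gam.
have cY : {ae P, forall w,
    \sum_(m <- window M) tcoef h phi N m * X m w @[M --> \oo] --> Y N w}.
  by apply: filterS (gamma_lty N) => w gw; exact: cvg_gam_window.
have h1 := log_mgf_tcoef X_ge0 h_ge0 h_fin c0 mphi phi_bound N Ly.
have h2 := @cvg_emean_window _ _ _ P X h h_ge0 h_fin c0 phi N.
apply: le_trans (exp_le_windows X_law X_indep mY cY h1 h2) _.
rewrite lee_fin ler_expR -lee_fin (sum_emean X_ge0 c0 mphi phi_bound N Ly) EFinM.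
by rewrite lee_pmul2l ?lte_fin//; exact: ltW.
Qed.

Lemma rate_cvg : ((scale N)%:E * lne (\int[P]_w (expR (Y N w))%:E))%E @[N --> \oo] --> L.
Proof.
apply: cvge_real_bounds => v vL; first by apply: nearW => N; exact: upper_rate.
exact: (lower_rate X_ge0 X_law X_indep h_ge0 h_fin l1norm_gt0 mphi phi_bound phi_cont gamma_lty).
Qed.

End rate.

Variables (f : R -> R) (x : R).
Hypothesis f_meas : measurable_fun (`[0, 1] : set R) f.
Hypothesis f_L2 : mu.-integrable (`[0, 1] : set R) (fun t => (f t ^+ 2)%:E).
Local Notation L := (integrated_log_mgf (X 0) c (H f x)).

Lemma Z_rate_cvg (l : 'rV[R]_4) : ((scale N)%:E *
    lne ('E_P[fun w => expR ((scale N)^-1 * dot l (Z h X f x (scale N) w))])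
  @[N --> \oo] --> L l)%E.
Proof.
have Hb := H_boundP x f_meas f_L2.
have mH : measurable_fun unit_itv (fun s => dot l (H f x s)).
  by apply: measurable_dotG => i; exact: measurable_H.
have := rate_cvg mH (fun s Is => dotG_bound Hb l Is)
  (fun s s01 sx => @dotH_continuous _ _ _ f_meas f_L2 l s s01 sx).
apply: cvg_trans; apply: near_eq_cvg; apply: nearW => N.
have -> : ('E_P[fun w => expR ((scale N)^-1 * dot l (Z h X f x (scale N) w))] =
    \int[P]_w (expR (\sum_(k < N.+1) fine (gamma h X k.+1%:Z w) *
      ymean (fun s => dot l (H f x s)) N k))%:E)%E; last by [].
by rewrite unlock; apply: eq_integral => w _; rewrite /= (dot_Z h_ge0 X_ge0).
Qed.

Hypothesis x01 : 0 < x < 1.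
Local Notation La := (log_mgf (X 0)).

(** On (0, x) the argument is at most - c t by monotonicity; elsewhere it is nonpositive, where the
    log-moment generating function is at most 0. *)
Lemma integrated_axis_le (i : 'I_4) (t : R) : 0 <= t ->
  (forall s, \1_(`]0, x[ : set R) s <= H f x s 0 i) ->
  (L (- t *: delta_mx 0 i)%R <= (x * fine (La (- (c * t))))%:E)%E.
Proof.
move=> t0 Hi; have c0 := l1norm_gt0; have /andP[x0 x1] := x01.
have Hb := H_boundP x f_meas f_L2; have mH := measurable_H x f_meas f_L2.
have ct : - (c * t) <= 0 by rewrite oppr_le0 mulr_ge0// ltW.
have fL : La (- (c * t)) \is a fin_num by exact: log_mgf_neg_fin.
set r := fine (La (- (c * t))).
have r0 : r <= 0 by rewrite -lee_fin fineK// log_mgf_le0.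
pose l : 'rV[R]_4 := - t *: delta_mx 0 i.
have le1 s : (La (c * dot l (H f x s)) <= (r * \1_(`]0, x[ : set R) s)%:E)%E.
  rewrite dotZl dot_delta; have := Hi s; rewrite indicE; case: (_ \in _) => /= h1.
    rewrite mulr1 fineK//; apply: log_mgf_nondecreasing => //.
    by rewrite -mulrN ler_pM2l// mulNr lerN2 ler_peMr.
  rewrite mulr0 log_mgf_le0// mulNr mulrN oppr_le0 mulr_ge0 ?(ltW c0)// mulr_ge0//.
have m1 : measurable_fun unit_itv (fun s => (r * \1_(`]0, x[ : set R) s)%:E).
  apply/measurable_EFinP; apply: measurable_funM => //; exact: measurable_indic.
have i1 : (\int[mu]_(s in unit_itv) (r * \1_(`]0, x[ : set R) s)%:E = (x * r)%:E)%E.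
  under eq_integral do rewrite EFinM.
  rewrite integralZl//; last first.
    have [] // := @Rintegral_bounded R (\1_(`]0, x[ : set R)) 1 unit_itv.
    - by rewrite setDv measure0.
    - by move=> s _ _; rewrite ger0_norm; have /andP[] := indic_le1 (`]0, x[ : set R) s.
  rewrite integral_indic//; rewrite mulrC EFinM; congr (_ * _)%E.
  have -> : `]0, x[%classic `&` unit_itv = `]0, x[%classic :> set R.
    apply/seteqP; split => s /=; first by case.
    rewrite /unit_itv/= !in_itv/= => /andP[s0 sx]; split; first by rewrite s0.
    by rewrite !ltW//; exact: lt_trans x1.
  by have := lebesgue_measure_itv (R := R) `]0, x[; rewrite /= lte_fin x0 oppr0 adde0.
have D0 := lower_const_ge0 (X_ge0 0) (H_bound f) c0 (l1_ge0 l).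
have low s : unit_itv s -> ((- lower_const (X 0) c (H_bound f) (l1 l))%:E <= La (c * dot l (H f x s)))%E.
  by move=> Is; exact: (log_mgf_lower (X_ge0 0) c0 Hb (l1_ge0 l) Is).
rewrite -(@leeD2rE _ (lower_const (X 0) c (H_bound f) (l1 l))%:E)//.
rewrite (integrated_shift (X_ge0 0) c0 Hb mH (l1_ge0 l) (lexx _)) -i1.
rewrite -integral_shift//; last by move=> s Is; exact: le_trans (low s Is) (le1 s).
apply: ge0_le_integral01.
- by move=> s Is; exact: (shifted_ge0 (X_ge0 0) c0 Hb (l1_ge0 l) (lexx _) Is).
- by apply: emeasurable_funD => //; exact: measurable_log_mgf_dotG.
- exact: emeasurable_funD.
- by move=> s Is; rewrite leeD2r.
Qed.

(* As P (beta = 0) = 0, the log-moment generating function tends to -oo at -oo, so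
   that dot l z - L l is unbounded along the axis of a nonpositive z_3 or z_4. *)
Lemma legendre_off_g_dom : P (X 0 @^-1` [set 0]) = 0%E ->
  forall z, ~ g_dom z -> legendre L z = +oo%E.
Proof.
move=> P0 z nz; have c0 := l1norm_gt0; have /andP[x0 x1] := x01.
have [i [zi Hi]] : exists i : 'I_4, z 0 i <= 0 /\
    forall s, \1_(`]0, x[ : set R) s <= H f x s 0 i.
  have [z2|z2] := leP (z 0 (inord 2)) 0.
    by exists (inord 2); split => // s; rewrite H2E.
  have [z3|z3] := leP (z 0 (inord 3)) 0.
    by exists (inord 3); split => // s; rewrite H3E; have /andP[] := indic_le1 (`]0, x[ : set R) s.
  by exfalso; apply: nz.
apply/eqyP => A A0.
(* The division by x compensates the length of (0, x) in [integrated_axis_le]; t = k / c then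
   cancels the factor c in the argument. *)
have [k Hk] := log_mgfNy (X_ge0 0) P0 (- (A / x)).
have t0 : 0 <= k%:R / c by rewrite divr_ge0// ltW.
apply: (@le_trans _ _ ((dot (- (k%:R / c) *: delta_mx 0 i : 'rV[R]_4) z)%:E - L (- (k%:R / c) *: delta_mx 0 i)%R)%E); last first.
  by apply: ereal_sup_ubound; exists (- (k%:R / c) *: delta_mx 0 i).
have cE : c * (k%:R / c) = k%:R by rewrite mulrC divfK ?gt_eqF.
have := integrated_axis_le t0 Hi; rewrite cE.
have kn : - k%:R <= 0 :> R by rewrite oppr_le0.
have fL := log_mgf_neg_fin (X_ge0 0) kn.
move: Hk; rewrite -{1}(fineK fL) lte_fin => Hk.
rewrite dotZl dot_delta => Lle.
apply: (@le_trans _ _ (- (x * fine (La (- k%:R)))%:E)%E).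
  rewrite -EFinN lee_fin -mulrN.
  by rewrite -ler_pdivrMl// mulrC; lra.
have d0 : 0 <= - (k%:R / c) * z 0 i by rewrite mulNr oppr_ge0 mulr_ge0_le0.
rewrite -[leLHS]add0e; apply: leeD; first by rewrite lee_fin.
by rewrite leeN2.
Qed.

End convolved_medium.

(* Pxi is the conditional probability given the fixed value of xi. *)
Theorem theorem4p5 (R : realType) (d : measure_display) (T : measurableType d)
  (Pxi : probability T R)
  (h : int -> R) (h_ge0 : forall k, 0 <= h k) (h_fin : (l1norm h < +oo)%E)
  (beta : {RV Pxi >-> R}) (beta_ : int -> {RV Pxi >-> R})
  (beta_ge0 : forall m w, 0 <= beta_ m w)
  (beta_law : forall m (B : set R), measurable B ->
    distribution Pxi (beta_ m) B = distribution Pxi beta B)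
  (beta_indep : mutually_independent beta_)
  (gamma_def : convolution_well_defined h beta)
  (medium_bnd : forall N, {ae Pxi, forall w, exists nu1 nu2 : R, 0 < nu1 /\
    forall s, 0 < s < 1 -> nu1 <= medium_eps h beta_ (scale N) w s <= nu2})
  (f : R -> R) (f_meas : measurable_fun (`[0, 1] : set R) f)
  (f_L2 : (@lebesgue_measure R).-integrable (`[0, 1] : set R)
    (fun t => (f t ^+ 2)%:E))
  (u : R -> T -> R -> R)
  (u_sol : forall N, {ae Pxi, forall w,
    solves_bvp (medium_eps h beta_ (scale N) w) f (u (scale N) w)})
  (x : R) (x01 : 0 < x < 1)
  (u_meas : forall N, measurable_fun [set: T] (fun w => u (scale N) w x)) :
  let L := Lambda h beta f x in
  let Zx := Z h beta_ f x in
  let ux := fun eps w => u eps w x in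
  [/\ (forall l, (-oo < L l)%E) /\ econvex L,
      smooth_on (interior (effdom L)) (fine \o L),
      (forall t, (log_mgf beta t < +oo)%E) ->
        (forall l, (L l < +oo)%E) /\ smooth_on setT (fine \o L),
      forall l, ((scale N)%:E *
          lne ('E_Pxi[fun w => expR ((scale N)^-1 * dot l (Zx (scale N) w))])
        @[N --> \oo] --> L l)%E &
      interior (effdom L) 0 -> steep L ->
        [/\ good_rate_function (legendre L) /\ econvex (legendre L),
            ldp Pxi Zx (legendre L),
            good_rate_function (contracted_rate setT (legendre L)) /\
              ldp Pxi ux (contracted_rate setT (legendre L)) &
            Pxi (beta @^-1` [set 0]) = 0%E ->
              good_rate_function (contracted_rate g_dom (legendre L)) /\
              ldp Pxi ux (contracted_rate g_dom (legendre L))]].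
Proof.
move=> L Zx ux; have gpos N := gam_pos (medium_bnd N).
have lawX m : log_mgf (beta_ m) = log_mgf beta by apply: log_mgf_law; exact: beta_law.
have X_law m : log_mgf (beta_ m) = log_mgf (beta_ 0) by rewrite !lawX.
have c0 := l1norm_gt0 h_ge0 h_fin gpos.
have Hb := H_boundP x f_meas f_L2; have mH := measurable_H x f_meas f_L2.
(* The constant last coordinate of H supplies the direction of uniform shift that smoothness
   requires. *)
have e0H s : unit_itv s -> dot (delta_mx 0 (inord 3)) (H f x s) = 1.
  by move=> _; exact: dot_H3.
have X0 := beta_ge0 0.
have LE : L = integrated_log_mgf (beta_ 0) (fine (l1norm h)) (H f x).
  by apply/funext => l; rewrite /L /Lambda -(lawX 0).
have LN := integrated_gtNy X0 c0 Hb mH.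
have Lconv := integrated_convex X0 c0 Hb mH.
have Lsm := integrated_smooth X0 c0 Hb mH e0H.
have Lcvg := Z_rate_cvg h_ge0 h_fin beta_ge0 X_law beta_indep gpos f_meas f_L2.
rewrite LE; split => //.
  move=> bfin; have Lfin := integrated_fin X0 c0 Hb mH.
  rewrite -(lawX 0) in bfin; split; first exact: Lfin.
  have E : interior (effdom (integrated_log_mgf (beta_ 0) (fine (l1norm h)) (H f x))) = setT.
    rewrite (_ : effdom _ = setT) ?interiorT//.
    by apply/seteqP; split => // l _; exact: Lfin.
  by rewrite -E; exact: Lsm.
  by move=> l; exact: Lcvg.
move=> int0 Lsteep.
have L0 := integrated0 (beta_ 0) (fine (l1norm h)) (H f x).
have Jgood := legendre_good L0 LN int0.
have Jconv := econvex_legendre LN.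
have Zldp : ldp Pxi Zx (legendre (integrated_log_mgf (beta_ 0) (fine (l1norm h)) (H f x))).
  apply: gartner_ellis => //.
  - by move=> N; exact: (borel_measurable_Z h_ge0 beta_ge0 N x f_meas f_L2).
  - by move=> l; exact: Lcvg.
  - exact: (integrated_lsc X0 c0 Hb mH).
  - by move=> l v Il; exact: (integrated_derive_gradient X0 c0 Hb mH e0H v Il).
have ZK N : {ae Pxi, forall w, limit_cone (H_bound f) (Zx (scale N) w)}.
  by apply: aeW => w; exact: (Z_limit_cone h_ge0 beta_ge0 N x f_meas f_L2 w).
have mU N : borel_measurable (ux (scale N)).
  move=> U oU; rewrite -[X in measurable X]setTI; apply: u_meas => //.
  exact: open_measurable.
have UZ N : {ae Pxi, forall w, ux (scale N) w = g (Zx (scale N) w)}.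
  apply: filterS2 (gpos N) (u_sol N) => w gw sw.
  exact: (solves_bvp_g h_ge0 beta_ge0 f_meas f_L2 x01 gw sw).
have Kc : closed (limit_cone (H_bound f)) by exact: closed_limit_cone.
have gK : {within limit_cone (H_bound f), continuous (g : 'rV[R]_4 -> R)}.
  exact: within_continuous_g.
have Ugood := contracted_good Jgood Zldp Kc gK ZK.
have Uldp := contraction_ldp Zldp Kc gK ZK mU UZ.
split => // P0.
have P0' : Pxi (beta_ 0 @^-1` [set 0]) = 0%E.
  exact: etrans (beta_law 0 [set 0] (measurable_set1 0)) P0.
have off := legendre_off_g_dom h_ge0 h_fin beta_ge0 gpos f_meas f_L2 x01 P0'.
by rewrite (contracted_rate_g_dom off).
Qed.
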